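(* Let $n\ge1$ and fix an anti-isometry $\xi$ of $U^n$. The map $\theta:\Pi\to\mathcal{T}$, $M\mapsto(M,M^\perp(-1),\varphi(M))$, descends to bijections $$\overline{\Pi}\xrightarrow{\ \sim\ }\overline{\mathcal{T}},\qquad \overline{\Pi}/\xi\xrightarrow{\ \sim\ }\overline{\mathcal{T}}/\sigma .$$ These maps preserve discriminant and primitivity.
   Context: All lattices are even integral and non-degenerate: free abelian groups of finite rank with a non-degenerate symmetric integral bilinear form with $\langle x,x\rangle\in2\mathbb{Z}$. For $r\in\mathbb{Q}^\times$, $X(r)$ is $X$ with the form multiplied by $r$. The discriminant of a rank $m$ lattice is $(-1)^{m-1}$ times the determinant of its Gram matrix. A lattice $X$ is primitive (as an abstract lattice) if $m=1$ is the only positive integer such that $X(\frac1m)$ is even integral. $A_X=X^*/X$ is the discriminant group with its induced $\mathbb{Q}/2\mathbb{Z}$-valued quadratic form; isometries of discriminant groups preserve it; an isomorphism of lattices $f:X\to X'$ induces $f^*:A_X\to A_{X'}$. $U=\mathbb{Z}e\oplus\mathbb{Z}f$ with $\langle e,e\rangle=\langle f,f\rangle=0$, $\langle e,f\rangle=1$, and $U^n$ is the orthogonal sum of $n$ copies. A sublattice $M\subset U^n$ is a primitive sublattice if $U^n/M$ is torsion free. $\Pi$ is the set of rank $n$ (non-degenerate) primitive sublattices of $U^n$, and $\overline{\Pi}=\Pi/O(U^n)$. $M^\perp$ is the orthogonal complement in $U^n$. An anti-isometry $\xi$ of $U^n$ is an automorphism of the abelian group $U^n$ with $\langle\xi(x),\xi(x)\rangle=-\langle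 x,x\rangle$ for all $x$. The group generated by $O(U^n)$ and $\xi$ acts on $\Pi$, with $O(U^n)$ acting by $M\mapsto fM$ and $\xi$ acting by $M\mapsto M^\xi:=\xi(M)^\perp$; $\overline{\Pi}/\xi$ is the orbit space of $\Pi$ under this group. A triple $(X,Y,\varphi)$ consists of even lattices $X,Y$ of rank $n$ having the same signature, and an isometry $\varphi:A_Y\to A_X$; $\mathcal{T}$ is the collection of triples. $(X,Y,\varphi)$ and $(X',Y',\varphi')$ are properly equivalent if there are isomorphisms $f:X\to X'$, $g:Y\to Y'$ with $\varphi'=f^*\circ\varphi\circ(g^* )^{-1}$; $\overline{\mathcal{T}}$ is the set of proper equivalence classes. $\sigma$ is the involution $(X,Y,\varphi)\mapsto(Y,X,\varphi^{-1})$ on $\mathcal{T}$ and $\overline{\mathcal{T}}$, and $\overline{\mathcal{T}}/\sigma$ its orbit set. The discriminant of a triple is the common discriminant of $X$ and $Y$; a triple is primitive if $X$ and $Y$ are primitive as abstract lattices. The discriminant and primitivity of $M\in\Pi$ are those of $M$ as an abstract lattice. $\varphi(M):A_{M^\perp(-1)}\to A_M$ is the unique isometry with $U^n/(M\oplus M^\perp)=\{\varphi(M)(a)\oplus a\mid a\in M^\perp(-1)^*/M^\perp(-1)\}$, where $M^\perp(-1)^*$ is identified as a group with $(M^\perp)^*$. A map preserves discriminant and primitivity if an object and its image have the same discriminant, and an object is primitive if and only if its image is. *)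

(* Defs.v *)
From HB Require Import structures.
From Stdlib Require Import Relation_Operators.
From mathcomp Require Import all_boot all_order all_algebra.
From mathcomp Require Import boolp classical_sets.

Set Implicit Arguments.
Unset Strict Implicit.
Unset Printing Implicit Defensive.

Import GRing.Theory Num.Theory.
Local Open Scope ring_scope.

(* A lattice X is handled as a subgroup of a rational vector space carrying a
   rational symmetric bilinear form.  The ambient space plays the role of
   X (x) Q, but it may be larger than the rational span of X, so that
   sublattices of U^n live in the same space as U^n. *)
Record qlattice := QLattice {
  qspace : vectType rat;
  qform : qspace -> qspace -> rat;
  qform_sym : forall x y, qform x y = qform y x;
  qform_lin : forall x, scalar (qform x);
  qset :> zmodClosed qspace
}.

Lemma qformBl (X : qlattice) (x y z : qspace X) :
  qform (x - y) z = qform x z - qform y z.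
Proof.
rewrite !(@qform_sym X _ z) [x - y]addrC -scaleN1r.
by rewrite (@qform_lin X z) mulN1r addrC.
Qed.

Lemma qform0l (X : qlattice) (z : qspace X) : qform 0 z = 0.
Proof. by have := qformBl 0 0 z; rewrite !subrr. Qed.

Lemma qformZl (X : qlattice) a (x z : qspace X) :
  qform (a *: x) z = a * qform x z.
Proof.
have := @qform_lin X z a x 0.
by rewrite addr0 (qform_sym z 0) qform0l addr0 !(@qform_sym X z).
Qed.

Definition Zbasis (X : qlattice) (m : nat) (b : m.-tuple (qspace X)) : Prop :=
  free b /\
  forall x, x \in X <-> exists c : 'I_m -> int, x = \sum_i tnth b i *~ c i.

Definition even_integral (X : qlattice) : Prop :=
  (forall x y, x \in X -> y \in X -> qform x y \is a Num.int) /\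
  (forall x, x \in X -> exists k : int, qform x x = 2 * k%:~R).

Definition nondegenerate (X : qlattice) : Prop :=
  forall x, x \in X -> (forall y, y \in X -> qform x y = 0) -> x = 0.

Definition even_lattice (m : nat) (X : qlattice) : Prop :=
  [/\ exists b : m.-tuple (qspace X), Zbasis b,
      even_integral X & nondegenerate X].

Section Scale.
Variables (r : rat) (X : qlattice).

Definition scale_form (x y : qspace X) : rat := r * qform x y.

Lemma scale_form_sym x y : scale_form x y = scale_form y x.
Proof. by rewrite /scale_form qform_sym. Qed.

Lemma scale_form_lin x : scalar (scale_form x).
Proof.
by move=> a u v; rewrite /scale_form qform_lin mulrDr mulrCA.
Qed.

Definition scale : qlattice := QLattice scale_form_sym scale_form_lin X.
End Scale.

Definition primitive_lattice (X : qlattice) : Prop :=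
  forall m : nat, (0 < m)%N -> even_integral (scale (m%:R^-1) X) <-> m = 1%N.

Definition gram (X : qlattice) (m : nat) (b : m.-tuple (qspace X)) : 'M[rat]_m :=
  \matrix_(i, j) qform (tnth b i) (tnth b j).

Definition has_disc (X : qlattice) (d : rat) : Prop :=
  exists (m : nat) (b : m.-tuple (qspace X)),
    Zbasis b /\ d = (-1) ^+ m.-1 * \det (gram b).

(* The value does not depend on the basis; junk value 0 without a basis. *)
Definition disc (X : qlattice) : rat := xget 0 (has_disc X : set rat).

(* Diagonalisation over Q; by Sylvester's law p and q depend only on X. *)
Definition has_signature (X : qlattice) (p q : nat) : Prop :=
  exists (m : nat) (b : m.-tuple (qspace X)) (P : 'M[rat]_m) (d : 'rV[rat]_m),
    [/\ Zbasis b, P \in unitmx, P *m gram b *m P^T = diag_mx d,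
        (forall i, d 0 i != 0)
      & p = #|[set i | 0 < d 0 i]| /\ q = #|[set i | d 0 i < 0]|].

Definition same_signature (X Y : qlattice) : Prop :=
  exists p q, has_signature X p q /\ has_signature Y p q.

(* The dual lattice X^*, inside the rational span of X. *)
Section Dual.
Variable X : qlattice.

Definition dual_pred : {pred qspace X} := fun v =>
  `[< (exists2 k : int, k != 0 & v *~ k \in X) /\
      forall x, x \in X -> qform v x \is a Num.int >].

Lemma dual_zmod_closed : zmod_closed dual_pred.
Proof.
split.
  apply/asboolP; split; first by exists 1; rewrite ?mul0rz ?rpred0.
  by move=> x _; rewrite qform0l.
move=> u v /asboolP[[k k0 ku] Hu] /asboolP[[l l0 lv] Hv]; apply/asboolP; split.
  exists (k * l); first by rewrite mulf_neq0.
  rewrite mulrzBl; apply: rpredB; first by rewrite mulrzA rpredMz.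
  by rewrite [k * l]mulrC mulrzA rpredMz.
by move=> x xX; rewrite qformBl rpredB ?Hu ?Hv.
Qed.

HB.instance Definition _ := GRing.isZmodClosed.Build (qspace X) dual_pred
  dual_zmod_closed.

Record dual := Dual {dual_val : qspace X; dual_valP : dual_val \in dual_pred}.

HB.instance Definition _ := [isSub for dual_val].
HB.instance Definition _ := [Choice of dual by <:].
HB.instance Definition _ := [SubChoice_isSubZmodule of dual by <:].

Definition dual_lat : {pred dual} := fun a => dual_val a \in X.

Lemma dual_lat_closed : zmod_closed dual_lat.
Proof.
split; first by rewrite unfold_in; apply: rpred0.
by move=> a b; rewrite !unfold_in => aX bX; apply: rpredB.
Qed.

HB.instance Definition _ := GRing.isZmodClosed.Build dual dual_lat
  dual_lat_closed.

(* The discriminant group A_X = X^*/X; for even X the subgroup X is contained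
   in X^*. *)
Definition discr : zmodType := Quotient.quot dual_lat.

End Dual.

Arguments dual_pred : clear implicits.
Arguments dual_lat : clear implicits.

Definition evenZ : {pred rat} := fun r => r / 2 \is a Num.int.

Lemma evenZ_closed : zmod_closed evenZ.
Proof.
by split=> [|x y]; rewrite !unfold_in ?mul0r // mulrBl; apply: rpredB.
Qed.

HB.instance Definition _ := GRing.isZmodClosed.Build rat evenZ evenZ_closed.

Definition Qmod2Z : zmodType := Quotient.quot evenZ.

Definition discr_form (X : qlattice) (a : discr X) : Qmod2Z :=
  \pi_(Quotient.quot evenZ)%qT
    (qform (dual_val (repr a)) (dual_val (repr a))).

Record discr_isometry (Y X : qlattice) := DiscrIsometry {
  disc_fun :> discr Y -> discr X;
  disc_inv : discr X -> discr Y;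
  disc_funK : cancel disc_fun disc_inv;
  disc_invK : cancel disc_inv disc_fun;
  disc_additive : zmod_morphism disc_fun;
  disc_isometry : forall a, discr_form (disc_fun a) = discr_form a
}.

(* Isomorphisms X -> X' of groups are represented by linear maps of the ambient
   spaces; only their restriction to the span of X matters. *)
Definition group_iso (X X' : qlattice) (f : {linear qspace X -> qspace X'}) :
    Prop :=
  {in X &, injective f} /\
  (forall y, y \in X' <-> exists2 x, x \in X & y = f x).

Definition lattice_iso (X X' : qlattice) (f : {linear qspace X -> qspace X'}) :
    Prop :=
  group_iso f /\
  (forall x y, x \in X -> y \in X -> qform (f x) (f y) = qform x y).

Section InducedMap.
Variables (X X' : qlattice) (f : {linear qspace X -> qspace X'}).
Hypothesis f_iso : lattice_iso f.

Lemma dual_map_subproof (a : dual X) : f (dual_val a) \in dual_pred X'.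
Proof.
case: f_iso => -[_ f_im] f_form; case: a => v /= /asboolP[[k k0 kv] vint].
apply/asboolP; split.
  by exists k => //; apply/f_im; exists (v *~ k); rewrite // raddfMz.
move=> _ /f_im[x xX ->].
have k0' : k%:~R != 0 :> rat by rewrite intr_eq0.
suff -> : qform (f v) (f x) = qform v x by apply: vint.
apply: (mulfI k0'); rewrite -!qformZl -linearZ /= !scaler_int.
exact: f_form.
Qed.

Definition dual_map (a : dual X) : dual X' := Dual (dual_map_subproof a).

(* f^* : A_X -> A_X', the class of a being sent to the class of f a. *)
Definition discr_map (a : discr X) : discr X' :=
  \pi_(Quotient.quot (dual_lat X'))%qT (dual_map (repr a)).

End InducedMap.

(* U^n as the orthogonal sum of n copies of U: row i of an n x 2 matrix holds
   the coordinates (e, f) in the i-th copy. *)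
Section Hyperbolic.
Variable n : nat.

Definition hyp_form (x y : 'M[rat]_(n, 2)) : rat :=
  \sum_(i < n) (x i 0 * y i 1 + x i 1 * y i 0).

Lemma hyp_form_sym x y : hyp_form x y = hyp_form y x.
Proof.
by apply: eq_bigr => i _; rewrite addrC mulrC [X in _ + X]mulrC.
Qed.

Lemma hyp_form_lin x : scalar (hyp_form x).
Proof.
move=> a u v; rewrite /hyp_form mulr_sumr -big_split /=; apply: eq_bigr => i _.
by rewrite !mxE !mulrDr !(mulrCA _ a) addrACA.
Qed.

Definition int_vect : {pred 'M[rat]_(n, 2)} := fun x =>
  x \is a mxOver Num.int.

Lemma int_vect_closed : zmod_closed int_vect.
Proof.
split=> [|x y /mxOverP xZ /mxOverP yZ]; apply/mxOverP => i j; rewrite !mxE //.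
exact: rpredB.
Qed.

HB.instance Definition _ := GRing.isZmodClosed.Build 'M[rat]_(n, 2) int_vect
  int_vect_closed.

Definition hyp : qlattice :=
  QLattice hyp_form_sym hyp_form_lin int_vect.

Definition sublattice (M : zmodClosed 'M[rat]_(n, 2)) : qlattice :=
  QLattice hyp_form_sym hyp_form_lin M.

Definition perp_pred (M : zmodClosed 'M[rat]_(n, 2)) :
    {pred 'M[rat]_(n, 2)} := fun x =>
  `[< x \in hyp /\ forall y, y \in M -> hyp_form x y = 0 >].

Lemma perp_closed M : zmod_closed (perp_pred M).
Proof.
split.
  apply/asboolP; split=> [|y _]; [exact: rpred0 | exact: (@qform0l hyp)].
move=> x y /asboolP[xU xM] /asboolP[yU yM]; apply/asboolP; split.
  exact: rpredB.
by move=> z zM; rewrite [LHS](@qformBl hyp) /= xM // yM // subrr.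
Qed.

HB.instance Definition _ M := GRing.isZmodClosed.Build 'M[rat]_(n, 2)
  (perp_pred M) (perp_closed M).

Definition perp M : qlattice := sublattice (perp_pred M).

Record primsub := PrimSub {
  psub :> zmodClosed 'M[rat]_(n, 2);
  psub_sub : forall x, x \in psub -> x \in hyp;
  psub_torsionfree : forall x (k : int),
    x \in hyp -> k != 0 -> x *~ k \in psub -> x \in psub;
  psub_even_lattice : even_lattice n (sublattice psub)
}.

Definition O_equiv (M M' : primsub) : Prop :=
  exists2 f : {linear qspace hyp -> qspace hyp}, lattice_iso f &
    forall y, y \in psub M' <-> exists2 x, x \in psub M & y = f x.

Definition anti_isometry (xi : {linear qspace hyp -> qspace hyp}) : Prop :=
  group_iso xi /\
  (forall x, x \in hyp -> hyp_form (xi x) (xi x) = - hyp_form x x).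

Definition is_xi_image (xi : {linear qspace hyp -> qspace hyp})
    (M M' : primsub) : Prop :=
  forall y, y \in psub M' <->
    y \in hyp /\ forall x, x \in psub M -> hyp_form y (xi x) = 0.

(* Orbits of the group generated by O(U^n) and xi: the equivalence relation
   generated by the action of the generators. *)
Definition O_xi_equiv (xi : {linear qspace hyp -> qspace hyp}) :
    primsub -> primsub -> Prop :=
  clos_refl_sym_trans _ (fun M M' => O_equiv M M' \/ is_xi_image xi M M').

Record triple := Triple {
  tX : qlattice;
  tY : qlattice;
  tX_even : even_lattice n tX;
  tY_even : even_lattice n tY;
  t_sign : same_signature tX tY;
  tphi : discr_isometry tY tX
}.

(* The last condition is phi' o g^* = f^* o phi; the induced map g^* is
   bijective. *)
Definition proper_equiv (t t' : triple) : Prop :=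
  exists (f : {linear qspace (tX t) -> qspace (tX t')})
         (g : {linear qspace (tY t) -> qspace (tY t')})
         (f_iso : lattice_iso f) (g_iso : lattice_iso g),
    forall a, tphi t' (discr_map g_iso a) = discr_map f_iso (tphi t a).

Lemma same_signature_sym X Y : same_signature X Y -> same_signature Y X.
Proof. by case=> p [q [HX HY]]; exists p, q. Qed.

Definition inv_isometry X Y (phi : discr_isometry Y X) : discr_isometry X Y.
Proof.
exists (disc_inv phi) (disc_fun phi).
- exact: disc_invK.
- exact: disc_funK.
- move=> a b; apply: (can_inj (disc_funK phi)).
  by rewrite (disc_additive phi) !disc_invK.
- by move=> a; rewrite -(disc_isometry phi) disc_invK.
Defined.

Definition sigma (t : triple) : triple :=
  Triple (tY_even t) (tX_even t) (same_signature_sym (t_sign t))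
    (inv_isometry (tphi t)).

(* The sigma-orbits on proper equivalence classes, as classes of triples. *)
Definition sigma_equiv : triple -> triple -> Prop :=
  clos_refl_sym_trans _ (fun t t' => proper_equiv t t' \/ t' = sigma t).

Definition triple_has_disc (t : triple) (d : rat) : Prop :=
  disc (tX t) = d /\ disc (tY t) = d.

Definition triple_primitive (t : triple) : Prop :=
  primitive_lattice (tX t) /\ primitive_lattice (tY t).

(* U^n/(M + M^perp) as a subgroup of A_M x A_(M^perp(-1)): the classes of the
   decompositions x = b + a of the elements of U^n. *)
Definition glue (M : primsub) :
    set (discr (sublattice M) * discr (scale (-1) (perp M))) :=
  fun p => exists (b : dual (sublattice M)) (a : dual (scale (-1) (perp M))),
    [/\ p.1 = \pi_(Quotient.quot (dual_lat (sublattice M)))%qT b,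
        p.2 = \pi_(Quotient.quot (dual_lat (scale (-1) (perp M))))%qT a
      & (dual_val b : 'M[rat]_(n, 2)) + (dual_val a : 'M[rat]_(n, 2)) \in hyp].

(* t = (M, M^perp(-1), phi(M)); the graph condition determines phi(M). *)
Definition is_theta (M : primsub) (t : triple) : Prop :=
  exists (hX : even_lattice n (sublattice M))
         (hY : even_lattice n (scale (-1) (perp M)))
         (hs : same_signature (sublattice M) (scale (-1) (perp M)))
         (phi : discr_isometry (scale (-1) (perp M)) (sublattice M)),
    @glue M = [set p | p.1 = phi p.2]%classic /\ t = Triple hX hY hs phi.

End Hyperbolic.

(* R is meant to be an equivalence relation.  Predicates are written T -> Prop
   because the type of triples is too large for the universe of [set]. *)
Definition classes (T : Type) (R : T -> T -> Prop) : Type :=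
  {C : T -> Prop | exists x, C = R x}.

Definition class_of (T : Type) (R : T -> T -> Prop) (x : T) : classes R :=
  exist _ (R x) (ex_intro _ x erefl).

Definition preserves (n : nat) (R : primsub n -> primsub n -> Prop)
    (S : triple n -> triple n -> Prop) (F : classes R -> classes S) : Prop :=
  forall (C : classes R) (M : primsub n) (t : triple n),
    sval C M -> sval (F C) t ->
    triple_has_disc t (disc (sublattice M)) /\
    (primitive_lattice (sublattice M) <-> triple_primitive t).

Definition descends_to_bijection (n : nat) (theta : primsub n -> triple n)
    (R : primsub n -> primsub n -> Prop) (S : triple n -> triple n -> Prop)
    (F : classes R -> classes S) : Prop :=
  (forall M, F (class_of R M) = class_of S (theta M)) /\ bijective F.

(* Main.v *)
(* Injectivity is the gluing argument: a proper equivalence (f, g) between the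
   triples of M and M' defines an isometry f (+) g of the rational span of U^n,
   and compatibility with phi says that it preserves U^n.  For surjectivity, the
   graph of phi in A_Y(-1) x A_X defines an even unimodular overlattice L of
   X (+) Y(-1) of signature (n, n), and an isometry from L to U^n carries X to
   the desired M.  Finally, xi induces isometries from M^perp(-1) to M^xi and
   from M to (M^xi)^perp(-1), which exchange phi and its inverse.

   That L is isometric to U^n comes down to finding an isotropic vector in L,
   since a primitive isotropic vector splits off a copy of U.  Isotropy follows
   from Tate's computation of the Witt group of Q: the class of L has trivial
   residues at all primes, so descending over the primes p it is represented by
   diagonal forms with ever smaller prime factors, and finally by a sum of
   <1> and <-1>, which vanishes because the signature does. *)

Require Import Defs.
From HB Require Import structures.
From Stdlib Require Import Relation_Operators.
From mathcomp Require Import all_boot all_order all_algebra.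
From mathcomp Require Import boolp classical_sets.
From mathcomp Require Import perm.
From mathcomp Require Import ring lra zify.

Import GRing.Theory Num.Theory Order.TTheory.
Local Open Scope ring_scope.
Set Implicit Arguments.
Unset Strict Implicit.
Unset Printing Implicit Defensive.

(** * Congruence of rational diagonal forms *)

(** The Witt group of [F_p] is never built: a homomorphism out of it is represented by a function on
    [F_p], with values in any abelian group, satisfying the Witt relations. Arbitrary targets are
    needed because Tate's inverse of the residue at [p] only exists modulo the classes of integers
    with prime factors below [p]. The residues of a unimodular form vanish because for odd [p] it
    has a diagonal form with unit entries over the localization of [Z] at [p]; at 2 its determinant
    suffices. Evenness of the overlattice enters when the partner of an isotropic vector is made
    isotropic too.

    On the side of [U^n], a basis of [M] extends to a basis [S] of [U^n], and half of the basis dual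
    to [S] spans the complement. The Gram matrix of [M] is thus a block of a unimodular matrix, and
    that of the complement is the opposite block of the inverse. Complementary minors then give
    equal discriminants, and a computation with the blocks modulo [m] carries divisibility of the
    even form by [m] from one side to the other. *)

Definition diag_seq (m : nat) (s : seq rat) : 'M[rat]_m :=
  diag_mx (\row_(i < m) s`_i).

Definition nonzeros (s : seq rat) : bool := all (fun a => a != 0) s.

(** Forms are sequences of diagonal entries, so that orthogonal sums are concatenations and
    dimensions need no casts. *)
Definition cong (s t : seq rat) : Prop :=
  exists m (P : 'M[rat]_m),
    [/\ size s = m, size t = m, P \in unitmx
      & P *m diag_seq m s *m P^T = diag_seq m t].

Lemma cong_refl s : cong s s.
Proof.
by exists (size s), 1%:M; split; rewrite ?unitmx1 // trmx1 mulmx1 mul1mx.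
Qed.

Lemma cong_sym s t : cong s t -> cong t s.
Proof.
move=> [m [P [es et uP HP]]]; exists m, (invmx P); split=> //.
  by rewrite unitmx_inv.
rewrite -HP -!mulmxA trmx_inv mulKmx // mulmxV ?mulmx1 //.
by rewrite unitmx_tr.
Qed.

Lemma cong_trans s t u : cong s t -> cong t u -> cong s u.
Proof.
move=> [m [P [es et uP HP]]] [m' [Q [et' eu uQ HQ]]].
have em : m' = m by rewrite -et' et.
move: Q uQ HQ eu et'; rewrite em => Q uQ HQ eu et'; exists m, (Q *m P); split=> //;
  first by rewrite unitmx_mul uQ.
by rewrite trmx_mul -HQ -HP !mulmxA.
Qed.

Lemma diag_seq_cat m1 m2 s t : size s = m1 ->
  diag_seq (m1 + m2) (s ++ t) = block_mx (diag_seq m1 s) 0 0 (diag_seq m2 t).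
Proof.
move=> es; rewrite /diag_seq -diag_mx_row; congr diag_mx.
apply/rowP => i; case: (split_ordP i) => j ->.
  by rewrite row_mxEl !mxE nth_cat es /= ltn_ord.
by rewrite row_mxEr !mxE nth_cat es /= ltnNge leq_addr /= addKn.
Qed.

Lemma diag_seq_cons m a s :
  diag_seq (1 + m) (a :: s) = block_mx a%:M 0 0 (diag_seq m s).
Proof.
rewrite -cat1s diag_seq_cat //; congr block_mx.
by apply/matrixP => i j; rewrite !ord1 !mxE.
Qed.

Lemma cong_cat s t s' t' : cong s t -> cong s' t' -> cong (s ++ s') (t ++ t').
Proof.
move=> [m [P [es et uP HP]]] [m' [Q [es' et' uQ HQ]]].
exists (m + m')%N, (block_mx P 0 0 Q); split; rewrite ?size_cat ?es ?et ?es' ?et' //.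
  by rewrite unitmxE det_ublock unitrM -!unitmxE uP.
by rewrite !diag_seq_cat // tr_block_mx !mulmx_block !trmx0 !(mulmx0, mul0mx, addr0,
  add0r) HP HQ.
Qed.

Lemma cong_perm s t : perm_eq s t -> cong s t.
Proof.
move=> st; have /perm_size es := st.
have [q Hq] : exists q : 'S_(size t), s = [tuple tnth (in_tuple t) (q i) | i < size t].
  by apply/(@tuple_permP _ (size t) s (in_tuple t)).
apply: cong_sym.
exists (size t), (perm_mx q); split=> //; first by rewrite unitmx_perm.
rewrite tr_perm_mx -[_ *m perm_mx _]col_permE.
rewrite -row_permE.
apply/matrixP => i j; rewrite !mxE (inj_eq perm_inj); congr (_ *+ _).
by rewrite Hq /= (nth_map i) ?size_enum_ord // nth_ord_enum (tnth_nth 0).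
Qed.

(** The base change has rows [(x, y)] and [(z, w)]; the hypotheses are its invertibility, the values
    of the form on the rows and their orthogonality. *)
Lemma cong2 (a b c d x y z w : rat) : x * w - y * z != 0 ->
  a * x ^+ 2 + b * y ^+ 2 = c -> a * z ^+ 2 + b * w ^+ 2 = d ->
  a * x * z + b * y * w = 0 -> cong [:: a; b] [:: c; d].
Proof.
move=> nd ec ed e0.
pose mk (l : seq (seq rat)) : 'M[rat]_2 := \matrix_(i, j) (nth [::] l i)`_j.
pose P := mk [:: [:: x; y]; [:: z; w]].
pose k := (x * w - y * z)^-1.
exists 2%N, P; split => //.
  apply: (proj1 (@mulmx1_unit _ _ P (mk [:: [:: w * k; - y * k]; [:: - z * k; x * k]]) _)).
  apply/matrixP => i j; rewrite !mxE !big_ord_recl big_ord0 !mxE.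
  by case: i j => -[|[|//]] ? [[|[|//]] ?] /=; rewrite /k; field.
apply/matrixP => i j; rewrite !mxE !big_ord_recl big_ord0 !mxE.
rewrite !big_ord_recl !big_ord0 !mxE /=.
case: i j => -[|[|//]] ? [[|[|//]] ?] /=; rewrite ?mulr0n ?mulr1n.
- by rewrite -ec; ring.
- by rewrite -[RHS]e0; ring.
- by rewrite -[RHS]e0; ring.
- by rewrite -ed; ring.
Qed.

(** The vector [(1, 1)] has value [a + b], and [(- b, a)] is orthogonal to it. *)
Lemma cong_add a b : a + b != 0 -> cong [:: a; b] [:: a + b; a * b * (a + b)].
Proof.
by move=> nz; apply: (@cong2 _ _ _ _ 1 1 (- b) a);
  [rewrite mul1r mulrN opprK addrC mul1r addrC| ring..].
Qed.

(** The form is [a (x + y) (x - y)], so the vector with [x + y = 1] and [x - y = a^-1] has value 1;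
    exchanging its coordinates gives an orthogonal vector of value -1. *)
Lemma cong_opp a : a != 0 -> cong [:: a; - a] [:: 1; -1].
Proof.
move=> nz; apply: (@cong2 _ _ _ _ ((1 + a^-1) / 2) ((1 - a^-1) / 2)
  ((1 - a^-1) / 2) ((1 + a^-1) / 2)); try by field.
by rewrite (_ : _ - _ = a^-1) ?invr_eq0 //; field.
Qed.

Lemma cong_sq a b : b != 0 -> cong [:: a] [:: a * b ^+ 2].
Proof.
move=> nz; exists 1%N, b%:M; split=> //.
  by rewrite unitmxE det_scalar1 unitfE.
apply/matrixP => i j; rewrite tr_scalar_mx mul_scalar_mx mul_mx_scalar !mxE.
by rewrite !ord1 /= !mulr1n; ring.
Qed.

Lemma diag_seq_unit m s : size s = m ->
  nonzeros s -> diag_seq m s \in unitmx.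
Proof.
move=> es /allP nz; rewrite unitmxE det_diag unitfE.
apply/prodf_neq0 => i _; rewrite mxE; apply: nz; apply: mem_nth.
by rewrite es.
Qed.

(* Write P = [[x, be], [ga, de]]; then Q = de + k ga be works as soon as
   k^2 (1 - x^2) - 2 k x = 1, that is (k (1 - x) - 1) (k (1 + x) + 1) = 0. *)
Lemma witt_cancel m (a : rat) (P : 'M[rat]_(1 + m)) (C1 C2 : 'M[rat]_m) :
  C2 \in unitmx ->
  P *m block_mx a%:M 0 0 C1 *m P^T = block_mx a%:M 0 0 C2 ->
  exists2 Q : 'M[rat]_m, Q \in unitmx & Q *m C1 *m Q^T = C2.
Proof.
move=> uC2; rewrite -[P]submxK.
set al := ulsubmx P; set be := ursubmx P.
set ga := dlsubmx P; set de := drsubmx P.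
have [x ->] : exists x, al = x%:M by exists (al 0 0); exact: mx11_scalar.
rewrite tr_block_mx !mulmx_block !(mulmx0, addr0, add0r).
rewrite tr_scalar_mx.
case/eq_block_mx => H1 H2 H3 H4.
have {}H1 : be *m C1 *m be^T = (a - a * x ^+ 2)%:M.
  move: H1 => /(canRL (addKr _)) ->; rewrite -!scalar_mxM -raddfN -raddfD /=.
  by congr _%:M; ring.
have {}H2 : be *m C1 *m de^T = - (a * x) *: ga^T.
  move: H2 => /(canRL (addKr _)) ->; rewrite -scalar_mxM mul_scalar_mx addr0 scaleNr.
  by rewrite mulrC.
have {}H3 : de *m C1 *m be^T = - (a * x) *: ga.
  move: H3 => /(canRL (addKr _)) ->.
  by rewrite mul_mx_scalar mul_mx_scalar scalerA addr0 scaleNr mulrC.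
have {}H4 : de *m C1 *m de^T = C2 - a *: (ga *m ga^T).
  move: H4 => /(canRL (addKr _)) ->; rewrite addrC mul_mx_scalar.
  by rewrite -scalemxAl.
have [k Hk] : exists k, k ^+ 2 * (1 - x ^+ 2) - 2 * k * x - 1 = 0.
  have [x1|x1] := eqVneq x 1; last by exists (1 - x)^-1; field; rewrite subr_eq0 eq_sym.
  by exists (- (1 + x)^-1); rewrite x1; field.
pose Q := de + k *: (ga *m be).
have HQ : Q *m C1 *m Q^T = C2.
  have -> : Q^T = de^T + k *: (be^T *m ga^T).
    by rewrite /Q linearD linearZ /= trmx_mul.
  rewrite /Q !mulmxDl !mulmxDr -!scalemxAl -!scalemxAr.
  have e1 : ga *m be *m C1 *m de^T = - (a * x) *: (ga *m ga^T).
    by rewrite -!mulmxA (mulmxA be) H2 -scalemxAr.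
  have e2 : de *m C1 *m (be^T *m ga^T) = - (a * x) *: (ga *m ga^T).
    by rewrite !mulmxA H3 -scalemxAl.
  have e3 : ga *m be *m C1 *m (be^T *m ga^T) = (a - a * x ^+ 2) *: (ga *m ga^T).
    by rewrite -!mulmxA (mulmxA C1) (mulmxA be) (mulmxA be) H1 mul_scalar_mx -scalemxAr.
  rewrite e1 e2 e3 H4 !scalerA -!addrA -scaleNr -!scalerDl.
  rewrite -[RHS]addr0 -[in RHS](scale0r (ga *m ga^T)); congr (_ + _ *: _).
  by rewrite -[RHS](mulr0 a) -Hk; ring.
exists Q => //; have : Q *m C1 *m Q^T \in unitmx by rewrite HQ.
by rewrite !unitmx_mul => /andP[/andP[]].
Qed.

Lemma cong_cancel a s t : a != 0 -> nonzeros t ->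
  cong (a :: s) (a :: t) -> cong s t.
Proof.
move=> a0 nzt [m [P [es et uP HP]]].
case: m P es et uP HP => // m P [es] [et] uP.
rewrite -[m.+1]/(1 + m)%N in P uP *.
rewrite !diag_seq_cons => /witt_cancel[|Q uQ HQ]; first exact: diag_seq_unit.
by exists m, Q.
Qed.

(* The defining relations of the Witt group: functions satisfying them extend
   to homomorphisms on Witt classes of diagonal forms. *)
Definition witt_fun (F : fieldType) (A : zmodType) (f : F -> A) : Prop :=
  [/\ forall a b, a != 0 -> b != 0 -> f (a * b ^+ 2) = f a,
      forall a, a != 0 -> f a + f (- a) = 0
    & forall a b, a != 0 -> b != 0 -> a + b != 0 ->
        f a + f b = f (a + b) + f (a * b * (a + b))].

Definition wsum (A : zmodType) (f : rat -> A) (s : seq rat) : A :=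
  \sum_(a <- s) f a.

Lemma nonzeros_cat s t : nonzeros (s ++ t) = nonzeros s && nonzeros t.
Proof. exact: all_cat. Qed.

Section WittFun.
Variables (A : zmodType) (f : rat -> A).
Hypothesis wf : witt_fun f.

Lemma wsum_cat s t : wsum f (s ++ t) = wsum f s + wsum f t.
Proof. exact: big_cat. Qed.

Lemma wsum_cons a s : wsum f (a :: s) = f a + wsum f s.
Proof. exact: big_cons. Qed.

Lemma wsum_nil : wsum f [::] = 0.
Proof. exact: big_nil. Qed.

(** A value [c] can be brought to the front by square-class changes, permutations and the binary
    relation of [cong_add], and [wsum f] is invariant under each of these moves. *)
Lemma represented s (x : nat -> rat) (c : rat) : nonzeros s -> c != 0 ->
  c = \sum_(i < size s) s`_i * x i ^+ 2 ->
  exists s', [/\ nonzeros s', cong s (c :: s') & wsum f s = f c + wsum f s'].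
Proof.
case: wf => f_sq f_opp f_add.
elim: s x c => [|a s IH] x c /=.
  by rewrite big_ord0 => _ /[swap] -> /eqP.
move=> /andP[a0 nzs] c0; rewrite big_ord_recl /=.
set c1 := \sum_(i < _) _ => ec.
have [c10|c1n0] := eqVneq c1 0.
  rewrite c10 addr0 in ec.
  have x0 : x 0%N != 0 by apply: contraNneq c0 => x0; rewrite ec x0 expr0n mulr0.
  exists s; split=> //; last by rewrite wsum_cons ec f_sq.
  by rewrite -[a :: s]cat1s -[c :: s]cat1s ec; apply: cong_cat;
    [exact: cong_sq|exact: cong_refl].
have [s' [nzs' cs' fs']] := IH (fun i => x i.+1) c1 nzs c1n0 erefl.
have [x0|x0] := eqVneq (x 0%N) 0.
  have ec1 : c = c1 by rewrite ec x0 expr0n mulr0 add0r.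
  exists (a :: s'); split; first by rewrite /= a0.
    apply: (@cong_trans _ (a :: c1 :: s')).
      by rewrite -[a :: s]cat1s -[a :: c1 :: s']cat1s; apply: cong_cat => //;
        exact: cong_refl.
    by rewrite ec1; apply: cong_perm;
      rewrite -[a :: c1 :: _]/([:: a] ++ [:: c1] ++ s') perm_catCA.
  by rewrite !wsum_cons fs' ec1 addrCA.
set ax := a * x 0%N ^+ 2 in ec.
have ax0 : ax != 0 by rewrite mulf_neq0 ?expf_neq0.
exists (ax * c1 * c :: s'); split; first by rewrite /= !mulf_neq0.
  apply: (@cong_trans _ ([:: ax] ++ c1 :: s')).
    by rewrite -[a :: s]cat1s; apply: cong_cat => //; exact: cong_sq.
  apply: (@cong_cat [:: ax; c1] [:: c; ax * c1 * c]); last exact: cong_refl.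
  by rewrite ec; apply: cong_add; rewrite -ec.
rewrite !wsum_cons fs' -(f_sq a (x 0%N)) // -/ax !addrA; congr (_ + _).
by rewrite ec; apply: f_add; rewrite -?ec.
Qed.

(** The head of [t] is a value of [s]: put it in front, remove it by Witt cancellation, and
    induct. *)
Lemma wsum_cong s t : nonzeros s -> nonzeros t -> cong s t ->
  wsum f s = wsum f t.
Proof.
elim: t s => [|c t IH] s nzs nzt cst.
  by case: cst => m [_ [es /= et _ _]]; move: es; rewrite -et => /size0nil ->.
have /= /andP[c0 nzt'] := nzt.
have [x ec] : exists x : nat -> rat, c = \sum_(i < size s) s`_i * x i ^+ 2.
  have [m [P [es et uP HP]]] := cst.
  case: m P es et uP HP => // m P es _ _ /matrixP/(_ 0 0).
  rewrite !mxE /= mulr1n es => <-.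
  exists (fun i => P 0 (inord i)); apply: eq_bigr => i _.
  rewrite mxE (bigD1 i) //= big1 ?addr0 => [|j ji]; last first.
    by rewrite !mxE (negPf ji) mulr0n mulr0.
  by rewrite !mxE eqxx mulr1n inord_val expr2 mulrA [s`__ * _]mulrC.
have [s' [nzs' cs' ->]] := represented nzs c0 ec.
rewrite wsum_cons; congr (_ + _); apply: IH => //.
by apply: (@cong_cancel c) => //; apply: cong_trans cst; apply: cong_sym.
Qed.

End WittFun.

(** * The Witt group of Q *)

Definition hyp_seq (k : nat) : seq rat := nseq k 1 ++ nseq k (-1).

Definition neutral (s : seq rat) : Prop := exists k, cong s (hyp_seq k).

Lemma nonzeros_hyp k : nonzeros (hyp_seq k).
Proof. by rewrite nonzeros_cat /nonzeros !all_nseq oppr_eq0 oner_eq0 !orbT. Qed.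

Lemma nonzeros_opp s : nonzeros (map -%R s) = nonzeros s.
Proof. by rewrite /nonzeros all_map; apply: eq_all => a /=; rewrite oppr_eq0. Qed.

Lemma hyp_seqD k l : perm_eq (hyp_seq (k + l)) (hyp_seq k ++ hyp_seq l).
Proof. by apply/seq.permP => a; rewrite !count_cat !count_nseq; lia. Qed.

Lemma neutral_cong s t : cong s t -> neutral t -> neutral s.
Proof. by move=> st [k tk]; exists k; apply: cong_trans tk. Qed.

Lemma neutral_perm s t : perm_eq s t -> neutral t -> neutral s.
Proof. by move=> /cong_perm; exact: neutral_cong. Qed.

Lemma neutral_cat s t : neutral s -> neutral t -> neutral (s ++ t).
Proof.
move=> [k sk] [l tl]; exists (k + l)%N; apply: cong_trans (cong_cat sk tl) _.
by apply: cong_perm; rewrite perm_sym hyp_seqD.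
Qed.

Lemma cong_cancel_cat u s t : nonzeros u -> nonzeros t ->
  cong (u ++ s) (u ++ t) -> cong s t.
Proof.
elim: u => //= a u IH /andP[a0 nzu] nzt /(cong_cancel a0) H.
by apply: IH => //; apply: H; rewrite nonzeros_cat nzu.
Qed.

Lemma cong_size s t : cong s t -> size s = size t.
Proof. by case=> m [P [-> ->]]. Qed.

Lemma neutral_cancel s t : neutral (s ++ t) -> neutral t -> neutral s.
Proof.
move=> [k stk] [l tl].
have lk : (l <= k)%N.
  move: (cong_size stk) (cong_size tl).
  by rewrite !size_cat !size_nseq; lia.
exists (k - l)%N; apply: (@cong_cancel_cat (hyp_seq l)); rewrite ?nonzeros_hyp //.
apply: (@cong_trans _ (s ++ t)).
  apply: cong_trans (cong_cat (cong_refl s) (cong_sym tl)).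
  by apply: cong_perm; rewrite perm_catC.
by apply: cong_trans stk _; apply: cong_perm; rewrite -{1}(subnKC lk) hyp_seqD.
Qed.

Lemma neutral_nil : neutral [::].
Proof. by exists 0%N; apply: cong_refl. Qed.

Lemma neutral_pair a : a != 0 -> neutral [:: a; - a].
Proof. by exists 1%N; apply: cong_opp. Qed.

Lemma neutral_catN s : nonzeros s -> neutral (s ++ map -%R s).
Proof.
elim: s => [_|a s IH /= /andP[a0 nzs]]; first exact: neutral_nil.
apply: neutral_perm (neutral_cat (neutral_pair a0) (IH nzs)).
by rewrite /= perm_cons -cat1s perm_catCA.
Qed.

Lemma cong_map_opp s t : cong s t -> cong (map -%R s) (map -%R t).
Proof.
have dN m (u : seq rat) : size u = m -> diag_seq m (map -%R u) = - diag_seq m u.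
  move=> eu; apply/matrixP => i j; rewrite !mxE (nth_map 0) ?mulNrn //.
  by rewrite eu.
move=> [m [P [es et uP HP]]]; exists m, P; split; rewrite ?size_map //.
by rewrite !dN // mulmxN mulNmx HP.
Qed.

Lemma neutral_opp s : neutral s -> neutral (map -%R s).
Proof.
move=> [k /cong_map_opp sk]; exists k; apply: cong_trans sk _.
apply: cong_perm; rewrite /hyp_seq map_cat !map_nseq opprK.
by rewrite perm_catC.
Qed.

(** Integer polynomials serve as the free abelian group on the countable set of rationals, a
    rational being coded by the monomial of degree [pickle a]. *)
Definition free_gen (a : rat) : {poly int} := 'X^(pickle a).

Lemma perm_free_gen s t : wsum free_gen s = wsum free_gen t -> perm_eq s t.
Proof.
move=> est; apply/allP => a _ /=.
have cnt u : (wsum free_gen u)`_(pickle a) = (count_mem a u)%:R.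
  rewrite /wsum coef_sum -sum1_count natr_sum [RHS]big_mkcond /=.
  apply: eq_bigr => b _; rewrite coefXn (inj_eq (pcan_inj pickleK)) eq_sym.
  by case: eqP.
by move: (cnt s); rewrite est cnt => /eqP; rewrite eqr_nat eq_sym.
Qed.

(** Relations are given directly as formal differences of forms that become hyperbolic, not by
    generators; closure under subtraction is then concatenation. *)
Definition witt_rel : {pred {poly int}} := fun p =>
  `[< exists s t, [/\ nonzeros s, nonzeros t,
      p = wsum free_gen s - wsum free_gen t & neutral (s ++ map -%R t)] >].

Lemma witt_rel_closed : zmod_closed witt_rel.
Proof.
split.
  apply/asboolP; exists [::], [::]; split=> //; last exact: neutral_nil.
  by rewrite subrr.
move=> p q /asboolP[s [t [ns nt -> nst]]] /asboolP[s' [t' [ns' nt' -> nst']]].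
apply/asboolP; exists (s ++ t'), (t ++ s'); split.
- by rewrite nonzeros_cat ns.
- by rewrite nonzeros_cat nt.
- by rewrite !wsum_cat; ring.
apply: neutral_perm (neutral_cat nst (neutral_opp nst')).
rewrite !map_cat mapK //; last exact: opprK.
by apply/seq.permP => a; rewrite !count_cat; lia.
Qed.

HB.instance Definition _ := GRing.isZmodClosed.Build {poly int} witt_rel
  witt_rel_closed.

(* The Witt group of Q, as a quotient of the free abelian group Z[Q]. *)
Definition witt : zmodType := Quotient.quot witt_rel.

Definition wclass (a : rat) : witt := \pi_(Quotient.quot witt_rel)%qT (free_gen a).

Lemma wsum_wclass s :
  wsum wclass s = \pi_(Quotient.quot witt_rel)%qT (wsum free_gen s).
Proof. by rewrite /wsum raddf_sum. Qed.

(** Equality in the free group is a permutation, so a witness [(s', t')] has [s'] a permutation of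
    [s ++ t']; the form [t'] plus its opposite is hyperbolic and cancels. *)
Lemma wsum_wclass0 s : nonzeros s -> wsum wclass s = 0 <-> neutral s.
Proof.
move=> nzs; rewrite wsum_wclass.
have -> : (\pi_(Quotient.quot witt_rel)%qT (wsum free_gen s) = 0) <->
          (wsum free_gen s \in witt_rel).
  rewrite -{2}[wsum _ s]subr0 Quotient.idealrBE raddf0; split => [->|/eqP] //.
split=> [/asboolP[s' [t' [ns' nt' e n']]]|ns]; last first.
  apply/asboolP; exists s, [::]; split; rewrite ?wsum_nil ?subr0 //.
  by rewrite cats0.
have pst : perm_eq (s ++ t') s'.
  by apply: perm_free_gen; rewrite wsum_cat e subrK.
apply: (@neutral_cancel _ (t' ++ map -%R t')); last exact: neutral_catN.
by apply: neutral_perm n'; rewrite catA perm_cat2r.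
Qed.

Lemma wclass_witt : witt_fun wclass.
Proof.
have Z s : nonzeros s -> neutral s -> wsum wclass s = 0.
  by move=> nzs; rewrite wsum_wclass0.
have opp a : a != 0 -> wclass a + wclass (- a) = 0.
  move=> a0; have := Z [:: a; - a]; rewrite !wsum_cons wsum_nil addr0; apply.
    by rewrite /= oppr_eq0 a0.
  exact: neutral_pair.
have oppE a : a != 0 -> wclass (- a) = - wclass a.
  by move=> /opp/addr0_eq.
split=> // [a b a0 b0|a b a0 b0 ab0].
  have ab0 : a * b ^+ 2 != 0 by rewrite mulf_neq0 ?expf_neq0.
  apply/eqP; rewrite -subr_eq0 -oppE //; apply/eqP.
  have := Z [:: a * b ^+ 2; - a]; rewrite !wsum_cons wsum_nil addr0; apply.
    by rewrite /= ab0 oppr_eq0 a0.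
  apply: neutral_cong (neutral_pair a0).
  by apply: (@cong_cat [:: _] [:: _] [:: _] [:: _]);
    [apply/cong_sym/cong_sq | exact: cong_refl].
have ab0' : a * b * (a + b) != 0 by rewrite !mulf_neq0.
have := Z [:: a; b; - (a + b); - (a * b * (a + b))].
rewrite !wsum_cons wsum_nil addr0 !oppE //.
rewrite addrA -opprD => H; apply/eqP; rewrite -subr_eq0 H //.
  by rewrite /= a0 b0 !oppr_eq0 ab0 ab0'.
apply: neutral_cong (@neutral_catN [:: a; b] _); last by rewrite /= a0 b0.
apply: (@cong_cat [:: _; _] [:: _; _] [:: _; _] [:: _; _]); first exact: cong_refl.
apply: (@cong_map_opp [:: _; _] [:: _; _]); apply: cong_sym; exact: cong_add.
Qed.

Lemma wsum_opp (A : zmodType) (f : rat -> A) s : witt_fun f -> nonzeros s ->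
  wsum f (map -%R s) = - wsum f s.
Proof.
case=> _ opp _; elim: s => [|a s IH] /=; first by rewrite wsum_nil oppr0.
by case/andP => a0 /IH e; rewrite !wsum_cons e opprD -(addr0_eq (opp _ a0)).
Qed.

Lemma wsum_hyp (A : zmodType) (f : rat -> A) k : witt_fun f ->
  wsum f (hyp_seq k) = 0.
Proof.
move=> wf; rewrite (_ : hyp_seq k = nseq k 1 ++ map -%R (nseq k 1)); last first.
  by rewrite map_nseq.
by rewrite wsum_cat wsum_opp ?subrr // /nonzeros all_nseq oner_eq0 orbT.
Qed.

(** Forms of equal class differ by a hyperbolic form, on which every Witt function sums to zero.
    This transfers residues and signature to other representatives of a Witt class. *)
Lemma wclass_universal (A : zmodType) (f : rat -> A) s t :
  witt_fun f -> nonzeros s -> nonzeros t ->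
  wsum wclass s = wsum wclass t -> wsum f s = wsum f t.
Proof.
move=> wf nzs nzt est.
have nzst : nonzeros (s ++ map -%R t) by rewrite nonzeros_cat nzs nonzeros_opp.
have /(wsum_wclass0 nzst) [k] : wsum wclass (s ++ map -%R t) = 0.
  by rewrite wsum_cat wsum_opp ?est ?subrr //; exact: wclass_witt.
move=> /(wsum_cong wf nzst (nonzeros_hyp k)).
rewrite wsum_hyp // wsum_cat wsum_opp // => /eqP.
by rewrite subr_eq0 => /eqP.
Qed.

(** * Residues at primes *)

Section Residue.
Variables (p : nat) (p_pr : prime p).

Lemma intFp_eq0 (z : int) : (z%:~R == 0 :> 'F_p) = (p %| z)%Z.
Proof. by rewrite -(dvdz_pcharf (pchar_Fp p_pr)). Qed.

Lemma int_pfactor (z : int) : z != 0 ->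
  exists2 u : int, z = u * p%:Z ^+ logn p `|z| & u%:~R != 0 :> 'F_p.
Proof.
move=> z0; have /(pfactor_coprime p_pr)[m pm em] : (0 < `|z|)%N by rewrite absz_gt0.
exists (sgz z * m%:Z).
  by rewrite -mulrA -!natz -natrX -natrM -em natz -intEsg.
rewrite intFp_eq0 dvdzE abszM (_ : `|sgz z| = 1)%N; last by case: sgzP z0.
rewrite mul1n /=.
by rewrite -prime_coprime.
Qed.

Lemma int_pfactor_inj (u v : int) (k l : nat) :
  u%:~R != 0 :> 'F_p -> v%:~R != 0 :> 'F_p ->
  u * p%:Z ^+ k = v * p%:Z ^+ l -> k = l /\ u = v.
Proof.
have lg w m : w%:~R != 0 :> 'F_p -> logn p `|w * p%:Z ^+ m| = m.
  move=> w0; have nw : (0 < `|w|)%N by rewrite absz_gt0; apply: contraNneq w0 => ->.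
  rewrite abszM abszX absz_nat lognM ?expn_gt0 ?(prime_gt0 p_pr) //.
  rewrite pfactorK //; apply/eqP; rewrite -[eqbRHS]add0n eqn_add2r; apply/eqP.
  by rewrite logn_coprime // prime_coprime //; move: w0; rewrite intFp_eq0 dvdzE absz_nat.
move=> u0 v0 e; have ekl : k = l by rewrite -(lg u k) // e lg.
split=> //; apply: (mulIf _ (etrans e (congr1 (fun i => v * p%:Z ^+ i) (esym ekl)))).
by rewrite expf_neq0 //; case: (p) p_pr.
Qed.

Variables (A : zmodType) (h : 'F_p -> A).
Hypothesis wh : witt_fun h.

(** The second residue map at [p] with respect to the uniformizer [p], followed by [h]. Numerator
    times denominator is an integer in the square class of [a], whose prime-to-[p] part counts only
    when the valuation is odd. *)
Definition residue (a : rat) : A :=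
  let z := numq a * denq a in
  let k := logn p `|z| in
  if odd k then h (z %/ p%:Z ^+ k)%Z%:~R else 0.

Lemma prime_natr_neq0 (R : numDomainType) : p%:R != 0 :> R.
Proof. by rewrite pnatr_eq0 -lt0n prime_gt0. Qed.

(* The residue only depends on the square class: it can be read off any
   expression a = c^2 p^k u with u an integer prime to p. *)
Lemma residueE (c : rat) (k : nat) (u : int) : c != 0 ->
  u%:~R != 0 :> 'F_p ->
  residue (c ^+ 2 * p%:R ^+ k * u%:~R) = if odd k then h u%:~R else 0.
Proof.
move=> c0 u0; set a := (X in residue X); rewrite /residue.
have uZ0 : u != 0 by apply: contraNneq u0 => ->.
have a0 : a != 0.
  by rewrite !mulf_neq0 ?expf_neq0 ?prime_natr_neq0 ?intr_eq0.
set z := numq a * denq a.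
have z0 : z != 0 by rewrite mulf_neq0 ?numq_eq0 ?denq_eq0.
have [z' ez z'0] := int_pfactor z0; set l := logn p `|z| in ez *.
have -> : (z %/ p%:Z ^+ l)%Z = z'.
  by rewrite {1}ez mulzK // expf_neq0 // -natz prime_natr_neq0.
have eza : z%:~R = (c * (denq a)%:~R) ^+ 2 * p%:R ^+ k * u%:~R :> rat.
  have -> : z%:~R = a * (denq a)%:~R ^+ 2.
    rewrite intrM -{3}[a]divq_num_den expr2 mulrA divfK // intr_eq0 denq_eq0 //.
  by rewrite {1}/a; ring.
set C := c * _ in eza; have C0 : C != 0 by rewrite mulf_neq0 // intr_eq0 denq_eq0.
clearbody z.
have {}eza : denq C ^+ 2 * z = numq C ^+ 2 * p%:Z ^+ k * u.
  apply: (@intr_inj rat); rewrite !rmorphM /= !rmorphXn /= -!pmulrn eza.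
  have -> : (numq C)%:~R = C * (denq C)%:~R :> rat by rewrite numqE.
  by ring.
have [x' ex x'0] := @int_pfactor (numq C) (ltac:(by rewrite numq_eq0)).
have [y' ey y'0] := @int_pfactor (denq C) (denq_neq0 C).
move: eza; rewrite {1}ex {1}ey ez.
set j := logn p _; set i := logn p _.
have -> : (y' * p%:Z ^+ j) ^+ 2 * (z' * p%:Z ^+ l) = (z' * y' ^+ 2) * p%:Z ^+ (2 * j + l).
  by rewrite exprMn -exprM exprD (mulnC j); move: (_ ^+ (2 * j)) (_ ^+ l) => ? ?; ring.
have -> : (x' * p%:Z ^+ i) ^+ 2 * p%:Z ^+ k * u = (u * x' ^+ 2) * p%:Z ^+ (2 * i + k).
  by rewrite exprMn -exprM exprD (mulnC i); move: (_ ^+ (2 * i)) (_ ^+ k) => ? ?; ring.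
have [h_sq _ _] := wh.
(* Both sides are an integer prime to [p] times a power of [p]: the exponents [k] and [l] differ by
   an even number, and the units [u] and [z'] by the squares of [x'] and [y']. *)
case/int_pfactor_inj; rewrite ?intrM ?rmorphXn ?mulf_neq0 ?expf_neq0 // => ekl euv.
have -> : odd l = odd k by move: ekl; lia.
case: odd => //; rewrite -(h_sq _ y'%:~R) // -(h_sq u%:~R x'%:~R) //.
by rewrite -!rmorphXn -!intrM euv.
Qed.

Lemma rat_pfactor (a : rat) : a != 0 -> exists (c : rat) (k : nat) (u : int),
  [/\ c != 0, u%:~R != 0 :> 'F_p & a = c ^+ 2 * p%:R ^+ k * u%:~R].
Proof.
move=> a0; have z0 : numq a * denq a != 0 by rewrite mulf_neq0 ?numq_eq0 ?denq_eq0.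
have [u eu u0] := int_pfactor z0.
exists ((denq a)%:~R^-1), (logn p `|numq a * denq a|), u.
have d0 : (denq a)%:~R != 0 :> rat by rewrite intr_eq0 denq_eq0.
split; rewrite ?invr_eq0 //.
rewrite -mulrA -{1}[p%:R]/(p%:Z%:~R) -rmorphXn -intrM mulrC [_ * u]mulrC -eu.
by rewrite intrM -{1}[a]divq_num_den; field.
Qed.

Lemma residue_sq a b : a != 0 -> b != 0 -> residue (a * b ^+ 2) = residue a.
Proof.
move=> a0 b0; have [c [k [u [c0 u0 ->]]]] := rat_pfactor a0.
have -> : c ^+ 2 * p%:R ^+ k * u%:~R * b ^+ 2 = (c * b) ^+ 2 * p%:R ^+ k * u%:~R.
  by ring.
by rewrite !residueE // mulf_neq0.
Qed.

Lemma residue_int (k : nat) (u : int) : u%:~R != 0 :> 'F_p ->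
  residue (p%:R ^+ k * u%:~R) = if odd k then h u%:~R else 0.
Proof.
by move=> u0; rewrite -(@residueE 1) ?oner_eq0 // expr1n mul1r.
Qed.

Lemma residue_opp a : a != 0 -> residue a + residue (- a) = 0.
Proof.
move=> a0; have [c [k [u [c0 u0 ->]]]] := rat_pfactor a0.
rewrite -mulrN -intrN !residueE // ?intrN ?oppr_eq0 //.
by case: wh => _ h_opp _; case: odd; [exact: h_opp | exact: addr0].
Qed.

(** If [m > 0], then [a + b] has the leading unit of [a], and [a b (a + b)] that of [b] up to a
    square. If [m = 0], the relation is that of [h] unless [u + v] vanishes modulo [p]; in that case
    both sides are zero, since [v = - u] and the units [w'] and [u v w'] are opposite up to a
    square. *)
Lemma residue_add_int (k m : nat) (u v : int) :
  u%:~R != 0 :> 'F_p -> v%:~R != 0 :> 'F_p ->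
  u + v * p%:Z ^+ m != 0 ->
  let a := p%:R ^+ k * u%:~R in let b := p%:R ^+ (k + m) * v%:~R in
  residue a + residue b = residue (a + b) + residue (a * b * (a + b)).
Proof.
move=> u0 v0 w0 a b; have [h_sq h_opp h_add] := wh.
have eab : a + b = p%:R ^+ k * (u + v * p%:Z ^+ m)%:~R.
  by rewrite /a /b exprD intrD intrM rmorphXn /= -pmulrn; ring.
have eabc : a * b * (a + b) =
    p%:R ^+ (k + k + k + m) * (u * v * (u + v * p%:Z ^+ m))%:~R.
  by rewrite eab /a /b !exprD !intrM; ring.
have pF0 : p%:~R = 0 :> 'F_p by apply/eqP; rewrite intFp_eq0 dvdzz.
case: m => [|m] in w0 b eab eabc *; last first.
  have e : (u + v * p%:Z ^+ m.+1)%:~R = u%:~R :> 'F_p.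
    by rewrite intrD intrM rmorphXn /= pF0 expr0n mulr0 addr0.
  rewrite eabc eab !residue_int // ?intrM ?e ?mulf_neq0 //.
  rewrite (_ : odd (k + k + k + m.+1) = odd (k + m.+1)); last by lia.
  by rewrite mulrAC -expr2 mulrC h_sq.
rewrite eabc eab expr0 mulr1 addn0 in w0 *.
rewrite /a /b addn0 (residue_int k u0) (residue_int k v0).
have [w_F0|w_F0] := eqVneq ((u + v)%:~R : 'F_p) 0; last first.
  rewrite !residue_int // ?intrM ?mulf_neq0 //.
  rewrite (_ : odd (k + k + k) = odd k); last by lia.
  by case: odd; rewrite ?addr0 // !intrD h_add // -intrD.
have [w' ew w'0] := int_pfactor w0; set n := logn p _ in ew.
have euv : v%:~R = - u%:~R :> 'F_p.
  by apply/eqP; rewrite -addr_eq0 addrC -intrD w_F0.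
have -> : p%:R ^+ k * (u + v)%:~R = p%:R ^+ (k + n) * w'%:~R :> rat.
  by rewrite ew intrM rmorphXn /= -pmulrn exprD; ring.
have -> : p%:R ^+ (k + k + k) * (u * v * (u + v))%:~R =
    p%:R ^+ (k + k + k + n) * (u * v * w')%:~R :> rat.
  by rewrite ew !intrM rmorphXn /= -pmulrn !exprD; ring.
rewrite !residue_int // ?intrM ?mulf_neq0 //.
rewrite (_ : odd (k + k + k + n) = odd (k + n)); last by lia.
have -> : u%:~R * v%:~R * w'%:~R = - w'%:~R * u%:~R ^+ 2 :> 'F_p.
  by rewrite euv; ring.
rewrite h_sq ?oppr_eq0 // euv.
by case: (odd k); case: (odd (k + n)); rewrite ?h_opp ?addr0.
Qed.

Lemma residue_add a b : a != 0 -> b != 0 -> a + b != 0 ->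
  residue a + residue b = residue (a + b) + residue (a * b * (a + b)).
Proof.
(* Clear denominators; by symmetry the smaller power of p comes first. *)
have int_case (x y : int) : x != 0 -> y != 0 -> x + y != 0 ->
    residue x%:~R + residue y%:~R =
    residue (x%:~R + y%:~R) + residue (x%:~R * y%:~R * (x%:~R + y%:~R)).
  wlog le_xy : x y / (logn p `|x| <= logn p `|y|)%N => [hw|] x0 y0 xy0.
    case/orP: (leq_total (logn p `|x|) (logn p `|y|)) => le; first exact: hw.
    rewrite [LHS]addrC (hw y x le y0 x0); last by rewrite addrC.
    by rewrite [y%:~R + _]addrC [y%:~R * x%:~R]mulrC.
  have [u ex u0] := int_pfactor x0; have [v ey v0] := int_pfactor y0.
  have := @residue_add_int (logn p `|x|) (logn p `|y| - logn p `|x|) u v u0 v0.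
  rewrite subnKC //=.
  have -> : p%:R ^+ logn p `|x| * u%:~R = x%:~R :> rat.
    by rewrite {2}ex intrM rmorphXn /= -pmulrn mulrC.
  have -> : p%:R ^+ logn p `|y| * v%:~R = y%:~R :> rat.
    by rewrite {2}ey intrM rmorphXn /= -pmulrn mulrC.
  apply; apply: contraNneq xy0 => e.
  rewrite ex {1}ey -(subnKC le_xy) exprD [p%:Z ^+ _ * _]mulrC mulrA -mulrDl.
  by rewrite e mul0r.
move=> a0 b0 ab0.
pose d : rat := (denq a * denq b)%:~R.
have d0 : d != 0 by rewrite intr_eq0 mulf_neq0 ?denq_eq0.
have clear c (z : int) : c * d = z%:~R -> exists y : int, y%:~R = c * d ^+ 2.
  by move=> e; exists (z * (denq a * denq b)); rewrite intrM -e expr2 mulrA.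
have [x ex] := @clear a (numq a * denq b) (ltac:(by rewrite intrM numqE /d intrM mulrA)).
have [y ey] := @clear b (numq b * denq a) (ltac:(by rewrite intrM numqE /d intrM; ring)).
have sc e : e != 0 -> residue e = residue (e * d ^+ 2) by move=> e0; rewrite residue_sq.
rewrite (sc a) // (sc b) // (sc (a + b)) // -ex -ey int_case.
- congr (_ + _); first by rewrite ex ey mulrDl.
  rewrite -(residue_sq (a := a * b * (a + b)) (b := d ^+ 3)) ?mulf_neq0 ?expf_neq0 //.
  by congr residue; rewrite ex ey; ring.
- by rewrite -(intr_eq0 rat) ex mulf_neq0 ?expf_neq0.
- by rewrite -(intr_eq0 rat) ey mulf_neq0 ?expf_neq0.
- by rewrite -(intr_eq0 rat) intrD ex ey -mulrDl mulf_neq0 ?expf_neq0.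
Qed.

Lemma residue_witt : witt_fun residue.
Proof.
split; [exact: residue_sq | exact: residue_opp | exact: residue_add].
Qed.

End Residue.

(** * Tate's descent on primes *)

Definition smooth (k : nat) (v : int) : bool :=
  (v != 0) && all (fun q => q <= k)%N (primes `|v|).

Lemma smooth_neq0 k v : smooth k v -> v != 0.
Proof. by case/andP. Qed.

Lemma smoothM k u v : smooth k (u * v) = smooth k u && smooth k v.
Proof.
rewrite /smooth mulf_eq0 negb_or.
case: (eqVneq u 0) => [_|u0] //=.
case: (eqVneq v 0) => [_|v0] /=; first by rewrite andbF.
have e : primes `|u * v| =i primes `|u| ++ primes `|v|.
  by move=> q; rewrite abszM primesM ?absz_gt0 // mem_cat.
by rewrite (eq_all_r e) all_cat.
Qed.

Lemma smooth_opp k v : smooth k (- v) = smooth k v.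
Proof. by rewrite /smooth oppr_eq0 abszN. Qed.

Lemma smooth_small k v : v != 0 -> (`|v| <= k)%N -> smooth k v.
Proof.
move=> v0 vk; rewrite /smooth v0 /=; apply/allP => q.
rewrite mem_primes => /and3P[_ _ /dvdn_leq le]; apply: leq_trans vk.
by apply: le; rewrite absz_gt0.
Qed.

Lemma smooth0 v : smooth 0 v -> v = 1 \/ v = -1.
Proof.
case/andP=> v0 /allP H; have [v1|v1] := leqP `|v| 1; first by lia.
have := H (pdiv `|v|); rewrite mem_primes pdiv_prime // pdiv_dvd absz_gt0 v0.
by move=> /(_ isT); rewrite leqn0 => /eqP e; have := pdiv_prime v1; rewrite e.
Qed.

Section SmoothGen.
Variables (A : zmodType) (f : rat -> A) (k : nat).

Definition isum (s : seq int) : A := wsum f (map intr s).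

Lemma isum_cat s t : isum (s ++ t) = isum s + isum t.
Proof. by rewrite /isum map_cat wsum_cat. Qed.

(** The subgroup generated by the values of [f] at [k]-smooth integers; for [f = wclass] these
    subgroups are Tate's filtration of the Witt group. *)
Definition smooth_gen : {pred A} := fun x =>
  `[< exists s t, [/\ all (smooth k) s, all (smooth k) t & x = isum s - isum t] >].

Lemma smooth_gen_closed : zmod_closed smooth_gen.
Proof.
split; first by apply/asboolP; exists [::], [::]; rewrite subrr.
move=> x y /asboolP[s [t [ss st ->]]] /asboolP[s' [t' [ss' st' ->]]].
apply/asboolP; exists (s ++ t'), (t ++ s'); split; rewrite ?all_cat ?ss ?st //.
by rewrite !isum_cat opprB addrACA opprD.
Qed.

HB.instance Definition _ := GRing.isZmodClosed.Build A smooth_gen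
  smooth_gen_closed.

Lemma smooth_genP v : smooth k v -> f v%:~R \in smooth_gen.
Proof.
move=> sv; apply/asboolP; exists [:: v], [::]; split; rewrite /= ?sv //.
by rewrite /isum /= wsum_cons !wsum_nil addr0 subr0.
Qed.

End SmoothGen.

(** Scaling the form by [n] multiplies the cubic term by [n ^ 3], which is [n] up to a square. *)
Lemma witt_fun_mul (A : zmodType) (f : rat -> A) (n : rat) :
  n != 0 -> witt_fun f -> witt_fun (fun a => f (n * a)).
Proof.
move=> n0 [f_sq f_opp f_add]; split=> [a b a0 b0|a a0|a b a0 b0 ab0].
- by rewrite mulrA f_sq // mulf_neq0.
- by rewrite mulrN f_opp // mulf_neq0.
rewrite f_add ?mulf_neq0 // -?mulrDr ?mulf_neq0 //; congr (_ + _).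
rewrite -(f_sq (n * (a * b * (a + b))) n) ?mulf_neq0 //.
by congr f; ring.
Qed.

Lemma smooth_gen_mul (A : zmodType) (f : rat -> A) k (n : int) x : smooth k n ->
  x \in smooth_gen (fun a => f (n%:~R * a)) k -> x \in smooth_gen f k.
Proof.
move=> sn /asboolP[s [t [/allP ss /allP st ->]]]; apply/asboolP.
have e u : isum (fun a => f (n%:~R * a)) u = isum f (map ( *%R n) u).
  rewrite /isum /wsum -map_comp !big_map; apply: eq_bigr => v _.
  by rewrite /= intrM.
exists (map ( *%R n) s), (map ( *%R n) t); split; rewrite ?e //.
  by apply/allP => _ /mapP[v /ss sv ->]; rewrite smoothM sn.
by apply/allP => _ /mapP[v /st sv ->]; rewrite smoothM sn.
Qed.

Section Tate.
Variables (p : nat) (p_pr : prime p).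

Lemma smooth_Fp v : smooth p.-1 v -> v%:~R != 0 :> 'F_p.
Proof.
case/andP => v0 /allP H; rewrite intFp_eq0 //; apply/negP => pv.
have := H p; rewrite dvdzE absz_nat in pv;
  rewrite mem_primes p_pr absz_gt0 v0 pv => /(_ isT).
by have := (prime_gt0 p_pr); lia.
Qed.

(* The Witt relation for the pair (p r, p^2 l), whose sum is p v. *)
Lemma tate_base (A : zmodType) (f : rat -> A) (v r l : int) : witt_fun f ->
  smooth p.-1 v -> smooth p.-1 r -> (l = 0) \/ smooth p.-1 l ->
  v = r + p%:Z * l ->
  f (p%:R * v%:~R) - f (p%:R * r%:~R) \in smooth_gen f p.-1.
Proof.
move=> [f_sq f_opp f_add] sv sr [l0|sl] e.
  by rewrite e l0 mulr0 addr0 subrr rpred0.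
have p0 := prime_natr_neq0 p_pr rat.
have [v0 r0 l0] := And3 (smooth_neq0 sv) (smooth_neq0 sr) (smooth_neq0 sl).
have ev : p%:R * r%:~R + p%:R ^+ 2 * l%:~R = p%:R * v%:~R :> rat.
  by rewrite e intrD intrM; ring.
have := f_add (p%:R * r%:~R) (p%:R ^+ 2 * l%:~R).
rewrite ev !mulf_neq0 ?expf_neq0 ?intr_eq0 // => /(_ isT isT isT).
rewrite [p%:R ^+ 2 * _]mulrC f_sq ?intr_eq0 // => H.
have e2 : p%:R * r%:~R * (l%:~R * p%:R ^+ 2) * (p%:R * v%:~R) =
  (r * l * v)%:~R * (p%:R ^+ 2) ^+ 2 :> rat by rewrite !intrM; ring.
rewrite e2 f_sq ?expf_neq0 ?intr_eq0 ?mulf_neq0 // in H.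
have -> : f (p%:R * v%:~R) - f (p%:R * r%:~R) = f l%:~R - f (r * l * v)%:~R.
  by apply/eqP; rewrite subr_eq addrAC eq_sym subr_eq -H addrC.
by apply: rpredB; apply: smooth_genP; rewrite ?smoothM ?sr ?sl.
Qed.

(* Multiply out the prime factors q of v one at a time, reducing modulo p after
   each step; f is generalized because the step replaces f by a |-> f (q a). *)
Lemma tate_red (A : zmodType) (f : rat -> A) (v : int) : witt_fun f ->
  smooth p.-1 v ->
  exists r : nat, [/\ (0 < r < p)%N, v%:~R = r%:R :> 'F_p &
    f (p%:R * v%:~R) - f (p%:R * r%:R) \in smooth_gen f p.-1].
Proof.
have [m] := ubnP `|v|; elim: m f v => // m IH f v vm wf sv.
have p1 := prime_gt1 p_pr.
have sm (r : nat) : (0 < r < p)%N -> smooth p.-1 r.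
  by case/andP => r0 rp; apply: smooth_small; lia.
have [v1|v1] := leqP `|v| 1.
  have [->|->] : v = 1 \/ v = -1 by have := smooth_neq0 sv; lia.
    by exists 1%N; split; rewrite ?p1 // subrr rpred0.
  exists p.-1; split; first by lia.
    apply/eqP; rewrite -subr_eq0 -[p.-1%:R]/(p.-1%:~R) -intrB intFp_eq0 //.
    by rewrite (_ : -1 - _ = - p%:Z) ?rpredN ?dvdzz //; lia.
  (* Division with remainder: [-1 = (p - 1) + p * (-1)]. *)
  apply: (@tate_base _ _ _ p.-1%:Z (-1)) => //; try by [apply: sm; lia].
    by right; rewrite smooth_opp; apply: smooth_small => //; lia.
  by lia.
pose q := pdiv `|v|; have q_pr : prime q := pdiv_prime v1.
have [v' ev] : exists v', v = q%:Z * v'.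
  have /dvdzP[v' ->] : (q%:Z %| v)%Z by rewrite dvdzE /= pdiv_dvd.
  by exists v'; rewrite mulrC.
have q0 := prime_gt0 q_pr.
have /andP[sq sv'] : smooth p.-1 q && smooth p.-1 v' by rewrite -smoothM -ev.
have q1 := prime_gt1 q_pr.
have v'm : (`|v'| < m)%N.
  have v'0 := smooth_neq0 sv'.
  apply: leq_trans (_ : `|v| <= m)%N; last by lia.
  by rewrite ev abszM absz_nat; nia.
have qQ0 : q%:~R != 0 :> rat by rewrite intr_eq0; lia.
have [r' [r'p er' Hr']] := IH _ v' v'm (witt_fun_mul qQ0 wf) sv'.
have {}Hr' := smooth_gen_mul sq Hr'.
have qp : (q < p)%N.
  case/andP: sq => _ /allP /(_ q); rewrite mem_primes q_pr absz_nat q0 dvdnn.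
  by move=> /(_ isT); lia.
have sr' := sm _ r'p.
have /smooth_Fp qr0 : smooth p.-1 (q * r')%N by rewrite PoszM smoothM sq.
have r0 : (0 < (q * r') %% p < p)%N.
  rewrite ltn_mod (prime_gt0 p_pr) andbT lt0n; apply: contraNneq qr0 => e.
  by rewrite intFp_eq0 // dvdzE /= /dvdn e.
exists ((q * r') %% p)%N; split=> //.
  rewrite ev intrM er' -!pmulrn -natrM {1}(divn_eq (q * r') p) natrD natrM.
  by rewrite -[p%:R]/(p%:~R) (eqP (_ : p%:~R == 0)) ?mulr0 ?add0r // intFp_eq0 // dvdzz.
have {Hr'} e1 : f (p%:R * v%:~R) - f (p%:R * (q * r')%N%:R) \in smooth_gen f p.-1.
  rewrite (_ : p%:R * v%:~R = q%:~R * (p%:R * v'%:~R) :> rat); last first.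
    by rewrite ev intrM; ring.
  rewrite (_ : p%:R * (q * r')%N%:R = q%:~R * (p%:R * r'%:R) :> rat) //.
  by rewrite natrM -pmulrn; ring.
rewrite -(subrKA (f (p%:R * (q * r')%N%:R))) rpredD //.
(* Both [q] and [r'] lie below [p], so the quotient of [q r'] by [p] does too: it is zero or
   (p-1)-smooth. *)
apply: (@tate_base _ _ (q * r')%N%:Z ((q * r') %% p)%N%:Z ((q * r') %/ p)%N%:Z) => //.
- by rewrite PoszM smoothM sq.
- exact: sm.
- have [->|d0] := posnP ((q * r') %/ p)%N; [by left|right].
  by apply: sm; rewrite d0 ltn_divLR ?(prime_gt0 p_pr) //; nia.
by rewrite {1}(divn_eq (q * r') p); lia.
Qed.

Section Step.
Variables (A : zmodType) (f : rat -> A).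
Hypothesis wf : witt_fun f.

Let I := smooth_gen f p.-1.
Let piI (x : A) : Quotient.quot I := \pi_(Quotient.quot I)%qT x.

Lemma piI_eq x y : x - y \in I -> piI x = piI y.
Proof. by rewrite Quotient.idealrBE => /eqP. Qed.

(* Modulo the classes of (p-1)-smooth integers, this inverts the residue map
   at p: u is sent to the class of p u. *)
Definition tate_map (u : 'F_p) : Quotient.quot I := piI (f (p%:R * (val u)%:R)).

Lemma val_Fp_lt (u : 'F_p) : (val u < p)%N.
Proof. by rewrite -[X in (_ < X)%N](Fp_cast p_pr) ltn_ord. Qed.

Lemma tate_mapE (v : int) : smooth p.-1 v ->
  tate_map v%:~R = piI (f (p%:R * v%:~R)).
Proof.
move=> sv; have [r [rp -> Hr]] := tate_red wf sv.
rewrite /tate_map (piI_eq Hr) /= val_Fp_nat // modn_small //.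
by case/andP: rp.
Qed.

Lemma Fp_lift (u : 'F_p) : u != 0 -> exists v : int,
  [/\ smooth p.-1 v, u = v%:~R, 0 < v & v < p%:Z].
Proof.
move=> u0; have l := val_Fp_lt u.
have v0 : val u != 0%N by apply: contraNneq u0 => e; apply/eqP/val_inj.
exists (val u); split; try by lia.
  by apply: smooth_small; lia.
by rewrite -pmulrn natr_Zp.
Qed.

Lemma tate_map_witt : witt_fun tate_map.
Proof.
have [f_sq f_opp f_add] := wf; have p0 := prime_natr_neq0 p_pr rat.
split=> [a b /Fp_lift[u [su -> _ _]] /Fp_lift[v [sv -> _ _]]|
         a /Fp_lift[u [su -> _ _]]|a b a0 b0 ab0].
- rewrite -rmorphXn -intrM !tate_mapE ?smoothM ?su ?sv //.
  rewrite intrM mulrA rmorphXn f_sq ?mulf_neq0 ?intr_eq0 //;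
    exact: smooth_neq0 sv || exact: smooth_neq0 su.
- rewrite -intrN !tate_mapE ?smooth_opp // -raddfD /= intrN mulrN f_opp ?raddf0 //.
  by rewrite mulf_neq0 // intr_eq0 (smooth_neq0 su).
have [u [su ea u0 up]] := Fp_lift a0; have [v [sv eb v0 vp]] := Fp_lift b0.
have pF0 : p%:~R = 0 :> 'F_p by apply/eqP; rewrite intFp_eq0 ?dvdzz.
(* Lifting [b] to a negative integer keeps the sum of the two lifts strictly between [-p] and [p],
   hence (p-1)-smooth. *)
have {eb}eb : b = (v - p%:Z)%:~R by rewrite intrB pF0 subr0.
set w := v - p%:Z in eb.
have sw : smooth p.-1 w by apply: smooth_small; rewrite /w; lia.
have uw0 : u + w != 0.
  by apply: contraNneq ab0 => e; rewrite ea eb -intrD e.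
have suw : smooth p.-1 (u + w) by apply: smooth_small => //; rewrite /w; lia.
rewrite ea eb -intrD -!intrM !tate_mapE ?smoothM ?su ?sw // -!raddfD /=.
have [uQ wQ uwQ] : [/\ u%:~R != 0 :> rat, w%:~R != 0 :> rat & (u + w)%:~R != 0 :> rat].
  by rewrite !intr_eq0 (smooth_neq0 su) (smooth_neq0 sw).
rewrite f_add ?mulf_neq0 // -?mulrDr -?intrD ?mulf_neq0 //.
rewrite -(f_sq (p%:R * (u * w * (u + w))%:~R) p%:R) ?mulf_neq0 ?intr_eq0 ?mulf_neq0 //.
- by congr (piI (_ + f _)); rewrite !intrM; ring.
- exact: smooth_neq0 su.
- exact: smooth_neq0 sw.
Qed.

(** Up to squares [v] is [u] or [p u] with [u] (p-1)-smooth: the first dies in the quotient, and the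
    second is the value of [tate_map] at its residue. *)
Lemma residue_smooth (v : int) : smooth p v -> residue tate_map v%:~R = piI (f v%:~R).
Proof.
move=> sv; have [u ev u0] := int_pfactor p_pr (smooth_neq0 sv).
set k := logn p _ in ev.
have [f_sq _ _] := wf; have p0 := prime_natr_neq0 p_pr rat.
have su : smooth p.-1 u.
  move: sv; rewrite ev smoothM => /andP[/andP[nu /allP H] _].
  rewrite /smooth nu; apply/allP => q qu; have := H q qu.
  rewrite leq_eqVlt => /orP[/eqP e|]; last by have := (prime_gt0 p_pr); lia.
  by move: qu u0; rewrite e mem_primes intFp_eq0 // dvdzE => /and3P[_ _ ->].
have uQ : u%:~R != 0 :> rat by rewrite intr_eq0 (smooth_neq0 su).
have -> : v%:~R = p%:R ^+ k * u%:~R :> rat.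
  by rewrite ev intrM rmorphXn /= -pmulrn mulrC.
rewrite (residue_int p_pr tate_map_witt) // tate_mapE //.
have -> : p%:R ^+ k * u%:~R = p%:R ^+ odd k * u%:~R * (p%:R ^+ k./2) ^+ 2 :> rat.
  by rewrite -{1}(odd_double_half k) exprD -exprM muln2; ring.
rewrite f_sq ?mulf_neq0 ?expf_neq0 //.
case: odd; rewrite ?expr1 ?expr0 ?mul1r //.
by apply/esym/eqP; rewrite -(raddf0 piI) -Quotient.idealrBE subr0 smooth_genP.
Qed.

Lemma tate_step s : all (smooth p) s -> isum (residue tate_map) s = 0 ->
  isum f s \in I.
Proof.
move=> /allP ss rs; rewrite -[isum f s]subr0 Quotient.idealrBE raddf0.
rewrite -rs /isum /wsum raddf_sum /= !big_map; apply/eqP.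
by rewrite big_seq [RHS]big_seq; apply: eq_bigr => v /ss /residue_smooth ->.
Qed.

End Step.
End Tate.

(** Quantifying over all Witt functions [h] expresses that the residue vanishes in the Witt group of
    [F_p]. The instance that drives the descent is [tate_map]. *)
Definition unramified (d : seq rat) : Prop :=
  forall (p : nat) (A : zmodType) (h : 'F_p -> A),
    prime p -> witt_fun h -> wsum (residue h) d = 0.

(** Summing signs gives the signature, so [wsum_cong] applied to this function is Sylvester's law of
    inertia. *)
Lemma sg_witt : witt_fun (@Num.sg rat).
Proof.
split=> [a b a0 b0|a a0|a b a0 b0 ab0].
- by rewrite sgrM sgrX sqr_sg b0 mulr1.
- by rewrite sgrN subrr.
rewrite !sgrM; case: (sgrP a) a0 => // a0 _; case: (sgrP b) b0 => // b0 _.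
- by rewrite gtr0_sg ?addr_gt0 //; ring.
- by ring.
- by ring.
- by rewrite ltr0_sg; [ring | lra].
Qed.

Lemma smooth_pred k v : ~~ prime k -> smooth k v -> smooth k.-1 v.
Proof.
move=> npk /andP[v0 /allP H]; rewrite /smooth v0; apply/allP => q qv.
have := H q qv; rewrite leq_eqVlt => /orP[/eqP e|]; last by lia.
by move: npk qv; rewrite -e mem_primes => /negPf ->.
Qed.

Lemma smooth_gen_wclass k x : x \in smooth_gen wclass k ->
  exists s, all (smooth k) s /\ x = isum wclass s.
Proof.
move=> /asboolP[s [t [ss st ->]]]; exists (s ++ map -%R t).
split; first by rewrite all_cat ss all_map (eq_all (smooth_opp k)).
rewrite isum_cat; congr (_ + _).
have e : map intr (map -%R t) = map -%R (map intr t) :> seq rat.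
  by rewrite -!map_comp; apply: eq_map => v /=; rewrite intrN.
rewrite /isum e wsum_opp //; first exact: wclass_witt.
by rewrite /nonzeros all_map; apply: sub_all st => v /= /smooth_neq0; rewrite intr_eq0.
Qed.

Lemma nonzeros_smooth k s : all (smooth k) s -> nonzeros (map intr s).
Proof.
by rewrite /nonzeros all_map; apply: sub_all => v /= /smooth_neq0; rewrite intr_eq0.
Qed.

(** A smooth representative [s] of the class has the same residues as [d], namely zero, so
    [tate_step] removes the prime [k]; for [k] not prime, [k]-smooth integers are already
    (k-1)-smooth. *)
Lemma unramified_smooth_gen d k : nonzeros d -> unramified d ->
  wsum wclass d \in smooth_gen wclass k -> wsum wclass d \in smooth_gen wclass k.-1.
Proof.
move=> nzd ud /smooth_gen_wclass[s [ss es]].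
have [pk|npk] := boolP (prime k); last first.
  apply/asboolP; exists s, [::]; split=> //; last by rewrite es /isum wsum_nil subr0.
  by apply: sub_all ss => v; exact: smooth_pred.
rewrite es; apply: (tate_step pk wclass_witt) => //.
have wt := tate_map_witt pk wclass_witt.
rewrite -(ud k _ _ pk wt); apply: (wclass_universal (residue_witt pk wt)) => //.
exact: nonzeros_smooth ss.
Qed.

Lemma unramified_neutral d : nonzeros d -> unramified d ->
  wsum (@Num.sg rat) d = 0 -> neutral d.
Proof.
move=> nzd ud sd; apply/wsum_wclass0 => //.
have [w_sq w_opp _] := wclass_witt.
have [k wk] : exists k, wsum wclass d \in smooth_gen wclass k.
  elim: d nzd {ud sd} => [_|a d IH /= /andP[a0 /IH[k /asboolP [s [t [ss st e]]]]]].
    by exists 0%N; rewrite wsum_nil rpred0.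
  pose v := numq a * denq a.
  have v0 : v != 0 by rewrite mulf_neq0 ?numq_eq0 ?denq_eq0.
  have sub l m : (l <= m)%N -> forall u, smooth l u -> smooth m u.
    move=> lm u /andP[u0 H]; rewrite /smooth u0.
    by apply: sub_all H => q ql; apply: leq_trans lm.
  exists (maxn k `|v|); rewrite wsum_cons; apply: rpredD.
    have -> : wclass a = wclass v%:~R.
      rewrite -(w_sq a (denq a)%:~R) ?intr_eq0 ?denq_eq0 //.
      by rewrite /v intrM numqE expr2 mulrA.
    by apply: smooth_genP; apply: smooth_small => //; rewrite leq_maxr.
  apply/asboolP; exists s, t; split=> //.
    by apply: sub_all ss; apply: sub; rewrite leq_maxl.
  by apply: sub_all st; apply: sub; rewrite leq_maxl.
have {k wk} : wsum wclass d \in smooth_gen wclass 0.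
  by elim: k wk => // k IH wk; apply: IH; apply: (@unramified_smooth_gen _ k.+1).
move=> /smooth_gen_wclass[s [ss es]].
have := wclass_universal sg_witt nzd (nonzeros_smooth ss) es.
rewrite sd es /isum /wsum !big_map => H.
(* At level 0 only [1] and [-1] remain, so the class is the signature times the class of 1. *)
have -> : \sum_(v <- s) wclass v%:~R = wclass 1 *~ \sum_(v <- s) sgz v.
  rewrite mulrz_sumr big_seq [RHS]big_seq; apply: eq_bigr => v vs.
  have [->|->] := smooth0 (allP ss v vs); first by rewrite mulr1z.
  by rewrite mulrN1z; apply/esym/addr0_eq; apply: w_opp.
suff -> : \sum_(v <- s) sgz v = 0 by rewrite mulr0z.
apply: (@intr_inj rat); rewrite -[RHS]/(0 : rat) H raddf_sum /=.
rewrite big_seq [RHS]big_seq; apply: eq_bigr => v vs.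
by have [->|->] := smooth0 (allP ss v vs).
Qed.

(** * Unimodular forms of signature zero *)

Section LocalDiag.
Variables (F : fieldType) (O : subringClosed F).

Definition local_unit (x : F) : bool := [&& x != 0, x \in O & x^-1 \in O].

Hypothesis local_add : forall x y, x \in O -> y \in O ->
  local_unit (x + y) -> local_unit x \/ local_unit y.
Hypothesis local_two : local_unit 2.

Lemma local_unitM x y : local_unit x -> local_unit y -> local_unit (x * y).
Proof.
move=> /and3P[x0 xO x'O] /and3P[y0 yO y'O].
by rewrite /local_unit mulf_neq0 // invfM !rpredM.
Qed.

Lemma local_unit_mulr x y : x \in O -> y \in O -> local_unit (x * y) -> local_unit x.
Proof.
move=> xO yO /and3P[]; rewrite mulf_eq0 negb_or => /andP[x0 y0] xyO iO.
rewrite /local_unit x0 xO (_ : x^-1 = y * (x * y)^-1) ?rpredM //.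
by rewrite invfM mulrCA mulfV ?mulr1.
Qed.

Lemma local_unit_sum (I : finType) (x : I -> F) : (forall i, x i \in O) ->
  local_unit (\sum_i x i) -> exists i, local_unit (x i).
Proof.
move=> xO us; apply/existsP; apply: contraLR us; rewrite negb_exists => /forallP nu.
suff /andP[] : (\sum_i x i \in O) && ~~ local_unit (\sum_i x i) by [].
apply: (big_ind (fun y => (y \in O) && ~~ local_unit y)) => [|y z|i _].
- by rewrite rpred0 /local_unit eqxx.
- move=> /andP[yO yu] /andP[zO zu]; rewrite rpredD //=.
  by apply/negP => /(local_add yO zO) [|]; apply/negP.
by rewrite xO nu.
Qed.

Lemma local_det m (B : 'M[F]_m) : (forall i j, B i j \in O) -> \det B \in O.
Proof.
move=> BO; apply: rpred_sum => s _; apply: rpredM; first by rewrite rpredX // rpredN1.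
by apply: rpred_prod.
Qed.

Lemma local_mulmx m n q (B : 'M[F]_(m, n)) (C : 'M[F]_(n, q)) :
  (forall i j, B i j \in O) -> (forall i j, C i j \in O) ->
  forall i j, (B *m C) i j \in O.
Proof. by move=> BO CO i j; rewrite mxE rpred_sum // => k _; rewrite rpredM. Qed.

(** If no diagonal entry is a unit, expanding the determinant along row 0 yields a unit [B 0 j] with
    [j != 0]. Adding basis vector [j] to vector 0 gives the diagonal entry
    [B 0 0 + 2 * B 0 j + B j j], a unit because exactly its middle term is one. *)
Lemma local_pivot m (B : 'M[F]_(1 + m)) : B^T = B ->
  (forall i j, B i j \in O) -> local_unit (\det B) ->
  exists Q : 'M[F]_(1 + m), [/\ forall i j, Q i j \in O,
    \det Q ^+ 2 = 1 & local_unit ((Q *m B *m Q^T) 0 0)].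
Proof.
move=> Bs BO Bu.
have [/existsP[i ui]|/existsPn nd] := boolP [exists i, local_unit (B i i)].
  exists (tperm_mx 0 i); split.
  - by move=> k l; rewrite !mxE rpred_nat.
  - by rewrite det_perm sqrr_sign.
  rewrite tr_perm_mx -[_ *m perm_mx _]col_permE -row_permE !mxE.
  by rewrite ?tpermV tpermL.
have [j uj] : exists j, local_unit (B 0 j).
  move: Bu; rewrite (expand_det_row _ 0) => /local_unit_sum[j|j].
    rewrite rpredM // /cofactor rpredM ?rpredX ?rpredN1 //.
    by apply: local_det => k l; rewrite !mxE.
  move=> /local_unit_mulr uj; exists j; apply: uj => //.
  rewrite /cofactor rpredM ?rpredX ?rpredN1 //.
  by apply: local_det => k l; rewrite !mxE.
case: (split_ordP j) => j' ej; first by move: uj (nd 0); rewrite ej ord1 lshift0 => ->.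
have e0 : 0 = lshift m 0 :> 'I_(1 + m) by apply: val_inj.
pose Q : 'M[F]_(1 + m) := block_mx 1%:M (delta_mx 0 j') 0 1%:M.
exists Q; split.
- move=> k l; case: (split_ordP k) => k' ->; case: (split_ordP l) => l' ->.
  + by rewrite block_mxEul mxE rpred_nat.
  + by rewrite block_mxEur mxE rpred_nat.
  + by rewrite block_mxEdl mxE rpred0.
  by rewrite block_mxEdr mxE rpred_nat.
- by rewrite det_ublock !det1 mulr1 expr1n.
have -> : (Q *m B *m Q^T) 0 0 = B 0 0 + (2 * B 0 j + B j j).
  have r0 : row 0 Q = delta_mx 0 0 + delta_mx 0 j.
    apply/rowP => l; rewrite e0 ej; case: (split_ordP l) => l' ->.
      rewrite mxE; apply: etrans (block_mxEul _ _ _ _ _ _) _.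
      by rewrite (ord1 l') !mxE -!val_eqE /= addr0.
    rewrite mxE; apply: etrans (block_mxEur _ _ _ _ _ _) _.
    by rewrite !mxE -!val_eqE /= add0r.
  have -> : (Q *m B *m Q^T) 0 0 = (row 0 Q *m B *m (row 0 Q)^T) 0 0.
    rewrite -row_mul tr_row [LHS]mxE [RHS]mxE; apply: eq_bigr => k _.
    by congr (_ * _); apply/esym; rewrite mxE.
  rewrite r0 linearD /= !trmx_delta mulmxDl !mulmxDr !mulmxDl -!rowE -!colE !mxE.
  have -> : B j 0 = B 0 j by rewrite -[in LHS]Bs mxE.
  by ring.
have BjjN := nd j; have B00N := nd 0.
have u2 := local_unitM local_two uj; have O2 : 2 * B 0 j \in O by case/and3P: u2.
apply: contraT => nu.
have Bs2 : 2 * B 0 j = (B 0 0 + (2 * B 0 j + B j j)) + (- (B 0 0) + - (B j j)) by ring.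
have uN x : local_unit (- x) = local_unit x.
  by rewrite /local_unit oppr_eq0 invrN !rpredN.
have O00 : - B 0 0 \in O by rewrite rpredN.
have Ojj : - B j j \in O by rewrite rpredN.
have Onew : B 0 0 + (2 * B 0 j + B j j) \in O by rewrite !rpredD.
move: u2; rewrite Bs2 => /(local_add Onew (rpredD O00 Ojj))[/(negP nu) //|].
by case/(local_add O00 Ojj); rewrite uN; [move/(negP B00N) | move/(negP BjjN)].
Qed.

(** The unit pivot [a] splits off with Schur complement [C'], which has entries in [O] as [a^-1]
    does lie there, and whose determinant times [a] is that of [B]. *)
Lemma diag_local m (B : 'M[F]_m) : B^T = B ->
  (forall i j, B i j \in O) -> local_unit (\det B) ->
  exists (P : 'M[F]_m) (d : 'rV[F]_m), [/\ P \in unitmx,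
    P *m B *m P^T = diag_mx d & forall i, local_unit (d 0 i)].
Proof.
elim: m B => [|m IH] B Bs BO Bu.
  exists 1%:M, 0; split=> [||[]//]; first exact: unitmx1.
  by apply/matrixP => -[].
change 'M[F]_(1 + m) in B.
have [Q [QO Qd Qu]] := local_pivot Bs BO Bu.
set B1 := Q *m B *m Q^T in Qu.
have B1s : B1^T = B1 by rewrite /B1 !trmx_mul trmxK Bs mulmxA.
have B1O i j : B1 i j \in O.
  by apply: local_mulmx => [|k l]; [exact: local_mulmx | rewrite mxE].
have B1u : local_unit (\det B1).
  by rewrite /B1 !det_mulmx det_tr mulrC mulrA -expr2 Qd mul1r.
have uQ : Q \in unitmx.
  by rewrite unitmxE unitfE; apply/eqP => e; move: Qd; rewrite e expr0n => /esym/eqP;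
    rewrite oner_eq0.
suff [P [d [uP HP Hd]]] : exists (P : 'M[F]_(1 + m)) (d : 'rV[F]_(1 + m)),
    [/\ P \in unitmx, P *m B1 *m P^T = diag_mx d & forall i, local_unit (d 0 i)].
  exists (P *m Q), d; split=> //; first by rewrite unitmx_mul uP.
  by rewrite trmx_mul -HP /B1 !mulmxA.
clearbody B1; move: {Bs BO Bu Q QO Qd uQ} B1 Qu B1s B1O B1u => {}B ua Bs BO Bu.
pose a := B 0 0; pose v := ursubmx B; pose C := drsubmx B.
have eB : B = block_mx a%:M v v^T C.
  rewrite -[LHS]submxK; congr block_mx.
    rewrite [LHS]mx11_scalar /a; congr (_%:M); rewrite !mxE; congr (B _ _); exact: val_inj.
  by rewrite /v -[in RHS]Bs; apply/matrixP => i j; rewrite !mxE.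
have a0 : a != 0 by case/and3P: ua.
pose C' := C - a^-1 *: (v^T *m v).
pose P1 : 'M[F]_(1 + m) := block_mx 1%:M 0 (- a^-1 *: v^T) 1%:M.
have HP1 : P1 *m B *m P1^T = block_mx a%:M 0 0 C'.
  rewrite eB /P1 tr_block_mx !mulmx_block !trmx0 !trmx1.
  rewrite !(mul0mx, mulmx0, mulmx1, mul1mx, addr0, add0r).
  rewrite linearZ /= trmxK !mul_mx_scalar mul_scalar_mx !scalerA.
  have -> : a * - a^-1 = -1 by rewrite mulrN mulfV.
  rewrite !scaleN1r !addNr mul0mx add0r; congr block_mx.
  by rewrite addrC /C' -scalemxAl scaleNr.
have iaO : a^-1 \in O by case/and3P: ua.
have aO : a \in O by case/and3P: ua.
have C's : C'^T = C'.
  have Cs : C^T = C by rewrite /C -[in RHS]Bs; apply/matrixP => i j; rewrite !mxE.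
  by rewrite /C' linearB linearZ /= trmx_mul trmxK Cs.
have C'O i j : C' i j \in O.
  have vv : (v^T *m v) i j \in O by apply: local_mulmx => k l; rewrite !mxE.
  have -> : C' i j = C i j - a^-1 * (v^T *m v) i j by rewrite mxE [in X in _ + X]mxE
    [in X in - X]mxE.
  by rewrite rpredB ?rpredM // !mxE.
have C'u : local_unit (\det C').
  have := det_mulmx (P1 *m B) P1^T; rewrite HP1 det_ublock det_scalar1 det_tr det_mulmx.
  rewrite det_lblock !det1 !mulr1 mul1r => e.
  have : local_unit (\det C' * a) by rewrite mulrC e.
  by apply: local_unit_mulr => //; apply: local_det.
have [P [d [uP HP Hd]]] := IH C' C's C'O C'u.
exists (block_mx 1%:M 0 0 P *m P1), (row_mx a%:M d); split.
- by rewrite unitmx_mul !unitmxE det_ublock det_lblock !det1 mul1r mulr1 -unitmxE uP unitr1.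
- rewrite trmx_mul -!mulmxA (mulmxA B) (mulmxA P1) (mulmxA P1) HP1.
  rewrite tr_block_mx !mulmx_block !trmx0 trmx1.
  rewrite !(mul0mx, mulmx0, mulmx1, mul1mx, addr0, add0r) mulmxA HP diag_mx_row.
  by congr block_mx; apply/matrixP => i j; rewrite !ord1 !mxE.
move=> i; case: (split_ordP i) => i' ->; first by rewrite row_mxEl ord1 mxE mulr1n.
by rewrite row_mxEr.
Qed.
End LocalDiag.

(** The whole field as a subring, so that [diag_local] also diagonalizes over [Q]. *)
Definition any_rat : {pred rat} := fun _ => true.

Lemma any_rat_closed : subring_closed any_rat. Proof. by split. Qed.

HB.instance Definition _ := GRing.isSubringClosed.Build rat any_rat any_rat_closed.

Definition row_seq m (d : 'rV[rat]_m) : seq rat := [seq d 0 i | i <- enum 'I_m].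

Lemma size_row_seq m (d : 'rV[rat]_m) : size (row_seq d) = m.
Proof. by rewrite size_map size_enum_ord. Qed.

Lemma nth_row_seq m (d : 'rV[rat]_m) (i : 'I_m) : (row_seq d)`_i = d 0 i.
Proof. by rewrite (nth_map i) ?size_enum_ord // nth_ord_enum. Qed.

Lemma diag_row_seq m (d : 'rV[rat]_m) : diag_seq m (row_seq d) = diag_mx d.
Proof. by congr diag_mx; apply/rowP => i; rewrite mxE nth_row_seq. Qed.

Lemma nonzeros_row_seq m (d : 'rV[rat]_m) :
  nonzeros (row_seq d) = [forall i, d 0 i != 0].
Proof.
rewrite /nonzeros all_map; apply/allP/forallP => [H i|H i _]; last exact: H.
by apply: H; rewrite mem_enum.
Qed.

Lemma wsum_row_seq (A : zmodType) (f : rat -> A) m (d : 'rV[rat]_m) :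
  wsum f (row_seq d) = \sum_i f (d 0 i).
Proof. by rewrite /wsum big_map -[RHS]big_enum. Qed.

Lemma rat_diag m (B : 'M[rat]_m) : B^T = B -> B \in unitmx ->
  exists (P : 'M[rat]_m) (d : 'rV[rat]_m),
    [/\ P \in unitmx, P *m B *m P^T = diag_mx d & forall i, d 0 i != 0].
Proof.
move=> Bs; rewrite unitmxE unitfE => B0.
have lu x : local_unit any_rat x = (x != 0) by rewrite /local_unit andbT.
have [||//||P [d [uP HP Hd]]] := @diag_local _ any_rat _ _ m B Bs.
- move=> x y _ _; rewrite !lu; have [->|] := eqVneq x 0; last by left.
  by rewrite add0r; right.
- by rewrite lu.
- by rewrite lu.
by exists P, d; split=> // i; rewrite -lu.
Qed.

(* Coprimality rather than non-divisibility keeps the subring instance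
   independent of a primality proof. *)
Definition local_at (p : nat) : {pred rat} := fun x =>
  `[< exists a k : int, [/\ k != 0, coprimez p k & x = a%:~R / k%:~R] >].

Lemma local_at_closed p : subring_closed (local_at p).
Proof.
split.
- by apply/asboolP; exists 1, 1; split; rewrite ?divr1 // /coprimez gcdz1.
- move=> x y /asboolP[a [k [k0 pk ->]]] /asboolP[b [l [l0 pl ->]]]; apply/asboolP.
  exists (a * l - b * k), (k * l); split; rewrite ?mulf_neq0 ?coprimezMr ?pk //.
  by rewrite !(intrM, intrB); field; rewrite !intr_eq0 ?k0 ?l0.
move=> x y /asboolP[a [k [k0 pk ->]]] /asboolP[b [l [l0 pl ->]]]; apply/asboolP.
exists (a * b), (k * l); split; rewrite ?mulf_neq0 ?coprimezMr ?pk //.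
by rewrite !intrM; field; rewrite !intr_eq0 ?k0 ?l0.
Qed.

HB.instance Definition _ p := GRing.isSubringClosed.Build rat (local_at p)
  (local_at_closed p).

Section Localization.
Variables (p : nat) (p_pr : prime p).

Lemma dvdz_primeM (a b : int) : (p %| a * b)%Z = (p %| a)%Z || (p %| b)%Z.
Proof. by rewrite !dvdzE abszM Euclid_dvdM. Qed.

Lemma ndvd_neq0 (k : int) : ~~ (p %| k)%Z -> k%:~R != 0 :> rat.
Proof. by rewrite intr_eq0; apply: contraNneq => ->; rewrite dvdz0. Qed.

Lemma local_atP x : reflect (exists a k : int, ~~ (p %| k)%Z /\ x = a%:~R / k%:~R)
  (x \in local_at p).
Proof.
apply: (iffP (asboolP _)) => [[a [k [_ pk ->]]]|[a [k [pk ->]]]]; exists a, k.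
  by split=> //; move: pk; rewrite coprimezE prime_coprime.
by split; rewrite // -?(intr_eq0 rat) ?ndvd_neq0 // coprimezE prime_coprime.
Qed.

Lemma local_at_int (a : int) : a%:~R \in local_at p.
Proof. by rewrite rpred_int. Qed.

Lemma local_at_unitP (a k : int) : ~~ (p %| k)%Z ->
  local_unit (local_at p) (a%:~R / k%:~R) = ~~ (p %| a)%Z.
Proof.
move=> pk; apply/idP/idP => [/and3P[x0 _ /local_atP[b [l [pl e]]]]|pa].
  have k0 := ndvd_neq0 pk; have l0 := ndvd_neq0 pl.
  have a0 : a%:~R != 0 :> rat by apply: contraNneq x0 => ->; rewrite mul0r.
  have : a * b = k * l.
    apply: (@intr_inj rat); rewrite !intrM.
    have -> : b%:~R = (a%:~R / k%:~R)^-1 * l%:~R :> rat by rewrite e divfK.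
    by field; rewrite ?a0 ?k0 ?l0.
  move=> /(congr1 (fun z => ~~ (p %| z)%Z)).
  by rewrite !dvdz_primeM !negb_or pk pl => /andP[].
apply/and3P; split.
- by rewrite mulf_neq0 ?invr_eq0 ?ndvd_neq0.
- by apply/local_atP; exists a, k.
by apply/local_atP; exists k, a; split=> //; rewrite invf_div.
Qed.

Lemma ndvdz1 : ~~ (p %| 1)%Z.
Proof. by rewrite dvdzE /= dvdn1; case: eqP p_pr => // ->. Qed.

Lemma local_at_unit_int (a : int) : local_unit (local_at p) a%:~R = ~~ (p %| a)%Z.
Proof. by rewrite -(local_at_unitP a ndvdz1) mulr1z divr1. Qed.

Lemma local_at_add x y : x \in local_at p -> y \in local_at p ->
  local_unit (local_at p) (x + y) -> local_unit (local_at p) x \/ local_unit (local_at p) y.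
Proof.
move=> /local_atP[a [k [pk ->]]] /local_atP[b [l [pl ->]]].
have -> : a%:~R / k%:~R + b%:~R / l%:~R = (a * l + b * k)%:~R / (k * l)%:~R :> rat.
  by rewrite intrD !intrM; field; rewrite !ndvd_neq0.
rewrite !local_at_unitP ?dvdz_primeM ?negb_or ?pk // => H; apply/orP.
by apply: contraR H; rewrite negb_or !negbK => /andP[pa pb]; rewrite rpredD ?dvdz_mulr.
Qed.

(** Up to the square of its denominator a local unit is an integer prime to [p], of even valuation
    0. *)
Lemma residue_local_unit (A : zmodType) (h : 'F_p -> A) x : witt_fun h ->
  local_unit (local_at p) x -> residue h x = 0.
Proof.
move=> wh ux; have /and3P[_ /local_atP[a [k [pk ex]]] _] := ux.
move: ux; rewrite ex local_at_unitP // => pa.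
have -> : a%:~R / k%:~R = k%:~R^-1 ^+ 2 * p%:R ^+ 0 * (a * k)%:~R :> rat.
  by rewrite expr0 intrM; field; rewrite ndvd_neq0.
rewrite (residueE p_pr wh) ?invr_eq0 ?ndvd_neq0 //.
by rewrite intFp_eq0 // dvdz_primeM negb_or pa.
Qed.

End Localization.

(* At p = 2, where a unimodular form need not be diagonalizable with unit
   entries, the residue only sees the parity of the valuation, hence the
   determinant. *)
Lemma residue2M (A : zmodType) (h : 'F_2 -> A) a b : witt_fun h ->
  a != 0 -> b != 0 -> residue h (a * b) = residue h a + residue h b.
Proof.
move=> wh a0 b0; have p2 : prime 2 by [].
have one (u : 'F_2) : u != 0 -> u = 1.
  by case: u => -[|[|//]] // i _; apply: val_inj.
have [c [k [u [c0 u0 ->]]]] := rat_pfactor p2 a0.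
have [e [l [v [e0 v0 ->]]]] := rat_pfactor p2 b0.
have -> : c ^+ 2 * 2%:R ^+ k * u%:~R * (e ^+ 2 * 2%:R ^+ l * v%:~R) =
   (c * e) ^+ 2 * 2%:R ^+ (k + l) * (u * v)%:~R.
  by rewrite exprD intrM; ring.
have h2 : h 1 + h 1 = 0.
  by case: wh => _ h_opp _; rewrite -[RHS](h_opp 1) ?oner_eq0 //; congr (_ + h _);
    apply: val_inj.
rewrite !(residueE p2 wh) ?mulf_neq0 ?intrM ?mulf_neq0 // (one _ u0) (one _ v0) mulr1 oddD.
by case: odd; case: odd; rewrite ?addr0 ?add0r.
Qed.

(** The residue sum does not depend on the rational diagonalization, and for odd [p] one with unit
    entries is available. At 2 the sum is the residue of the determinant, which is 1 or -1 times a
    square. *)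
Lemma unimodular_unramified m (B : 'M[int]_m) (P : 'M[rat]_m) (d : 'rV[rat]_m) :
  B^T = B -> B \in unitmx -> P \in unitmx ->
  P *m map_mx intr B *m P^T = diag_mx d -> (forall i, d 0 i != 0) ->
  unramified (row_seq d).
Proof.
move=> Bs uB uP HP d0 p A h p_pr wh.
have nzd : nonzeros (row_seq d) by rewrite nonzeros_row_seq; apply/forallP.
have dB : \det (map_mx intr B : 'M[rat]_m) = (\det B)%:~R by rewrite det_map_mx.
have dB1 : \det B = 1 \/ \det B = -1.
  by move: uB; rewrite unitmxE => /orP[] /eqP ->; [left | right].
have [p2|p2] := eqVneq p 2%N.
  subst p; rewrite wsum_row_seq.
  have rM : forall s : seq 'I_m, \sum_(i <- s) residue h (d 0 i) = residue h
    (\prod_(i <- s) d 0 i)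
      /\ \prod_(i <- s) d 0 i != 0.
    elim=> [|i s [IH n0]].
      by rewrite !big_nil oner_eq0; split=> //.
    by rewrite !big_cons IH residue2M // mulf_neq0.
  have [-> _] := rM (index_enum 'I_m); rewrite -det_diag -HP !det_mulmx det_tr dB.
  set x := \det P; have x0 : x != 0 by rewrite -unitfE -unitmxE.
  have -> : x * (\det B)%:~R * x = x ^+ 2 * 2%:R ^+ 0 * (\det B)%:~R by ring.
  by rewrite (residueE p_pr wh) //; case: dB1 => ->.
have lu2 : local_unit (local_at p) 2%:~R.
  by rewrite local_at_unit_int // dvdzE /= dvdn_prime2.
have [|||Q [e [uQ HQ ue]]] := @diag_local _ (local_at p) (local_at_add p_pr) lu2 m
  (map_mx intr B).
- by rewrite map_trmx Bs.
- by move=> i j; rewrite mxE local_at_int.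
- by rewrite dB local_at_unit_int //; case: dB1 => ->; rewrite ?rpredN ndvdz1.
have nze : nonzeros (row_seq e).
  by rewrite nonzeros_row_seq; apply/forallP => i; case/and3P: (ue i).
rewrite (wsum_cong (residue_witt p_pr wh) nzd nze); last first.
  exists m, (Q *m invmx P); rewrite !size_row_seq !diag_row_seq; split=> //.
    by rewrite unitmx_mul uQ unitmx_inv.
  by rewrite trmx_mul -HP trmx_inv !mulmxA mulmxKV // mulmxK ?unitmx_tr.
rewrite wsum_row_seq big1 // => i _; exact: (residue_local_unit p_pr wh).
Qed.

Lemma unimodular_isotropic m (B : 'M[int]_m) (P : 'M[rat]_m) (d : 'rV[rat]_m) :
  (0 < m)%N -> B^T = B -> B \in unitmx -> P \in unitmx ->
  P *m map_mx intr B *m P^T = diag_mx d -> (forall i, d 0 i != 0) ->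
  \sum_i Num.sg (d 0 i) = 0 ->
  exists2 x : 'rV[int]_m, x != 0 & x *m B *m x^T = 0.
Proof.
move=> m0 Bs uB uP HP d0 sd.
have nzd : nonzeros (row_seq d) by rewrite nonzeros_row_seq; apply/forallP.
have [k [m' [Q [es et uQ HQ]]]] : neutral (row_seq d).
  apply: unramified_neutral => //; last by rewrite wsum_row_seq.
  exact: (unimodular_unramified Bs uB uP HP).
move: Q et uQ HQ; rewrite -es size_row_seq diag_row_seq => Q et uQ HQ.
have k0 : (0 < k)%N by move: et m0; rewrite size_cat !size_nseq; lia.
have km : (k < m)%N by move: et m0; rewrite size_cat !size_nseq; lia.
(* Entries 0 and [k] of [hyp_seq k] are its first 1 and its first -1. *)
pose i0 : 'I_m := Ordinal m0; pose i1 : 'I_m := Ordinal km.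
pose y : 'rV[rat]_m := delta_mx 0 i0 + delta_mx 0 i1.
have i01 : i0 != i1 by rewrite -val_eqE /= ltn_eqF.
have yQ : y *m diag_seq m (hyp_seq k) *m y^T = 0.
  rewrite mulmxDl linearD /= mulmxDr !mulmxDl -!rowE !trmx_delta -!colE.
  apply/matrixP => i j; rewrite !mxE eqxx (negPf i01) eq_sym (negPf i01).
  rewrite nth_cat size_nseq k0 nth_nseq k0 nth_cat size_nseq ltnn subnn nth_nseq k0.
  by rewrite eqxx !mulr1n !mulr0n addr0 add0r subrr.
pose z := y *m Q *m P.
have z0 : z != 0.
  apply: contraTneq isT => e; have : y = 0.
    by rewrite -[y](mulmxK uQ) -[y *m Q](mulmxK uP) -/z e !mul0mx.
  by move=> /rowP/(_ i0); rewrite !mxE !eqxx (negPf i01) addr0 => /eqP; rewrite oner_eq0.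
have zB : z *m map_mx intr B *m z^T = 0.
  rewrite /z !trmx_mul.
  have -> : y *m Q *m P *m map_mx intr B *m (P^T *m (Q^T *m y^T)) =
     y *m (Q *m (P *m map_mx intr B *m P^T) *m Q^T) *m y^T by rewrite !mulmxA.
  by rewrite HP HQ.
clearbody z.
pose N := \prod_j denq (z 0 j).
have N0 : N != 0 by apply/prodf_neq0 => j _; rewrite denq_eq0.
have [x ex] : exists x : 'rV[int]_m, map_mx intr x = N%:~R *: z.
  exists (\row_j (numq (z 0 j) * \prod_(i | i != j) denq (z 0 i))).
  apply/rowP => j; rewrite !mxE /N [in RHS](bigD1 j) //= !intrM.
  by rewrite numqE; ring.
exists x.
  apply: contraNneq z0 => x0; move: ex; rewrite x0 raddf0 => /esym/eqP.
  by rewrite scaler_eq0 intr_eq0 (negPf N0).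
have : map_mx intr (x *m B *m x^T) = 0 :> 'M[rat]_1.
  rewrite !map_mxM -map_trmx ex linearZ /= -!scalemxAl -scalemxAr zB !scaler0 //.
move=> /matrixP e; apply/matrixP => i j; apply: (@intr_inj rat).
by have := e i j; rewrite !mxE.
Qed.

(** * Splitting hyperbolic planes off even unimodular forms *)

(* Quantifying over all v, not only over the diagonal entries, makes evenness
   stable under congruence by definition. *)
Definition even_mx (m : nat) (B : 'M[int]_m) : Prop :=
  forall v : 'rV[int]_m, exists c : int, (v *m B *m v^T) 0 0 = 2 * c.

Lemma even_mx_cong m k (B : 'M[int]_m) (Q : 'M[int]_(k, m)) :
  even_mx B -> even_mx (Q *m B *m Q^T).
Proof.
by move=> eB v; have [c H] := eB (v *m Q); exists c; rewrite -H trmx_mul !mulmxA.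
Qed.

Lemma sym_cong m k (B : 'M[int]_m) (Q : 'M[int]_(k, m)) :
  B^T = B -> (Q *m B *m Q^T)^T = Q *m B *m Q^T.
Proof. by move=> Bs; rewrite !trmx_mul trmxK Bs mulmxA. Qed.

Lemma tr_form k l m (R : comRingType) (B : 'M[R]_m) (u : 'M[R]_(k, m)) (v : 'M[R]_(l, m)) :
  B^T = B -> (u *m B *m v^T)^T = v *m B *m u^T.
Proof. by move=> Bs; rewrite !trmx_mul trmxK Bs mulmxA. Qed.

(** A right inverse of [A] makes the diagonal part [D1] of its Smith form invertible, so [L *m D1]
    can be absorbed into a unimodular matrix. *)
Lemma unimodular_complete k l (A : 'M[int]_(k, k + l)) (R : 'M[int]_(k + l, k)) :
  A *m R = 1%:M -> exists2 S : 'M[int]_(k + l), S \in unitmx & usubmx S = A.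
Proof.
move=> AR; have [L uL [R' uR' [d _ eA]]] := int_Smith_normal_form A.
set D := \matrix_(i, j) _ in eA.
pose D1 : 'M[int]_k := \matrix_(i, j) (d`_i *+ (i == j :> nat)).
have eD : D = row_mx D1 0.
  apply/matrixP => i j; rewrite mxE; case: (split_ordP j) => j' ->.
    by rewrite row_mxEl mxE.
  rewrite row_mxEr mxE /= (_ : (i == k + j' :> nat) = false) //.
  by apply/eqP; have := ltn_ord i; lia.
have uD1 : D1 \in unitmx.
  have : D *m (R' *m R *m L) = 1%:M.
    rewrite -[LHS](mulKmx uL) -[RHS](mulVmx uL); congr (_ *m _).
    by rewrite !mulmxA -eA AR mul1mx.
  by rewrite eD -[R' *m _ *m _]vsubmxK mul_row_col mul0mx addr0 => /mulmx1_unit[].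
exists (block_mx (L *m D1) 0 0 1%:M *m R').
  by rewrite unitmx_mul uR' unitmxE det_ublock det1 mulr1 -unitmxE unitmx_mul uL uD1.
by rewrite /block_mx mul_col_mx col_mxKu eA eD mul_mx_row mulmx0.
Qed.

(** Smith's form of a single row writes [x] as a nonzero multiple of a row of a unimodular matrix.
    Primitivity of that row is recorded by the column [r], from which [hyperbolic_pair] builds a
    partner. *)
Lemma isotropic_primitive m (B : 'M[int]_m) (x : 'rV[int]_m) :
  x != 0 -> x *m B *m x^T = 0 ->
  exists (y : 'rV[int]_m) (r : 'cV[int]_m), y *m B *m y^T = 0 /\ y *m r = 1%:M.
Proof.
move=> x0 xB; have [L uL [R uR [d _ ex]]] := int_Smith_normal_form x.
case: m => [|m] in B x x0 xB R uR ex *; first by move: x0; rewrite thinmx0 eqxx.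
have {}ex : x = (L 0 0 * d`_0) *: row 0 R.
  rewrite [LHS]ex (mx11_scalar L) -mulmxA mul_scalar_mx mxE mulr1n -scalerA; congr (_ *: _).
  apply/rowP => j; rewrite !mxE (bigD1 0) //= mxE eqxx mulr1n big1 ?addr0 // => i i0.
  by rewrite mxE /= (_ : (0%N == i) = false) ?mulr0n ?mul0r //; apply: negbTE;
    rewrite eq_sym.
exists (row 0 R), (col 0 (invmx R)); split; last first.
  apply/matrixP => i j; rewrite !ord1.
  have := congr1 (fun M : 'M_m.+1 => M 0 0) (mulmxV uR); rewrite !mxE => <-.
  by apply: eq_bigr => k _; rewrite !mxE.
set c := L 0 0 * _ in ex; set y := row 0 R in ex *.
clearbody c y; have c0 : c != 0 by apply: contraNneq x0 => c0; rewrite ex c0 scale0r.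
have eT : x^T = c *: y^T by rewrite ex linearZ.
move: xB; rewrite eT ex -!scalemxAl -scalemxAr => /matrixP/(_ 0 0).
rewrite [LHS]mxE [X in c * X]mxE [RHS]mxE => /eqP;
  rewrite !mulf_eq0 (negPf c0) /= => /eqP e.
by rewrite [LHS]mx11_scalar e raddf0.
Qed.

(** Unimodularity gives [y0] with [(x, y0) = 1]. As [(y0, y0) = 2 c] is even, the integral vector
    [y0 - c x] is isotropic. *)
Lemma hyperbolic_pair m (B : 'M[int]_m) (x : 'rV[int]_m) (r : 'cV[int]_m) :
  B^T = B -> B \in unitmx -> even_mx B -> x *m B *m x^T = 0 -> x *m r = 1%:M ->
  exists y : 'rV[int]_m, x *m B *m y^T = 1%:M /\ y *m B *m y^T = 0.
Proof.
move=> Bs uB eB xx xr; pose y0 := (invmx B *m r)^T.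
have xy0 : x *m B *m y0^T = 1%:M by rewrite trmxK -mulmxA mulKVmx.
have y0x : y0 *m B *m x^T = 1%:M.
  by rewrite -(tr_form _ _ Bs) xy0 trmx1.
have [c ec] := eB y0.
have y0y0 : y0 *m B *m y0^T = (2 * c)%:M by rewrite [LHS]mx11_scalar ec.
have eT : (y0 - c *: x)^T = y0^T - c *: x^T by rewrite linearB linearZ.
exists (y0 - c *: x); rewrite eT; split.
  by rewrite mulmxBr -scalemxAr xx scaler0 subr0 xy0.
rewrite !mulmxBl !mulmxBr -!scalemxAl -!scalemxAr -?scalemxAl xx xy0 y0x y0y0
  !scaler0 subr0.
by rewrite !scalemx1 -!raddfB /= (_ : _ - _ = 0) ?raddf0 //; ring.
Qed.

(** The plane is unimodular, so [x], [y] complete to a basis, and subtracting [(W, y) x + (W, x) y]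
    from the other basis vectors [W] is an integral projection to the orthogonal complement. The
    Gram matrix becomes block diagonal with unit determinant. *)
Lemma hyperbolic_split m (B : 'M[int]_(2 + m)) (x y : 'rV[int]_(2 + m)) :
  B^T = B -> B \in unitmx -> x *m B *m x^T = 0 -> y *m B *m y^T = 0 ->
  x *m B *m y^T = 1%:M ->
  exists Z : 'M[int]_(m, 2 + m), [/\ x *m B *m Z^T = 0, y *m B *m Z^T = 0
    & Z *m B *m Z^T \in unitmx].
Proof.
move=> Bs uB xx yy xy.
have yx : y *m B *m x^T = 1%:M by rewrite -(tr_form _ _ Bs) xy trmx1.
pose A : 'M[int]_(1 + 1, 2 + m) := col_mx x y.
have AR : A *m (B *m (col_mx y x)^T) = 1%:M.
  by rewrite tr_col_mx mulmxA mul_col_mx mul_col_row xx yy xy yx -scalar_mx_block.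
have [S uS SA] := @unimodular_complete 2 m A _ AR.
pose W := dsubmx S.
pose Z := W - (W *m B *m y^T) *m x - (W *m B *m x^T) *m y.
have Zx : Z *m B *m x^T = 0.
  by rewrite /Z !mulmxBl -!mulmxA !(mulmxA _ B) xx yx !mulmx0 mulmx1 subr0 subrr.
have Zy : Z *m B *m y^T = 0.
  by rewrite /Z !mulmxBl -!mulmxA !(mulmxA _ B) xy yy !mulmx0 mulmx1 subr0 subrr.
have flip (u : 'rV[int]_(2 + m)) : Z *m B *m u^T = 0 -> u *m B *m Z^T = 0.
  by move=> e; rewrite -(tr_form _ _ Bs) e trmx0.
exists Z; split; try exact: flip.
pose T : 'M[int]_(2 + m) := block_mx 1%:M 0 (- row_mx (W *m B *m y^T) (W *m B *m x^T)
  : 'M_(m, 1 + 1)) 1%:M.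
have eTS : T *m S = col_mx A Z.
  rewrite -[S]vsubmxK SA /T mul_block_col !mul1mx mul0mx addr0; congr col_mx.
  have eRA : (row_mx (W *m B *m y^T) (W *m B *m x^T) : 'M_(m, 1 + 1)) *m A =
      W *m B *m y^T *m x + W *m B *m x^T *m y by exact: mul_row_col.
  by rewrite mulNmx [X in - X]eRA addrC opprD addrA.
have uTS : T *m S \in unitmx by rewrite unitmx_mul uS unitmxE det_lblock !det1 mulr1.
have : (T *m S) *m B *m (T *m S)^T \in unitmx by rewrite unitmx_mul unitmx_tr uTS
  andbT unitmx_mul uTS uB.
rewrite eTS tr_col_mx mul_col_mx mul_col_row.
have -> : A *m B *m Z^T = 0 by rewrite /A mul_col_mx mul_col_mx !flip // col_mx0.
by rewrite unitmxE det_lblock unitrM -!unitmxE => /andP[].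
Qed.

Definition signature_zero m (B : 'M[int]_m) : Prop :=
  exists (P : 'M[rat]_m) (d : 'rV[rat]_m), [/\ P \in unitmx,
    P *m map_mx intr B *m P^T = diag_mx d, forall i, d 0 i != 0
    & \sum_i Num.sg (d 0 i) = 0].

Lemma diag_sg_sum m (B : 'M[rat]_m) (P Q : 'M[rat]_m) (d e : 'rV[rat]_m) :
  P \in unitmx -> Q \in unitmx -> P *m B *m P^T = diag_mx d ->
  Q *m B *m Q^T = diag_mx e -> (forall i, d 0 i != 0) -> (forall i, e 0 i != 0) ->
  \sum_i Num.sg (d 0 i) = \sum_i Num.sg (e 0 i).
Proof.
move=> uP uQ HP HQ d0 e0; rewrite -!wsum_row_seq; apply: (wsum_cong sg_witt).
- by rewrite nonzeros_row_seq; apply/forallP.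
- by rewrite nonzeros_row_seq; apply/forallP.
exists m, (Q *m invmx P); rewrite !size_row_seq !diag_row_seq; split=> //.
  by rewrite unitmx_mul uQ unitmx_inv.
by rewrite trmx_mul -HP trmx_inv !mulmxA mulmxKV // mulmxK ?unitmx_tr.
Qed.

Lemma signature_zero_split m (B : 'M[int]_(2 + m)) (x y : 'rV[int]_(2 + m))
    (Z : 'M[int]_(m, 2 + m)) :
  B^T = B -> x *m B *m x^T = 0 -> y *m B *m y^T = 0 -> x *m B *m y^T = 1%:M ->
  x *m B *m Z^T = 0 -> y *m B *m Z^T = 0 -> Z *m B *m Z^T \in unitmx ->
  signature_zero B -> signature_zero (Z *m B *m Z^T).
Proof.
move=> Bs xx yy xy xZ yZ uB' [P [d [uP HP d0 sd]]].
have yx : y *m B *m x^T = 1%:M by rewrite -(tr_form _ _ Bs) xy trmx1.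
pose r k l (M : 'M[int]_(k, l)) : 'M[rat]_(k, l) := map_mx intr M.
have rM k l q (M : 'M[int]_(k, l)) (N : 'M_(l, q)) : r _ _ (M *m N) = r _ _ M *m r _ _ N.
  exact: map_mxM.
have rform k l (u : 'M[int]_(k, 2 + m)) (v : 'M[int]_(l, 2 + m)) :
    r _ _ u *m r _ _ B *m (r _ _ v)^T = r _ _ (u *m B *m v^T).
  by rewrite !rM /r map_trmx.
have [Q [e [uQ HQ e0]]] : exists (Q : 'M[rat]_m) (e : 'rV[rat]_m),
    [/\ Q \in unitmx, Q *m r _ _ (Z *m B *m Z^T) *m Q^T = diag_mx e & forall i, e 0 i != 0].
  apply: rat_diag; first by rewrite /r map_trmx sym_cong.
  by rewrite unitmxE /r det_map_mx rmorph_unit -?unitmxE.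
exists Q, e; split=> //.
(* In the plane, [x + y / 2] and [x - y / 2] are orthogonal of values 1 and -1, so the plane
   contributes nothing to the signature. *)
pose w s : 'rV[rat]_(2 + m) := r _ _ x + s *: r _ _ y.
have ww s t : w s *m r _ _ B *m (w t)^T = (s + t)%:M.
  have -> : (w t)^T = (r _ _ x)^T + t *: (r _ _ y)^T by rewrite linearD linearZ.
  rewrite !mulmxDl !mulmxDr -!scalemxAl -!scalemxAr !rform xx yy xy yx.
  rewrite /r !raddf0 !map_mx1 ?scaler0 add0r addr0 !scalemx1 -raddfD.
  by rewrite addrC.
have wZ s : w s *m r _ _ B *m (Q *m r _ _ Z)^T = 0.
  rewrite trmx_mul mulmxA !mulmxDl -!scalemxAl !rform xZ yZ.
  by rewrite /r !raddf0 mul0mx scaler0 addr0.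
have Zw s : Q *m r _ _ Z *m r _ _ B *m (w s)^T = 0.
  by rewrite -(tr_form _ _ (_ : (r _ _ B)^T = _)) ?wZ ?trmx0 // /r map_trmx Bs.
pose W : 'M[rat]_(1 + 1 + m, 2 + m) := col_mx (col_mx (w 2^-1) (w (- 2^-1))) (Q *m r _ _ Z).
pose f : 'rV[rat]_(1 + 1 + m) := row_mx (row_mx (const_mx 1) (const_mx (-1))) e.
have HW : W *m r _ _ B *m W^T = diag_mx f.
  rewrite /W /f !tr_col_mx mul_col_mx mul_col_row !diag_mx_row !diag_const_mx.
  rewrite (mul_col_mx (w _)) mul_col_row !mul_col_mx !ww !wZ col_mx0 !mul_mx_row !Zw
    row_mx0.
  congr block_mx; last first.
    by rewrite -HQ -rform trmx_mul !mulmxA.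
  by congr block_mx; rewrite ?subrr ?addNr ?raddf0 //; congr _%:M; field.
have f0 i : f 0 i != 0.
  rewrite /f; case: (split_ordP i) => j ->; rewrite ?row_mxEl ?row_mxEr //.
  by case: (split_ordP j) => l ->; rewrite ?row_mxEl ?row_mxEr mxE ?oppr_eq0 oner_eq0.
have uW : (W : 'M_(2 + m)) \in unitmx.
  have : \det (W *m r _ _ B *m W^T) != 0.
    by rewrite HW det_diag; apply/prodf_neq0.
  rewrite (det_mulmx ((W : 'M_(2 + m)) *m r _ _ B)) det_mulmx !mulf_eq0 !negb_or.
  by rewrite unitmxE unitfE => /andP[/andP[]].
have : \sum_(i < 1 + 1 + m) Num.sg (f 0 i) = 0.
  exact: etrans (esym (diag_sg_sum uP uW HP HW d0 f0)) sd.
rewrite big_split_ord /= big_split_ord /= !big_ord1 /f.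
rewrite !row_mxEl !row_mxEr !mxE sgrN sgr1 subrr add0r => {2}<-.
by apply: eq_bigr => i _; rewrite row_mxEr.
Qed.

(** The complement of a hyperbolic plane is again even, unimodular and of signature zero, so
    isotropic vectors remain available until the rank is exhausted. *)
Theorem hyperbolic_basis n m (B : 'M[int]_m) : m = n.*2 -> B^T = B ->
  B \in unitmx -> even_mx B -> signature_zero B ->
  exists E F : 'M[int]_(n, m), [/\ E *m B *m E^T = 0, F *m B *m F^T = 0
    & E *m B *m F^T = 1%:M].
Proof.
elim: n m B => [|n IH] m B em Bs uB eB sB.
  by exists 0, 0; split; rewrite ?mul0mx //; apply/matrixP => -[].
have {em} em : m = (2 + n.*2)%N by rewrite em doubleS.
move: B Bs uB eB sB; rewrite em => {m em} B Bs uB eB [P [d [uP HP d0 sd]]].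
have [z z0 zB] := unimodular_isotropic (isT : (0 < 2 + n.*2)%N) Bs uB uP HP d0 sd.
have [x [r [xx xr]]] := isotropic_primitive z0 zB.
have [y [xy yy]] := hyperbolic_pair Bs uB eB xx xr.
have [Z [xZ yZ uB']] := hyperbolic_split Bs uB xx yy xy.
have sB : signature_zero B by exists P, d.
have sB' := signature_zero_split Bs xx yy xy xZ yZ uB' sB.
have [E [F [EE FF EF]]] := IH _ _ erefl (sym_cong Z Bs) uB' (even_mx_cong Z eB) sB'.
exists (col_mx x (E *m Z) : 'M_(1 + n, _)), (col_mx y (F *m Z) : 'M_(1 + n, _)).
have flip (u : 'rV[int]_(2 + n.*2)) : u *m B *m Z^T = 0 -> Z *m B *m u^T = 0.
  by move=> e; rewrite -(tr_form _ _ Bs) e trmx0.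
have G (C D : 'M[int]_(n, n.*2)) (u v : 'rV[int]_(2 + n.*2)) :
    u *m B *m Z^T = 0 -> v *m B *m Z^T = 0 ->
    (col_mx u (C *m Z) : 'M_(1 + n, _)) *m B *m (col_mx v (D *m Z) : 'M_(1 + n, _))^T =
    block_mx (u *m B *m v^T) 0 0 (C *m (Z *m B *m Z^T) *m D^T).
  move=> uZ vZ; rewrite tr_col_mx mul_col_mx mul_col_row trmx_mul; congr block_mx.
  - by rewrite mulmxA uZ mul0mx.
  - by rewrite -!mulmxA (mulmxA Z) flip ?mulmx0.
  by rewrite !mulmxA.
split; rewrite G ?xx ?yy ?xy ?EE ?FF ?EF ?block_mx0 //.
by rewrite -scalar_mx_block.
Qed.

(** * Lattices in coordinates *)

Definition ratm m n (A : 'M[int]_(m, n)) : 'M[rat]_(m, n) := map_mx intr A.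

Lemma ratm_inj m n : injective (@ratm m n).
Proof.
move=> A B /matrixP e; apply/matrixP => i j; apply: (@intr_inj rat).
by have := e i j; rewrite !mxE.
Qed.

Lemma ratmM m n k (A : 'M_(m, n)) (B : 'M_(n, k)) : ratm (A *m B) = ratm A *m ratm B.
Proof. exact: map_mxM. Qed.

Lemma ratmB m n (A B : 'M_(m, n)) : ratm (A - B) = ratm A - ratm B.
Proof. exact: map_mxB. Qed.

Lemma ratmN m n (A : 'M_(m, n)) : ratm (- A) = - ratm A.
Proof. exact: map_mxN. Qed.

Lemma ratmT m n (A : 'M_(m, n)) : ratm A^T = (ratm A)^T.
Proof. by rewrite /ratm map_trmx. Qed.

Lemma ratm0 m n : ratm (0 : 'M_(m, n)) = 0.
Proof. exact: map_mx0. Qed.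

Lemma ratm1 n : ratm (1%:M : 'M_n) = 1%:M.
Proof. exact: map_mx1. Qed.

Lemma ratmZ m n a (A : 'M_(m, n)) : ratm (a *: A) = a%:~R *: ratm A.
Proof. exact: map_mxZ. Qed.

Lemma ratm_det n (A : 'M_n) : \det (ratm A) = (\det A)%:~R.
Proof. by rewrite det_map_mx. Qed.

Lemma ratm_unit n (A : 'M_n) : A \in unitmx -> ratm A \in unitmx.
Proof. by rewrite unitmxE => uA; rewrite unitmxE ratm_det rmorph_unit. Qed.

Lemma ratm_intP m n (A : 'M[rat]_(m, n)) :
  (exists B, A = ratm B) <-> (forall i j, A i j \is a Num.int).
Proof.
split=> [[B ->] i j|Ai]; first by rewrite mxE intr_int.
exists (\matrix_(i, j) Num.floor (A i j)).
by apply/matrixP => i j; rewrite !mxE floorK.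
Qed.

Lemma clear_denoms m (u : 'rV[rat]_m) :
  exists2 N : int, N != 0 & exists c, ratm c = N%:~R *: u.
Proof.
exists (\prod_j denq (u 0 j)); first by apply/prodf_neq0 => j _; rewrite denq_eq0.
exists (\row_j (numq (u 0 j) * \prod_(i | i != j) denq (u 0 i))).
apply/rowP => j; rewrite !mxE [in RHS](bigD1 j) //= !intrM.
by rewrite numqE; ring.
Qed.

(** Coordinates on the rational span: integral rows give the lattice, and rows whose product with
    the Gram matrix is integral give the dual. *)
Definition lcomb (V : vectType rat) m (b : m.-tuple V) (u : 'rV[rat]_m) : V :=
  \sum_i u 0 i *: tnth b i.

Lemma lcomb_is_linear (V : vectType rat) m (b : m.-tuple V) : linear (lcomb b).
Proof.
move=> a u v; rewrite /lcomb scaler_sumr -big_split; apply: eq_bigr => i _.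
by rewrite !mxE scalerDl scalerA.
Qed.

HB.instance Definition _ (V : vectType rat) m (b : m.-tuple V) :=
  GRing.isLinear.Build rat 'rV[rat]_m V _ (lcomb b) (lcomb_is_linear b).

Section Lcomb.
Variables (V : vectType rat) (m : nat) (b : m.-tuple V).

Lemma lcomb_coord u i : free b -> coord b i (lcomb b u) = u 0 i.
Proof.
move=> fb; rewrite /lcomb; under eq_bigr do rewrite (tnth_nth 0).
exact: coord_sum_free.
Qed.

Lemma lcomb_inj : free b -> injective (lcomb b).
Proof.
by move=> fb u v e; apply/rowP => i; rewrite -!(lcomb_coord _ _ fb) e.
Qed.

Lemma free_lcomb : injective (lcomb b) -> free b.
Proof.
move=> ib; apply/freeP => k e i.
have : \row_i k i = 0.
  apply: ib; rewrite raddf0 -e /lcomb; apply: eq_bigr => j _.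
  by rewrite mxE (tnth_nth 0).
by move=> /rowP/(_ i); rewrite !mxE.
Qed.

Lemma lcomb_delta i : lcomb b (delta_mx 0 i) = tnth b i.
Proof.
rewrite /lcomb (bigD1 i) //= mxE !eqxx scale1r big1 ?addr0 // => j ji.
by rewrite mxE (negPf ji) andbF scale0r.
Qed.

(** Isomorphisms have to be linear on the whole ambient space, which may exceed the span of [b]; the
    functionals [coord b] supply such an extension. *)
Lemma basis_linear (W : vectType rat) (b' : m.-tuple W) : free b ->
  exists f : {linear V -> W}, forall u, f (lcomb b u) = lcomb b' u.
Proof.
move=> fb; pose f x := lcomb b' (\row_i coord b i x).
have fl : linear f.
  move=> a x y; rewrite /f -linearP; congr lcomb; apply/rowP => i.
  by rewrite !mxE linearP.
pose F : {linear V -> W} := HB.pack f (GRing.isLinear.Build rat V W _ f fl).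
exists F => u; rewrite /F /= /f; congr lcomb; apply/rowP => i.
by rewrite mxE lcomb_coord.
Qed.
End Lcomb.

Section Form.
Variable X : qlattice.
Implicit Types x y z : qspace X.

Lemma qformDr x y z : qform x (y + z) = qform x y + qform x z.
Proof. by have := @qform_lin X x 1 y z; rewrite scale1r mul1r. Qed.

Lemma qformDl x y z : qform (x + y) z = qform x z + qform y z.
Proof. by rewrite !(@qform_sym X _ z) qformDr. Qed.

Lemma qform0r x : qform x 0 = 0.
Proof. by rewrite qform_sym qform0l. Qed.

Lemma qformMzl k x y : qform (x *~ k) y = k%:~R * qform x y.
Proof. by rewrite -scaler_int qformZl. Qed.

Lemma qform_suml (I : finType) (F : I -> qspace X) y :
  qform (\sum_i F i) y = \sum_i qform (F i) y.
Proof.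
apply: (big_ind2 (fun a c => qform a y = c)) => // [|x1 x2 y1 y2 <- <-].
  exact: qform0l.
exact: qformDl.
Qed.

Lemma qform_lcomb m k (b : m.-tuple (qspace X)) (c : k.-tuple (qspace X)) u v :
  qform (lcomb b u) (lcomb c v) =
  (u *m (\matrix_(i, j) qform (tnth b i) (tnth c j)) *m v^T) 0 0.
Proof.
rewrite qform_suml -mulmxA mxE; apply: eq_bigr => i _; rewrite qformZl; congr (_ * _).
rewrite qform_sym qform_suml mxE; apply: eq_bigr => j _.
by rewrite qformZl qform_sym !mxE mulrC.
Qed.

Lemma qform_gram m (b : m.-tuple (qspace X)) u v :
  qform (lcomb b u) (lcomb b v) = (u *m gram b *m v^T) 0 0.
Proof. exact: qform_lcomb. Qed.

Lemma gram_sym m (b : m.-tuple (qspace X)) : (gram b)^T = gram b.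
Proof. by apply/matrixP => i j; rewrite !mxE qform_sym. Qed.

Definition in_span (v : qspace X) : Prop := exists2 k : int, k != 0 & v *~ k \in X.

Lemma in_span_mem v : v \in X -> in_span v.
Proof. by exists 1. Qed.

Lemma dual_predP v : v \in dual_pred X <->
  in_span v /\ forall x, x \in X -> qform v x \is a Num.int.
Proof. by split=> [/asboolP|H]; last exact/asboolP. Qed.

Section Basis.
Variables (m : nat) (b : m.-tuple (qspace X)).
Hypothesis bX : Zbasis b.

Lemma Zbasis_mem x : x \in X <-> exists c, x = lcomb b (ratm c).
Proof.
case: bX => _ ->; split=> [[c ->]|[c ->]].
  exists (\row_i c i); apply: eq_bigr => i _.
  by rewrite !mxE scaler_int.
by exists (fun i => c 0 i); apply: eq_bigr => i _; rewrite mxE scaler_int.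
Qed.

Lemma Zbasis_inj : injective (lcomb b).
Proof. by case: bX => /lcomb_inj. Qed.

Lemma Zbasis_memE u : lcomb b u \in X <-> exists c, u = ratm c.
Proof.
split=> [/Zbasis_mem[c /Zbasis_inj ->]|[c ->]]; first by exists c.
by apply/Zbasis_mem; exists c.
Qed.

Lemma Zbasis_span v : in_span v <-> exists u, v = lcomb b u.
Proof.
split=> [[k k0 /Zbasis_mem[c e]]|[u ->]].
  exists (k%:~R^-1 *: ratm c); rewrite linearZ /= -e -scaler_int scalerA mulVf ?scale1r //.
  by rewrite intr_eq0.
have [N N0 [c ec]] := clear_denoms u; exists N => //.
by apply/Zbasis_mem; exists c; rewrite ec linearZ /= scaler_int.
Qed.

Lemma Zbasis_dual u :
  lcomb b u \in dual_pred X <-> exists c, u *m gram b = ratm c.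
Proof.
rewrite dual_predP; split=> [[_ H]|[c ec]].
  apply/ratm_intP => i j; rewrite ord1.
  have /H : tnth b j \in X.
    by apply/Zbasis_mem; exists (delta_mx 0 j); rewrite /ratm map_delta_mx lcomb_delta.
  rewrite -lcomb_delta qform_gram trmx_delta -colE.
  by rewrite mxE.
split; first by apply/Zbasis_span; exists u.
move=> x /Zbasis_mem[d ->]; rewrite qform_gram ec -ratmT -ratmM.
by rewrite mxE intr_int.
Qed.

End Basis.
End Form.

Lemma gram_int (X : qlattice) m (b : m.-tuple (qspace X)) :
  Zbasis b -> even_integral X ->
  exists G : 'M[int]_m, [/\ gram b = ratm G, G^T = G & even_mx G].
Proof.
move=> bX [Xi Xe].
have bi i : tnth b i \in X.
  by apply/(Zbasis_mem bX); exists (delta_mx 0 i); rewrite /ratm map_delta_mx lcomb_delta.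
have [G eG] : exists G, gram b = ratm G.
  by apply/ratm_intP => i j; rewrite mxE Xi.
exists G; split=> //; first by apply: ratm_inj; rewrite ratmT -eG gram_sym.
move=> v; have vX : lcomb b (ratm v) \in X by apply/(Zbasis_mem bX); exists v.
have [k ek] := Xe _ vX; exists k; apply: (@intr_inj rat).
by rewrite intrM -ek qform_gram eG -ratmT -!ratmM [RHS]mxE.
Qed.

Lemma even_integral_gram (X : qlattice) m (b : m.-tuple (qspace X)) (G : 'M[int]_m) :
  Zbasis b -> gram b = ratm G -> even_mx G -> even_integral X.
Proof.
move=> bX eG ev;
  split=> [x y /(Zbasis_mem bX)[c ->] /(Zbasis_mem bX)[d ->]|x /(Zbasis_mem bX)[c ->]].
  by rewrite qform_gram eG -ratmT -!ratmM mxE intr_int.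
have [k ek] := ev c; exists k.
by rewrite qform_gram eG -ratmT -!ratmM mxE ek intrM.
Qed.

Lemma gram_unit (X : qlattice) m (b : m.-tuple (qspace X)) :
  Zbasis b -> Defs.nondegenerate X <-> gram b \in unitmx.
Proof.
move=> bX; split=> [nd|ug].
  rewrite -row_free_unit -kermx_eq0; apply/eqP/row_matrixP => i.
  rewrite row0; set u := row i _.
  have uG : u *m gram b = 0.
    by apply/sub_kermxP; exact: row_sub.
  have [N N0 [c ec]] := clear_denoms u.
  have : lcomb b (ratm c) = 0.
    apply: nd; first by apply/(Zbasis_mem bX); exists c.
    move=> y /(Zbasis_mem bX)[d ->]; rewrite qform_gram ec -scalemxAl uG.
    by rewrite scaler0 mul0mx mxE.
  rewrite -(raddf0 (lcomb b)) => /(Zbasis_inj bX) => c0.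
  by apply/eqP; move: ec; rewrite c0 => /esym/eqP; rewrite scaler_eq0 intr_eq0 (negPf N0).
move=> x /(Zbasis_mem bX)[c ->] H; rewrite (_ : ratm c = 0) ?raddf0 //.
rewrite -[LHS](mulmxK ug); have -> : ratm c *m gram b = 0; last by rewrite mul0mx.
apply/rowP => j;
  have jX : lcomb b (ratm (delta_mx 0 j)) \in X by apply/(Zbasis_mem bX);
    exists (delta_mx 0 j).
have := H _ jX; rewrite qform_gram /ratm map_delta_mx trmx_delta -colE.
by rewrite mxE => ->; rewrite mxE.
Qed.

(** The base changes in both directions are integral and mutually inverse, so ranks agree and the
    determinant changes by the square of 1 or -1. Hence [disc] does not depend on the basis. *)
Lemma Zbasis_change (X : qlattice) m k (b : m.-tuple (qspace X)) (c : k.-tuple (qspace X)) :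
  Zbasis b -> Zbasis c -> m = k /\ \det (gram b) = \det (gram c).
Proof.
have coords m' k' (b' : m'.-tuple (qspace X)) (c' : k'.-tuple (qspace X)) :
    Zbasis b' -> Zbasis c' -> exists A : 'M[int]_(k', m'),
      forall u, lcomb c' u = lcomb b' (u *m ratm A).
  move=> bX cX.
  have /choice[a ea] : forall i : 'I_k', exists a : 'rV[int]_m', tnth c' i = lcomb b'
    (ratm a).
    move=> i; apply/(Zbasis_mem bX)/(Zbasis_mem cX).
    by exists (delta_mx 0 i); rewrite /ratm map_delta_mx lcomb_delta.
  exists (\matrix_i a i) => u; rewrite mulmx_sum_row linear_sum; apply: eq_bigr => i _.
  rewrite linearZ /= ea; congr (_ *: lcomb _ _); apply/rowP => j.
  by rewrite !mxE.
move=> bX cX; have [A eA] := coords _ _ _ _ bX cX; have [B eB] := coords _ _ _ _ cX bX.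
have AB : A *m B = 1%:M.
  apply: ratm_inj; apply/row_matrixP => i; rewrite ratm1 rowE [RHS]rowE mulmx1.
  by rewrite ratmM mulmxA; apply: (Zbasis_inj cX); rewrite -eB -eA.
have BA : B *m A = 1%:M.
  apply: ratm_inj; apply/row_matrixP => i; rewrite ratm1 rowE [RHS]rowE mulmx1.
  by rewrite ratmM mulmxA; apply: (Zbasis_inj bX); rewrite -eA -eB.
have mk : m = k.
  have rA : (\rank (ratm A) = k)%N.
    apply/eqP; apply/row_freeP; exists (ratm B); by rewrite -ratmM AB ratm1.
  have rB : (\rank (ratm B) = m)%N.
    apply/eqP; apply/row_freeP; exists (ratm A); by rewrite -ratmM BA ratm1.
  have := rank_leq_col (ratm A); have := rank_leq_col (ratm B).
  by rewrite rA rB => le1 le2; apply/eqP; rewrite eqn_leq le1.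
split=> //; subst k.
have gc : gram c = ratm A *m gram b *m (ratm A)^T.
  apply/matrixP => i j.
  have -> : gram c i j = qform (lcomb c (delta_mx 0 i)) (lcomb c (delta_mx 0 j)).
    by rewrite mxE !lcomb_delta.
  rewrite !eA qform_gram trmx_mul trmx_delta !mulmxA -colE -!mulmxA -rowE.
  by rewrite !mxE.
have dA : \det A ^+ 2 = 1.
  have : \det A \is a GRing.unit.
    by apply/unitrP; exists (\det B); rewrite -!det_mulmx AB BA !det1.
  by case/orP => /eqP ->.
rewrite gc !det_mulmx det_tr ratm_det mulrAC -expr2 -rmorphXn /= dA.
by rewrite mul1r.
Qed.

Section Iso.
Variables (X X' : qlattice) (f : {linear qspace X -> qspace X'}).

Lemma lcomb_map m (b : m.-tuple (qspace X)) u :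
  f (lcomb b u) = lcomb (map_tuple f b) u.
Proof.
rewrite linear_sum; apply: eq_bigr => i _.
by rewrite linearZ tnth_map.
Qed.

Lemma lattice_iso_basis m (b : m.-tuple (qspace X)) : Zbasis b -> lattice_iso f ->
  Zbasis (map_tuple f b) /\ gram (map_tuple f b) = gram b.
Proof.
move=> bX [[f_inj f_im] f_form].
have bi i : tnth b i \in X.
  by apply/(Zbasis_mem bX); exists (delta_mx 0 i); rewrite /ratm map_delta_mx lcomb_delta.
split; last by apply/matrixP => i j; rewrite !mxE !tnth_map f_form.
split.
  apply: free_lcomb => u v; rewrite -!lcomb_map => e; apply/eqP; rewrite -subr_eq0.
  have [N N0 [c ec]] := clear_denoms (u - v).
  suff c0 : c = 0.
    by move: ec; rewrite c0 ratm0 => /esym/eqP; rewrite scaler_eq0 intr_eq0 (negPf N0).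
  apply: ratm_inj; rewrite ratm0; apply: (Zbasis_inj bX); rewrite raddf0.
  apply: f_inj; rewrite ?rpred0 //; first by apply/(Zbasis_mem bX); exists c.
  by rewrite ec !linearZ /= (raddfB (lcomb b)) (raddfB f) /= e subrr scaler0 raddf0.
move=> y; rewrite f_im; split=> [[x xX ->]|[c ->]].
  have [_ /(_ x)[/(_ xX)[c ->] _]] := bX; exists c.
  rewrite raddf_sum; apply: eq_bigr => i _.
  by rewrite raddfMz tnth_map.
exists (\sum_i tnth b i *~ c i); first by have [_ ->] := bX; exists c.
by rewrite raddf_sum; apply: eq_bigr => i _; rewrite raddfMz tnth_map.
Qed.

End Iso.

Lemma basis_lattice_iso (X X' : qlattice) m (b : m.-tuple (qspace X))
    (b' : m.-tuple (qspace X')) (f : {linear qspace X -> qspace X'}) :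
  Zbasis b -> Zbasis b' -> gram b = gram b' ->
  (forall u, f (lcomb b u) = lcomb b' u) -> lattice_iso f.
Proof.
move=> bX bX' eg fb; split; last first.
  move=> x y /(Zbasis_mem bX)[c ->] /(Zbasis_mem bX)[d ->].
  by rewrite !fb !qform_gram eg.
split=> [x y /(Zbasis_mem bX)[c ->] /(Zbasis_mem bX)[d ->]|y].
  by rewrite !fb => /(Zbasis_inj bX') ->.
rewrite (Zbasis_mem bX'); split=> [[c ->]|[x /(Zbasis_mem bX)[c ->] ->]].
  by exists (lcomb b (ratm c)); rewrite ?fb //; apply/(Zbasis_mem bX); exists c.
by exists c; rewrite fb.
Qed.

(** The ambient maps need not be invertible, so the two cancellations are claimed on the rational
    spans only, where dual lattices live. *)
Lemma lattice_iso_inv (X X' : qlattice) m (f : {linear qspace X -> qspace X'}) :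
  even_lattice m X -> lattice_iso f ->
  exists g : {linear qspace X' -> qspace X}, lattice_iso g /\
    (forall x, in_span x -> g (f x) = x) /\ (forall y, in_span y -> f (g y) = y).
Proof.
move=> [[b bX] _ _] fi; have [bX' eg] := lattice_iso_basis bX fi.
have [g gE] := basis_linear b (proj1 bX').
exists g; split; first exact: basis_lattice_iso bX' bX eg gE.
split=> [x /(Zbasis_span bX)[u ->]|y /(Zbasis_span bX')[u ->]].
  by rewrite lcomb_map gE.
by rewrite gE lcomb_map.
Qed.

(** * Discriminant groups and triples *)

Definition dclass (X : qlattice) (a : dual X) : discr X :=
  \pi_(Quotient.quot (dual_lat X))%qT a.

Lemma dclass_eq (X : qlattice) (a b : dual X) :
  dclass a = dclass b <-> dual_val a - dual_val b \in X.
Proof.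
have -> : (dual_val a - dual_val b \in X) = (a - b \in dual_lat X) by [].
by rewrite Quotient.idealrBE; split=> /eqP.
Qed.

Lemma dclassB (X : qlattice) (a b : dual X) : dclass (a - b) = dclass a - dclass b.
Proof. exact: raddfB. Qed.

Lemma dclass_repr (X : qlattice) (x : discr X) : dclass (repr x) = x.
Proof. exact: reprK. Qed.

(** Another representative differs from [a] by some [d] in [X], and its norm by [2 (a, d) + (d, d)],
    which is even. *)
Lemma discr_formE (X : qlattice) (a : dual X) : even_integral X ->
  discr_form (dclass a) =
  \pi_(Quotient.quot evenZ)%qT (qform (dual_val a) (dual_val a)).
Proof.
move=> [_ Xe]; apply/eqP; rewrite -Quotient.idealrBE unfold_in.
set r := repr _; have : dclass r = dclass a by rewrite dclass_repr.
pose d := dual_val r - dual_val a.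
move=> /dclass_eq; rewrite -/d => dX.
have er : dual_val r = dual_val a + d by rewrite /d addrC subrK.
have /dual_predP[_ /(_ _ dX) ai] := dual_valP a.
have [k ek] := Xe _ dX.
clearbody d; rewrite er qformDl !qformDr ek [qform d _]qform_sym.
rewrite (_ : (_ - _) / 2 = qform (dual_val a) d + k%:~R); last by field.
by rewrite rpredD // intr_int.
Qed.

Lemma dclass_form_eq (X Y : qlattice) (a : dual X) (b : dual Y) :
  even_integral X -> even_integral Y ->
  discr_form (dclass a) = discr_form (dclass b) <->
  (qform (dual_val a) (dual_val a) - qform (dual_val b) (dual_val b)) / 2
     \is a Num.int.
Proof.
move=> Xe Ye; rewrite !discr_formE //.
have -> : ((qform (dual_val a) (dual_val a) - qform (dual_val b) (dual_val b)) / 2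
   \is a Num.int) = (qform (dual_val a) (dual_val a) - qform (dual_val b) (dual_val
     b) \in evenZ).
  by [].
by rewrite Quotient.idealrBE; split=> /eqP.
Qed.

Section DiscrMap.
Variables (X X' : qlattice) (f : {linear qspace X -> qspace X'}).
Hypothesis fi : lattice_iso f.

Lemma discr_mapE (a : dual X) : discr_map fi (dclass a) = dclass (dual_map fi a).
Proof.
apply/dclass_eq; rewrite /= -raddfB; case: fi => -[_ f_im] _; apply/f_im.
by eexists; last by []; apply/dclass_eq; exact: dclass_repr.
Qed.

Lemma dual_map_val (a : dual X) : dual_val (dual_map fi a) = f (dual_val a).
Proof. by []. Qed.

End DiscrMap.

Lemma dual_val_span (X : qlattice) (a : dual X) : in_span (dual_val a).
Proof. by have /dual_predP[] := dual_valP a. Qed.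

Lemma discr_map_cancel (X X' : qlattice) (f : {linear qspace X -> qspace X'})
    (g : {linear qspace X' -> qspace X}) (fi : lattice_iso f) (gi : lattice_iso g) :
  (forall x, in_span x -> g (f x) = x) -> forall a, discr_map gi (discr_map fi a) = a.
Proof.
move=> gf a; rewrite -(dclass_repr a) !discr_mapE; apply/dclass_eq.
by rewrite !dual_map_val gf ?subrr ?rpred0 //; exact: dual_val_span.
Qed.

Section ProperEquiv.
Variable n : nat.

Lemma proper_equiv_refl (t : triple n) : proper_equiv t t.
Proof.
have idi (X : qlattice) : lattice_iso (idfun : {linear qspace X -> qspace X}).
  split=> //; split=> // y; split=> [yX|[x xX ->]] //; by exists y.
exists idfun, idfun, (idi _), (idi _) => a.
have idm (X : qlattice) (c : discr X) : discr_map (idi X) c = c.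
  by rewrite -(dclass_repr c) discr_mapE; apply/dclass_eq; rewrite subrr rpred0.
by rewrite !idm.
Qed.

Lemma proper_equiv_sym (t t' : triple n) : proper_equiv t t' -> proper_equiv t' t.
Proof.
move=> [f [g [fi [gi H]]]].
have [f' [fi' [ff' f'f]]] := lattice_iso_inv (tX_even t) fi.
have [g' [gi' [gg' g'g]]] := lattice_iso_inv (tY_even t) gi.
exists f', g', fi', gi' => a.
have ea : a = discr_map gi (discr_map gi' a) by rewrite discr_map_cancel.
by rewrite [in RHS]ea H discr_map_cancel.
Qed.

Lemma lattice_iso_comp (X Y Z : qlattice) (f : {linear qspace X -> qspace Y})
    (g : {linear qspace Y -> qspace Z}) :
  lattice_iso f -> lattice_iso g -> lattice_iso (g \o f : {linear _ -> _}).
Proof.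
move=> [[fj fm] ff] [[gj gm] gf].
have fX x : x \in X -> f x \in Y by move=> xX; apply/fm; exists x.
split; last by move=> x y xX yX /=; rewrite gf ?ff ?fX.
split=> [x y xX yX /= /gj e|z]; first by apply: fj; rewrite // e ?fX.
rewrite gm; split=> [[y /fm[x xX ->] ->]|[x xX ->]]; first by exists x.
by exists (f x) => //; exact: fX.
Qed.

Lemma proper_equiv_trans (t t' t'' : triple n) :
  proper_equiv t t' -> proper_equiv t' t'' -> proper_equiv t t''.
Proof.
move=> [f [g [fi [gi H]]]] [f' [g' [fi' [gi' H']]]].
exists (f' \o f), (g' \o g), (lattice_iso_comp fi fi'), (lattice_iso_comp gi gi') => a.
have comp X Y Z (h : {linear qspace X -> qspace Y}) (k : {linear qspace Y -> qspace Z})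
    (hi : lattice_iso h) (ki : lattice_iso k) c :
    discr_map (lattice_iso_comp hi ki) c = discr_map ki (discr_map hi c).
  rewrite -(dclass_repr c) !discr_mapE; apply/dclass_eq.
  by rewrite !dual_map_val subrr rpred0.
by rewrite !comp H' H.
Qed.

Lemma proper_equiv_sigma (t t' : triple n) :
  proper_equiv t t' -> proper_equiv (sigma t) (sigma t').
Proof.
move=> [f [g [fi [gi H]]]]; exists g, f, gi, fi => a.
rewrite -[a in LHS](disc_invK (tphi t)) -H.
exact: disc_funK.
Qed.

Lemma has_disc_iso (X X' : qlattice) (f : {linear qspace X -> qspace X'}) d :
  lattice_iso f -> has_disc X d -> has_disc X' d.
Proof.
move=> fi [m [b [bX ->]]]; have [bX' eg] := lattice_iso_basis bX fi.
by exists m, (map_tuple f b); rewrite eg.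
Qed.

Lemma eq_disc (X X' : qlattice) : (forall d, has_disc X d <-> has_disc X' d) ->
  disc X = disc X'.
Proof.
move=> H; rewrite /disc; congr xget; apply/seteqP.
by split=> d /H.
Qed.

Lemma even_integral_iso (X X' : qlattice) (f : {linear qspace X -> qspace X'}) (r : rat) :
  lattice_iso f -> even_integral (scale r X) -> even_integral (scale r X').
Proof.
move=> [[_ fm] ff] [Xi Xe]; split=> [x y /fm[x' xX ->] /fm[y' yX ->]|x /fm[x' xX ->]].
  by rewrite /= /scale_form ff //; exact: Xi.
by have [k ek] := Xe _ xX; exists k; rewrite /= /scale_form ff.
Qed.

Lemma proper_equiv_disc (t t' : triple n) : proper_equiv t t' ->
  disc (tX t) = disc (tX t') /\ disc (tY t) = disc (tY t').
Proof.
move=> H; have [f' [g' [fi' [gi' _]]]] := proper_equiv_sym H.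
case: H => f [g [fi [gi _]]].
split; apply: eq_disc => d; split.
- exact: has_disc_iso fi.
- exact: has_disc_iso fi'.
- exact: has_disc_iso gi.
exact: has_disc_iso gi'.
Qed.

Lemma proper_equiv_primitive (t t' : triple n) : proper_equiv t t' ->
  triple_primitive t <-> triple_primitive t'.
Proof.
have imp (u u' : triple n) : proper_equiv u u' -> triple_primitive u -> triple_primitive u'.
  move=> H; have [f' [g' [fi' [gi' _]]]] := proper_equiv_sym H.
  case: H => f [g [fi [gi _]]] [pX pY].
  split=> m m0; split.
  - by move=> e; apply/(pX m m0); apply: even_integral_iso fi' e.
  - by move=> e; apply: even_integral_iso fi _; apply/(pX m m0).
  - by move=> e; apply/(pY m m0); apply: even_integral_iso gi' e.
  by move=> e; apply: even_integral_iso gi _; apply/(pY m m0).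
by move=> H; split; apply: imp => //; exact: proper_equiv_sym.
Qed.

End ProperEquiv.

(** * Orthogonal complements in U^n *)

Section Complement.
Variables (n : nat) (Ga Ga' : 'M[int]_(n + n)).
Hypothesis GaK : Ga *m Ga' = 1%:M.

(** Jacobi's identity for complementary minors: with its first block column replaced by that of the
    identity, [Ga'] is multiplied by [Ga] to a block triangular matrix. *)
Lemma det_complement : \det (drsubmx Ga') * \det Ga = \det (ulsubmx Ga).
Proof.
pose N := block_mx 1%:M (ursubmx Ga') 0 (drsubmx Ga').
have : Ga *m N = block_mx (ulsubmx Ga) 0 (dlsubmx Ga) 1%:M.
  have := GaK; rewrite -[in X in X = _](submxK Ga) -[in X in X = _](submxK Ga').
  rewrite mulmx_block (scalar_mx_block n n) => /eq_block_mx[_ e1 _ e2].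
  rewrite -[in LHS](submxK Ga) /N mulmx_block.
  by rewrite e1 e2 !mulmx1 !mulmx0 !addr0.
move=> /(congr1 determinant); rewrite det_mulmx /N det_ublock det_lblock !det1.
by rewrite mul1r mulr1 mulrC.
Qed.
End Complement.

Lemma int_mod_eq0 (m : nat) (z : int) : (1 < m)%N -> (z%:~R == 0 :> 'Z_m) = (m %| z)%Z.
Proof.
move=> m1; have nz (k : nat) : (k%:R == 0 :> 'Z_m) = (m %| k)%N.
  by rewrite -val_eqE /= val_Zp_nat.
case: z => k; first exact: nz.
by rewrite NegzE intrN oppr_eq0 dvdzE abszN nz.
Qed.

(* The blocks of an even unimodular matrix [[G,H],[H^T,D]] and of its inverse
   [[A,B],[B^T,E]] satisfy E = E D E - B^T G B, and modulo m | G the block B^T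
   is invertible while B^T G = - E H^T. *)
Lemma scaled_complement n (m : nat) (G H D A B E : 'M[int]_n) (G' : 'M[int]_n) :
  (1 < m)%N -> E^T = E -> even_mx D ->
  G *m A + H *m B^T = 1%:M -> G *m B + H *m E = 0 -> B^T *m H + E *m D = 1%:M ->
  G = m%:Z *: G' -> even_mx G' ->
  exists E' : 'M[int]_n, E = m%:Z *: E' /\ even_mx E'.
Proof.
move=> m1 Es evD e1 e2 e3 eG evG'.
pose r (M : 'M[int]_n) : 'M['Z_m]_n := map_mx intr M.
have rM (M N : 'M_n) : r (M *m N) = r M *m r N by exact: map_mxM.
have m0 : m%:~R = 0 :> 'Z_m by apply/eqP; rewrite int_mod_eq0 ?dvdzz.
have rG : r G = 0.
  by apply/matrixP => i j; rewrite eG !mxE intrM m0 mul0r.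
have HB : r H *m r B^T = 1%:M.
  by rewrite -rM -[_ *m _](addKr (G *m A)) e1 /r raddfD raddfN /= -/(r _) rM rG
    mul0mx oppr0 add0r map_mx1.
have rE : r E = 0.
  have HE : r H *m r E = 0.
    by rewrite -rM -[_ *m _](addKr (G *m B)) e2 addr0 /r raddfN /= -/(r _) rM rG
      mul0mx oppr0.
  by rewrite -[LHS]mul1mx -(mulmx1C HB) -mulmxA HE mulmx0.
have /choice[E1 HE1] : forall ij : 'I_n * 'I_n, exists k, E ij.1 ij.2 = m%:Z * k.
  move=> [i j] /=; have /matrixP/(_ i j) := rE; rewrite !mxE => /eqP.
  by rewrite int_mod_eq0 // => /dvdzP[k ->]; exists k; rewrite mulrC.
pose E' := \matrix_(i, j) E1 (i, j).
have eE : E = m%:Z *: E' by apply/matrixP => i j; rewrite !mxE -(HE1 (i, j)).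
have m0' : m%:Z != 0 by case: m m1 {r rM m0 rG HB rE E1 HE1 E' eE eG}.
exists E'; split=> // v.
have E's : E'^T = E'.
  apply/matrixP => i j; apply: (mulfI m0'); have /matrixP/(_ i j) := Es.
  by rewrite eE !mxE.
have eE2 : E = E *m D *m E - B^T *m G *m B.
  have : B^T *m (G *m B + H *m E) = 0 by rewrite e2 mulmx0.
  rewrite mulmxDr mulmxA mulmxA -[B^T *m H](addrK (E *m D)) e3 mulmxBl mul1mx.
  by rewrite addrA => /eqP; rewrite subr_eq0 => /eqP <-;
    rewrite [X in _ = X - _]addrC addrK.
(* Division of [eE2] by [m] writes [E'] in terms of transforms of the even matrices [D] and [G']. *)
have eE3 : E' = m%:Z *: (E' *m D *m E') - B^T *m G' *m B.
  apply/matrixP => i j; apply: (mulfI m0').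
  have -> : m%:Z * E' i j = E i j by rewrite eE !mxE.
  rewrite {1}eE2 {1 2}eE eG -!scalemxAl -!scalemxAr -!scalemxAl.
  by rewrite !mxE; ring.
have [c ec] := evD (v *m E'); have [d ed] := evG' (v *m B^T).
exists (m%:Z * c - d).
have -> : v *m E' *m v^T = m%:Z *: (v *m E' *m D *m (v *m E')^T) -
    v *m B^T *m G' *m (v *m B^T)^T.
  rewrite {1}eE3 mulmxBr mulmxBl -scalemxAr -scalemxAl !trmx_mul trmxK E's.
  by rewrite !mulmxA.
by rewrite mxE [X in X + _]mxE ec [X in _ + X]mxE ed; ring.
Qed.

(* Coordinates on U^n (x) Q: first those of the e_i, then those of the f_i. *)
Definition hv n (u : 'rV[rat]_(n + n)) : 'M[rat]_(n, 2) :=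
  \matrix_(i, j) (if j == 0 then u 0 (lshift n i) else u 0 (rshift n i)).

Lemma hv_is_linear n : linear (@hv n).
Proof. by move=> a u v; apply/matrixP => i j; rewrite !mxE; case: ifP. Qed.

HB.instance Definition _ n :=
  GRing.isLinear.Build rat 'rV[rat]_(n + n) 'M[rat]_(n, 2) _ (@hv n) (@hv_is_linear n).

Definition hc n (x : 'M[rat]_(n, 2)) : 'rV[rat]_(n + n) :=
  row_mx (col 0 x)^T (col 1 x)^T.

Lemma hcK n : cancel (@hc n) (@hv n).
Proof.
move=> x; apply/matrixP => i j; rewrite mxE /hc; case: eqP => [->|j0].
  by rewrite row_mxEl !mxE.
rewrite row_mxEr !mxE; congr (x _ _); apply: val_inj.
by case: j j0 => -[|[|//]] //= ? H; case: H; apply: val_inj.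
Qed.

Lemma hvK n : cancel (@hv n) (@hc n).
Proof.
move=> u; apply/rowP => i; rewrite /hc; case: (split_ordP i) => j ->.
  by rewrite row_mxEl !mxE eqxx.
by rewrite row_mxEr !mxE.
Qed.

Lemma hv_inj n : injective (@hv n).
Proof. exact: can_inj (@hvK n). Qed.

Definition hypJ (R : nzRingType) n : 'M[R]_(n + n) := block_mx 0 1%:M 1%:M 0.

Lemma hypJ_sym (R : nzRingType) n : (hypJ R n)^T = hypJ R n.
Proof. by rewrite /hypJ tr_block_mx !trmx0 !trmx1. Qed.

Lemma hypJJ (R : nzRingType) n : hypJ R n *m hypJ R n = 1%:M.
Proof.
rewrite /hypJ mulmx_block !(mul0mx, mulmx0, mulmx1, add0r, addr0).
by rewrite -scalar_mx_block.
Qed.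

Lemma hypJ_unit n : hypJ int n \in unitmx.
Proof. by case/mulmx1_unit: (hypJJ int n). Qed.

Lemma ratm_hypJ n : ratm (hypJ int n) = hypJ rat n.
Proof. by rewrite /ratm /hypJ map_block_mx !map_mx0 !map_mx1. Qed.

Lemma hyp_form_hv n (u v : 'rV[rat]_(n + n)) :
  hyp_form (hv u) (hv v) = (u *m hypJ rat n *m v^T) 0 0.
Proof.
rewrite -[u in RHS]hsubmxK -[v in RHS]hsubmxK /hypJ tr_row_mx mul_row_block.
rewrite !(mulmx0, mulmx1, add0r, addr0) mul_row_col !mxE -big_split.
by apply: eq_bigr => i _; rewrite !mxE /= addrC mulrC.
Qed.

Lemma hv_hyp n (u : 'rV[rat]_(n + n)) : hv u \in hyp n <-> exists c, u = ratm c.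
Proof.
rewrite ratm_intP; split=> [/mxOverP H i j|H].
  rewrite ord1; case: (split_ordP j) => k ->.
    by have := H k 0; rewrite mxE.
  by have := H k 1; rewrite mxE.
by apply/mxOverP => i j; rewrite mxE; case: ifP.
Qed.

Lemma in_hypP n (x : 'M[rat]_(n, 2)) : x \in hyp n <-> exists c, x = hv (ratm c).
Proof.
rewrite -{1}[x]hcK hv_hyp; split=> [[c e]|[c ->]]; exists c; last by rewrite hvK.
by rewrite -e hcK.
Qed.

Definition hrows n k (S : 'M[rat]_(k, n + n)) : k.-tuple 'M[rat]_(n, 2) :=
  [tuple hv (row i S) | i < k].

Lemma lcomb_hrows n k (S : 'M[rat]_(k, n + n)) u : lcomb (hrows S) u = hv (u *m S).
Proof.
rewrite mulmx_sum_row linear_sum; apply: eq_bigr => i _.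
by rewrite linearZ tnth_mktuple.
Qed.

Lemma gram_hrows n k (S : 'M[rat]_(k, n + n)) (Z : zmodClosed 'M[rat]_(n, 2)) :
  @gram (sublattice Z) k (hrows S) = S *m hypJ rat n *m S^T.
Proof.
apply/matrixP => i j; rewrite !mxE !tnth_mktuple [LHS]hyp_form_hv -row_mul tr_row.
rewrite [LHS]mxE; apply: eq_bigr => k' _; congr (_ * _); rewrite mxE //.
Qed.

Lemma hrows_Zbasis n k (S : 'M[rat]_(k, n + n)) (Z : zmodClosed 'M[rat]_(n, 2)) :
  row_free S -> (forall x, x \in Z <-> exists c, x = hv (ratm c *m S)) ->
  @Zbasis (sublattice Z) k (hrows S).
Proof.
move=> fS HZ; split.
  apply: free_lcomb => u v; rewrite !lcomb_hrows => /hv_inj.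
  exact: row_free_inj.
move=> x; rewrite HZ; split=> [[c ->]|[c ->]].
  exists (fun i => c 0 i); rewrite -lcomb_hrows; apply: eq_bigr => i _.
  by rewrite mxE scaler_int.
exists (\row_i c i); rewrite -lcomb_hrows; apply: eq_bigr => i _.
by rewrite !mxE scaler_int.
Qed.

(* If the first n rows of S span M, these rows span the orthogonal complement:
   they are dual to the last n rows of S. *)
Definition perp_rows n (S : 'M[int]_(n + n)) : 'M[int]_(n, n + n) :=
  dsubmx ((invmx S)^T *m hypJ int n).

Section Structure.
Variables (n : nat) (S : 'M[int]_(n + n)).
Hypothesis uS : S \in unitmx.

Let T := perp_rows S.

Lemma perp_rows_mul : T *m hypJ int n *m S^T = row_mx 0 1%:M.
Proof.
rewrite /T /perp_rows !mul_dsub_mx -!mulmxA (mulmxA (hypJ int n)) hypJJ mul1mx.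
rewrite -trmx_mul mulmxV // trmx1 (scalar_mx_block n n) /block_mx.
by rewrite col_mxKd.
Qed.

Lemma perp_rows_usub : T *m hypJ int n *m (usubmx S)^T = 0.
Proof.
have := perp_rows_mul; rewrite -{1}[S]vsubmxK tr_col_mx mul_mx_row.
by case/eq_row_mx.
Qed.

Definition ambient_gram : 'M[int]_(n + n) := S *m hypJ int n *m S^T.

Lemma ambient_gram_inv :
  ambient_gram *m ((invmx S)^T *m hypJ int n *m invmx S) = 1%:M.
Proof.
rewrite /ambient_gram !mulmxA -(mulmxA _ S^T) -trmx_mul mulVmx // trmx1 mulmx1.
by rewrite -(mulmxA S) hypJJ mulmx1 mulmxV.
Qed.

Lemma usub_gram : ulsubmx ambient_gram = usubmx S *m hypJ int n *m (usubmx S)^T.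
Proof.
by rewrite /ambient_gram -{1 2}[S]vsubmxK tr_col_mx mul_col_mx mul_col_row block_mxKul.
Qed.

(** The inverse of [ambient_gram] is the Gram matrix of the basis dual to [S], whose last rows span
    the complement. This links the determinants and the divisibility of the two Gram matrices. *)
Lemma perp_gram : drsubmx ((invmx S)^T *m hypJ int n *m invmx S) =
  T *m hypJ int n *m T^T.
Proof.
have -> : (invmx S)^T *m hypJ int n *m invmx S =
    ((invmx S)^T *m hypJ int n) *m hypJ int n *m ((invmx S)^T *m hypJ int n)^T.
  by rewrite trmx_mul trmxK hypJ_sym !mulmxA -(mulmxA _ _ (hypJ int n)) hypJJ mulmx1.
rewrite /T /perp_rows; move: ((invmx S)^T *m hypJ int n) => W.
by rewrite -{1 2}[W]vsubmxK tr_col_mx mul_col_mx mul_col_row block_mxKdr.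
Qed.

End Structure.

(** Smith's form gives a unimodular [R] whose first rows span [M] up to finite index, and
    torsion-freeness of the quotient removes the index. Coordinates in the basis dual to [R] are
    pairings with the rows of [R], so orthogonality to [M] annihilates the first half of them. *)
Lemma primsub_structure n (M : primsub n) : exists S : 'M[int]_(n + n),
  [/\ S \in unitmx,
      forall x, x \in psub M <-> exists c, x = hv (ratm c *m ratm (usubmx S))
    & forall x, x \in perp M <-> exists c, x = hv (ratm c *m ratm (perp_rows S))].
Proof.
have [[b bM] _ _] := psub_even_lattice M.
have /choice[B0 HB0] : forall i : 'I_n, exists c, tnth b i = hv (ratm c).
  move=> i; apply/in_hypP/psub_sub/(Zbasis_mem bM); exists (delta_mx 0 i).
  by rewrite /ratm map_delta_mx lcomb_delta.
pose B : 'M[int]_(n, n + n) := \matrix_i B0 i.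
have eb : b = hrows (ratm B).
  apply: eq_from_tnth => i; rewrite tnth_mktuple HB0; congr hv.
  by apply/rowP => j; rewrite !mxE.
have fB : row_free (ratm B).
  rewrite -kermx_eq0; apply/eqP/row_matrixP => i; rewrite row0.
  apply: (Zbasis_inj bM); rewrite eb lcomb_hrows raddf0 -[RHS](raddf0 (@hv n)); congr hv.
  by apply/sub_kermxP; exact: row_sub.
have [L uL [R uR [d _ eB]]] := int_Smith_normal_form B.
set D := \matrix_(i, j) _ in eB.
pose D1 : 'M[int]_n := \matrix_(i, j) (d`_i *+ (i == j :> nat)).
have eD : D = row_mx D1 0.
  apply/matrixP => i j; rewrite mxE; case: (split_ordP j) => j' ->.
    by rewrite row_mxEl mxE.
  rewrite row_mxEr mxE /= (_ : (i == n + j' :> nat) = false) //.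
  by apply/eqP; have := ltn_ord i; lia.
have {}eB : B = L *m D1 *m usubmx R.
  by rewrite eB eD -{1}[R]vsubmxK -mulmxA mul_row_col mul0mx addr0 mulmxA.
have D0 : \det D1 != 0.
  have [X HX] := row_freeP fB.
  have : ratm D1 *m (ratm (usubmx R) *m X *m ratm L) = 1%:M.
    rewrite -[LHS](mulKmx (ratm_unit uL)) -[RHS](mulVmx (ratm_unit uL)); congr (_ *m _).
    by rewrite !mulmxA -!ratmM -eB HX mul1mx.
  move=> /mulmx1_unit[]; rewrite unitmxE ratm_det unitfE intr_eq0 //.
have memM x : x \in psub M <-> exists c, x = hv (ratm c *m ratm B).
  by rewrite (Zbasis_mem bM) eb; split=> -[c ->]; exists c; rewrite lcomb_hrows.
have memR y : y \in psub M <-> exists c, y = hv (ratm c *m ratm (usubmx R)).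
  split=> [/memM[c ->]|[c ->]].
    by exists (c *m L *m D1); rewrite eB !ratmM !mulmxA.
  (* By the adjugate, [\det D1] times an integral combination of the rows of [usubmx R] lies in
     [M]. *)
  apply: (@psub_torsionfree _ M _ (\det D1)) => //.
    by apply/in_hypP; exists (c *m usubmx R); rewrite ratmM.
  apply/memM; exists (c *m \adj D1 *m invmx L).
  rewrite -scaler_int -linearZ /=; congr hv.
  rewrite eB -!ratmM -!mulmxA (mulmxA (invmx L)) mulVmx // mul1mx (mulmxA (\adj D1)).
  by rewrite mul_adj_mx mul_scalar_mx -scalemxAr ratmZ.
exists R; split=> // x.
split=> [/asboolP[/in_hypP[z ->] zM]|[c ->]].
  exists (z *m hypJ int n *m (dsubmx R)^T); congr hv; rewrite -ratmM; congr ratm.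
  have z0 : z *m hypJ int n *m (usubmx R)^T = 0.
    apply: ratm_inj; apply/rowP => j.
    have := zM (hv (ratm (delta_mx 0 j) *m ratm (usubmx R))).
    rewrite hyp_form_hv -ratm_hypJ -ratmM -ratmT -!ratmM => H.
    have {H} := H _; rewrite trmx_mul trmx_delta mulmxA -colE ratm0 => H.
    rewrite [RHS]mxE -H; last by apply/memR; exists (delta_mx 0 j); rewrite ratmM.
    by rewrite !mxE.
  have ey : z *m hypJ int n *m R^T = row_mx 0 (z *m hypJ int n *m (dsubmx R)^T).
    by rewrite -[in LHS](vsubmxK R) tr_col_mx mul_mx_row z0.
  have ez : z = z *m hypJ int n *m R^T *m ((invmx R)^T *m hypJ int n).
    by rewrite -!mulmxA (mulmxA R^T) -trmx_mul mulVmx // trmx1 mul1mx hypJJ mulmx1.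
  by rewrite {1}ez ey -[(invmx R)^T *m _]vsubmxK mul_row_col mul0mx add0r.
apply/asboolP; split; first by apply/in_hypP; exists (c *m perp_rows R); rewrite ratmM.
move=> y /memR[e ->]; rewrite hyp_form_hv -ratm_hypJ -!ratmM -ratmT -!ratmM.
rewrite trmx_mul -!mulmxA (mulmxA (hypJ int n)) (mulmxA (perp_rows R)) (mulmxA
  (perp_rows R)).
by rewrite perp_rows_usub // mul0mx mulmx0 ratm0 mxE.
Qed.

Lemma hypJ_even n : even_mx (hypJ int n).
Proof.
move=> v; rewrite -[v]hsubmxK /hypJ tr_row_mx mul_row_block.
rewrite !(mulmx0, mulmx1, add0r, addr0) mul_row_col.
have -> : rsubmx v *m (lsubmx v)^T = (lsubmx v *m (rsubmx v)^T)^T.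
  by rewrite trmx_mul trmxK.
move: (lsubmx v *m _) => w; exists (w 0 0).
by rewrite !mxE; ring.
Qed.

Lemma det_hypJ (R : comNzRingType) n : \det (hypJ R n) = (-1) ^+ n.
Proof.
have e : block_mx 1%:M 0 (- 1%:M) 1%:M *m hypJ R n *m block_mx 1%:M 0 1%:M 1%:M =
    block_mx 1%:M 1%:M 0 (- 1%:M).
  rewrite /hypJ !mulmx_block !(mulmx0, mul0mx, mulmx1, mul1mx, add0r, addr0).
  by rewrite subrr.
have := congr1 determinant e; rewrite !det_mulmx !det_lblock det_ublock !det1.
by rewrite !mulr1 !mul1r => ->; rewrite -raddfN det_scalar.
Qed.

Lemma usubmx_free n k (S : 'M[rat]_(n + k)) : S \in unitmx -> row_free (usubmx S).
Proof.
move=> uS; apply/row_freeP; exists (invmx S *m col_mx 1%:M 0).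
rewrite mulmxA mul_usub_mx mulmxV // (scalar_mx_block n k) /block_mx col_mxKu.
by rewrite mul_row_col mulmx1 mul0mx addr0.
Qed.

Lemma dsubmx_free n k (S : 'M[rat]_(n + k)) : S \in unitmx -> row_free (dsubmx S).
Proof.
move=> uS; apply/row_freeP; exists (invmx S *m col_mx 0 1%:M).
rewrite mulmxA mul_dsub_mx mulmxV // (scalar_mx_block n k) /block_mx col_mxKd.
by rewrite mul_row_col mulmx1 mul0mx add0r.
Qed.

Lemma sg_sum_count n (d : 'rV[rat]_n) : (forall i, d 0 i != 0) ->
  \sum_i Num.sg (d 0 i) = #|[set i | 0 < d 0 i]|%:R - #|[set i | d 0 i < 0]|%:R
  /\ addn #|[set i | 0 < d 0 i]| #|[set i | d 0 i < 0]| = n.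
Proof.
move=> d0; split.
  rewrite -!sum1_card !natr_sum [X in X - _]big_mkcond [X in _ - X]big_mkcond -sumrB.
  apply: eq_bigr => i _; rewrite !inE; case: sgrP (d0 i) => //= _ _; ring.
have -> : [set i | d 0 i < 0] = ~: [set i | 0 < d 0 i].
  by apply/setP => i; rewrite !inE -leNgt lt_neqAle d0.
by rewrite cardsC card_ord.
Qed.

(** * Invariants of a primitive sublattice and of its rescaled complement *)

Section ThetaData.
Variables (n : nat) (M : primsub n) (S : 'M[int]_(n + n)).
Hypothesis uS : S \in unitmx.
Let U := usubmx S.
Let T := perp_rows S.
Hypothesis memM : forall x, x \in psub M <-> exists c, x = hv (ratm c *m ratm U).
Hypothesis memP : forall x, x \in perp M <-> exists c, x = hv (ratm c *m ratm T).

Let X := sublattice M.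
Let Y := scale (-1) (perp M).
Let J := hypJ int n.
Let G := U *m J *m U^T.
Let E := T *m J *m T^T.

Lemma U_free : row_free (ratm U).
Proof.
rewrite (_ : ratm U = usubmx (ratm S)); last by rewrite /U /ratm map_usubmx.
exact: usubmx_free (ratm_unit uS).
Qed.

Lemma T_free : row_free (ratm T).
Proof.
rewrite (_ : ratm T = dsubmx (ratm ((invmx S)^T *m J))); last first.
  by rewrite /T /perp_rows /ratm map_dsubmx.
apply: dsubmx_free; apply: ratm_unit.
by rewrite unitmx_mul unitmx_tr unitmx_inv uS hypJ_unit.
Qed.

Lemma basisX : @Zbasis X n (hrows (ratm U)).
Proof. exact: hrows_Zbasis U_free memM. Qed.

Lemma basisP : @Zbasis (perp M) n (hrows (ratm T)).
Proof. exact: hrows_Zbasis T_free memP. Qed.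

Lemma basisY : @Zbasis Y n (hrows (ratm T)).
Proof. exact: basisP. Qed.

Lemma gramX : @gram X n (hrows (ratm U)) = ratm G.
Proof. by rewrite gram_hrows -ratm_hypJ /G !ratmM ratmT. Qed.

Lemma gramP : @gram (perp M) n (hrows (ratm T)) = ratm E.
Proof. by rewrite gram_hrows -ratm_hypJ /E !ratmM ratmT. Qed.

Lemma gramY : @gram Y n (hrows (ratm T)) = ratm (- E).
Proof.
rewrite ratmN -gramP; apply/matrixP => i j; rewrite !mxE /= /scale_form.
by rewrite mulN1r.
Qed.

Lemma G_neq0 : \det G != 0.
Proof.
have [_ _ nd] := psub_even_lattice M.
move/(gram_unit basisX): nd; rewrite gramX unitmxE ratm_det unitfE.
by rewrite intr_eq0.
Qed.

(** The determinant [(-1) ^+ n] of [hypJ] is compensated by the scaling of the complement by -1. *)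
Lemma det_E : \det (- E) = \det G.
Proof.
have := det_complement (ambient_gram_inv uS).
rewrite perp_gram usub_gram -/U -/T -/G -/E => <-.
rewrite /ambient_gram !det_mulmx det_tr det_hypJ mulrAC -expr2.
have -> : \det S ^+ 2 = 1 by move: uS; rewrite unitmxE => /orP[] /eqP ->.
by rewrite -scaleN1r detZ mul1r mulrC.
Qed.

Lemma E_neq0 : \det E != 0.
Proof.
have := G_neq0; rewrite -det_E -scaleN1r detZ mulf_eq0 negb_or.
by case/andP.
Qed.

Lemma Gr_unit : ratm G \in unitmx.
Proof. by rewrite unitmxE ratm_det unitfE intr_eq0 G_neq0. Qed.

Lemma Er_unit : ratm E \in unitmx.
Proof. by rewrite unitmxE ratm_det unitfE intr_eq0 E_neq0. Qed.

Lemma evenG : even_mx G. Proof. exact: even_mx_cong (@hypJ_even n). Qed.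
Lemma evenE : even_mx E. Proof. exact: even_mx_cong (@hypJ_even n). Qed.

Lemma evenNE : even_mx (- E).
Proof.
move=> v; have [c ec] := evenE v; exists (- c).
by rewrite mulmxN mulNmx mxE ec mulrN.
Qed.

Lemma Y_even : even_lattice n Y.
Proof.
split; first by exists (hrows (ratm T)); exact: basisY.
  exact: even_integral_gram basisY gramY evenNE.
apply/(gram_unit basisY); rewrite gramY unitmxE ratm_det unitfE intr_eq0 det_E.
exact: G_neq0.
Qed.

Lemma XY_disc : disc X = disc Y.
Proof.
apply: eq_disc => d; split=> -[m [b [bX ->]]].
  have [em ->] := Zbasis_change bX basisX.
  exists n, (hrows (ratm T)); split; first exact: basisY.
  by rewrite em gramY gramX !ratm_det det_E.
have [em ->] := Zbasis_change bX basisY.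
exists n, (hrows (ratm U)); split; first exact: basisX.
by rewrite em gramY gramX !ratm_det det_E.
Qed.

Let W : 'M[rat]_(n + n) := col_mx (ratm U) (ratm T).

Lemma U_J_T : U *m J *m T^T = 0.
Proof.
by rewrite -(tr_form _ _ (hypJ_sym int n)) (perp_rows_usub uS) trmx0.
Qed.

Lemma W_gram : W *m hypJ rat n *m W^T = block_mx (ratm G) 0 0 (ratm E).
Proof.
rewrite /W tr_col_mx mul_col_mx mul_col_row -ratm_hypJ -!ratmT -!ratmM.
by rewrite U_J_T (perp_rows_usub uS) ratm0.
Qed.

Lemma W_unit : W \in unitmx.
Proof.
have : W *m hypJ rat n *m W^T \in unitmx.
  by rewrite W_gram unitmxE det_ublock unitrM -!unitmxE Gr_unit Er_unit.
by rewrite !unitmx_mul => /andP[/andP[]].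
Qed.

(** Over [Q] the space [U^n] is the sum of [M] and its complement and has signature zero, so the
    sign sums of [X] and [Y] agree. As both ranks are [n], the numbers of positive and of negative
    entries agree too. *)
Lemma XY_signature : same_signature X Y.
Proof.
have Gs : (ratm G)^T = ratm G by rewrite -ratmT /G (sym_cong _ (hypJ_sym _ _)).
have Es : (ratm (- E))^T = ratm (- E).
  by rewrite -ratmT linearN /= /E (sym_cong _ (hypJ_sym _ _)).
have uE : ratm (- E) \in unitmx.
  by rewrite unitmxE ratm_det unitfE intr_eq0 det_E G_neq0.
have [P [d [uP HP d0]]] := rat_diag Gs Gr_unit.
have [Q [e [uQ HQ e0]]] := rat_diag Es uE.
have [s1 c1] := sg_sum_count d0; have [s2 c2] := sg_sum_count e0.
have sde : \sum_i Num.sg (d 0 i) = \sum_i Num.sg (e 0 i).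
  pose K1 : 'M[rat]_(n + n) := block_mx P 0 0 Q *m W.
  (* The rows of [K2] are [e_i + f_i / 2] and [e_i - f_i / 2], of values 1 and -1. *)
  pose K2 : 'M[rat]_(n + n) := block_mx 1%:M (2^-1)%:M 1%:M (- 2^-1)%:M.
  have HK1 : K1 *m hypJ rat n *m K1^T = diag_mx (row_mx d (- e)).
    have -> : K1 *m hypJ rat n *m K1^T =
        block_mx P 0 0 Q *m (W *m hypJ rat n *m W^T) *m (block_mx P 0 0 Q)^T.
      by rewrite /K1 trmx_mul !mulmxA.
    rewrite W_gram tr_block_mx !trmx0 !mulmx_block !(mulmx0, mul0mx, addr0, add0r).
    rewrite HP diag_mx_row; congr block_mx;
      rewrite linearN /= -HQ ratmN mulmxN mulNmx opprK //.
  have uK1 : K1 \in unitmx.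
    by rewrite unitmx_mul W_unit unitmxE det_ublock unitrM -!unitmxE uP uQ.
  have HK2 : K2 *m hypJ rat n *m K2^T = diag_mx (row_mx (const_mx 1) (const_mx (-1))).
    rewrite /K2 /hypJ tr_block_mx !mulmx_block !(mulmx0, mul0mx, mulmx1, mul1mx,
      addr0, add0r).
    rewrite !trmx1 !tr_scalar_mx ?mulmx1 ?mul1mx diag_mx_row !diag_const_mx -!raddfD.
    by congr block_mx; rewrite -?(raddf0 (@scalar_mx _ n)); congr _%:M; field.
  have c0 i : (row_mx (const_mx 1) (const_mx (-1)) : 'rV[rat]_(n + n)) 0 i != 0.
    by case: (split_ordP i) => j ->; rewrite ?row_mxEl ?row_mxEr mxE ?oppr_eq0 oner_eq0.
  have de0 i : (row_mx d (- e)) 0 i != 0.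
    by case: (split_ordP i) => j ->; rewrite ?row_mxEl ?row_mxEr // mxE oppr_eq0.
  have uK2 : K2 \in unitmx.
    have : \det (K2 *m hypJ rat n *m K2^T) != 0 by rewrite HK2 det_diag; apply/prodf_neq0.
    by rewrite !det_mulmx !mulf_eq0 !negb_or unitmxE unitfE => /andP[/andP[]].
  have := diag_sg_sum uK1 uK2 HK1 HK2 de0 c0; rewrite !big_split_ord /=.
  have -> : \sum_(i < n) Num.sg (row_mx d (- e) 0 (lshift n i)) = \sum_i Num.sg (d 0 i).
    by apply: eq_bigr => i _; rewrite row_mxEl.
  have -> : \sum_(i < n) Num.sg (row_mx d (- e) 0 (rshift n i)) = - \sum_i Num.sg (e 0 i).
    by rewrite -sumrN; apply: eq_bigr => i _; rewrite row_mxEr mxE sgrN.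
  rewrite -[RHS]big_split [RHS]big1 /= => [/eqP|i _].
    by rewrite subr_eq0 => /eqP.
  by rewrite row_mxEl row_mxEr !mxE sgrN sgr1 subrr.
have pq : #|[set i | 0 < d 0 i]| = #|[set i | 0 < e 0 i]| /\
          #|[set i | d 0 i < 0]| = #|[set i | e 0 i < 0]|.
  move: sde; rewrite s1 s2 => /eqP; rewrite subr_eq addrAC eq_sym subr_eq -!natrD eqr_nat.
  by move=> /eqP; lia.
exists #|[set i | 0 < d 0 i]|, #|[set i | d 0 i < 0]|; split.
  by exists n, (hrows (ratm U)), P, d; split=> //; [exact: basisX | rewrite gramX].
exists n, (hrows (ratm T)), Q, e; split=> //; first exact: basisY.
  by rewrite gramY.
Qed.

(** The scaling by [1/m] is even exactly when the Gram matrix is [m] times an even integral matrix.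
    For [m > 1], [scaled_complement] carries this property from [G] to [E] and back; for [m = 1]
    both lattices have it. *)
Lemma XY_primitive : primitive_lattice X <-> primitive_lattice Y.
Proof.
have scaledP (Z : qlattice) (b : n.-tuple (qspace Z)) (K : 'M[int]_n) (m : nat) :
    Zbasis b -> gram b = ratm K -> (0 < m)%N ->
    even_integral (scale m%:R^-1 Z) <-> exists K', K = m%:Z *: K' /\ even_mx K'.
  move=> bZ eK m0; have mQ : m%:R != 0 :> rat by rewrite pnatr_eq0 -lt0n.
  have bZ' : @Zbasis (scale m%:R^-1 Z) n b by exact: bZ.
  have eK' : @gram (scale m%:R^-1 Z) n b = m%:R^-1 *: ratm K.
    by rewrite -eK; apply/matrixP => i j; rewrite !mxE.
  split=> [/(gram_int bZ')[K' [e _ ev]]|[K' [e ev]]].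
    exists K'; split=> //; apply: ratm_inj; rewrite ratmZ -e eK' scalerA mulfV //.
    by rewrite scale1r.
  apply: (even_integral_gram bZ' _ ev); rewrite eK' e ratmZ scalerA.
  by rewrite mulVf ?scale1r.
pose Ga := ambient_gram S; pose Gi := (invmx S)^T *m J *m invmx S.
have Gs : G^T = G by rewrite /G (sym_cong _ (hypJ_sym _ _)).
have Es : E^T = E by rewrite /E (sym_cong _ (hypJ_sym _ _)).
have GGi : Ga *m Gi = 1%:M by exact: ambient_gram_inv.
have GiG := mulmx1C GGi.
have evGa : even_mx Ga by exact: even_mx_cong (@hypJ_even n).
have evGi : even_mx Gi.
  by rewrite /Gi -{2}[invmx S]trmxK; exact: even_mx_cong (@hypJ_even n).
have evblock (K : 'M[int]_(n + n)) : even_mx K -> even_mx (ulsubmx K) /\ even_mx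
  (drsubmx K).
  move=> evK; split=> v.
    have [c ec] := evK (row_mx v 0); exists c;
      rewrite -ec -{2}[K]submxK tr_row_mx mul_row_block.
    by rewrite mul_row_col !mul0mx !addr0 trmx0 mulmx0 addr0.
  have [c ec] := evK (row_mx 0 v); exists c;
    rewrite -ec -{2}[K]submxK tr_row_mx mul_row_block.
  by rewrite mul_row_col !mul0mx !add0r trmx0 mulmx0 add0r.
have GaS : Ga^T = Ga by exact: sym_cong (hypJ_sym _ _).
have GiS : Gi^T = Gi by rewrite /Gi !trmx_mul trmxK hypJ_sym mulmxA.
have eG : ulsubmx Ga = G by exact: usub_gram.
have eE : drsubmx Gi = E by exact: perp_gram.
have dlE (K : 'M[int]_(n + n)) : K^T = K -> dlsubmx K = (ursubmx K)^T.
  by move=> e; rewrite -[in LHS]e; apply/matrixP => i j; rewrite !mxE.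
move: GGi; rewrite -{1}[Ga]submxK -{1}[Gi]submxK mulmx_block (scalar_mx_block n n).
rewrite !dlE // eG eE => /eq_block_mx[e1 e2 e3 e4].
move: GiG; rewrite -{1}[Ga]submxK -{1}[Gi]submxK mulmx_block (scalar_mx_block n n).
rewrite !dlE // eG eE => /eq_block_mx[f1 f2 f3 f4].
have key (m : nat) : (1 < m)%N -> (exists K', G = m%:Z *: K' /\ even_mx K') <->
    (exists K', - E = m%:Z *: K' /\ even_mx K').
  have neg (K : 'M[int]_n) : (exists K', K = m%:Z *: K' /\ even_mx K') ->
      exists K', - K = m%:Z *: K' /\ even_mx K'.
    move=> [K' [-> ev]]; exists (- K'); rewrite scalerN; split=> // v.
    by have [c ec] := ev v; exists (- c); rewrite mulmxN mulNmx mxE ec mulrN.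
  move=> m1; split=> [[K' [eK ev]]|/neg].
    apply: neg; apply: (scaled_complement m1 Es _ e1 e2 f4 eK ev).
    by case: (evblock _ evGa).
  rewrite opprK => -[K' [eK ev]].
  have [evA _] := evblock _ evGi.
  (* For the converse the roles of [Ga] and [Gi] are exchanged and their blocks are listed in
     reverse order, so that [E] becomes the leading block. *)
  apply: (scaled_complement (H := (ursubmx Gi)^T) (A := drsubmx Ga) (B := (ursubmx Ga)^T)
    m1 Gs evA _ _ _ eK ev); rewrite ?trmxK.
  - exact: etrans (addrC _ _) f4.
  - exact: etrans (addrC _ _) f3.
  exact: etrans (addrC _ _) e1.
split=> prim m m0.
  rewrite (scaledP Y _ _ _ basisY gramY) // -(prim m m0) (scaledP X _ _ _ basisX gramX) //.
  have [m1|m1] := leqP m 1.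
    have -> : m = 1%N by lia.
    by split=> _; [exists G; rewrite scale1r; split=> //; exact: evenG
                  |exists (- E); rewrite scale1r; split=> //; exact: evenNE].
  by split=> /(key m m1).
rewrite (scaledP X _ _ _ basisX gramX) // -(prim m m0) (scaledP Y _ _ _ basisY gramY) //.
have [m1|m1] := leqP m 1.
  have -> : m = 1%N by lia.
  by split=> _; [exists (- E); rewrite scale1r; split=> //; exact: evenNE
                |exists G; rewrite scale1r; split=> //; exact: evenG].
by split=> /(key m m1).
Qed.

Lemma decomp (x : 'M[rat]_(n, 2)) :
  exists u v, x = hv (u *m ratm U) + hv (v *m ratm T).
Proof.
pose w := hc x *m invmx W; exists (lsubmx w), (rsubmx w).
by rewrite -linearD -mul_row_col hsubmxK -/W /w mulmxKV ?W_unit //= hcK.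
Qed.

Lemma spanX (x : qspace X) : in_span x <-> exists u, x = hv (u *m ratm U).
Proof.
rewrite (Zbasis_span basisX).
by split=> -[u ->]; exists u; rewrite lcomb_hrows.
Qed.

Lemma spanY (x : qspace Y) : in_span x <-> exists u, x = hv (u *m ratm T).
Proof.
rewrite (Zbasis_span basisY).
by split=> -[u ->]; exists u; rewrite lcomb_hrows.
Qed.

Lemma dualX u : hv (u *m ratm U) \in dual_pred X <-> exists c, u *m ratm G = ratm c.
Proof. by rewrite -lcomb_hrows (Zbasis_dual basisX) gramX. Qed.

Lemma dualY u : hv (u *m ratm T) \in dual_pred Y <-> exists c, u *m ratm E = ratm c.
Proof.
rewrite -lcomb_hrows (Zbasis_dual basisY) gramY ratmN mulmxN.
by split=> -[c ec]; exists (- c); rewrite ratmN -ec ?opprK.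
Qed.

(* Pairing z = u U + v T with the two bases reads off u G and v E. *)
Lemma pair_decomp (z : 'rV[rat]_(n + n)) (a b : 'rV[rat]_n) :
  z = a *m ratm U + b *m ratm T ->
  z *m ratm (J *m U^T) = a *m ratm G /\ z *m ratm (J *m T^T) = b *m ratm E.
Proof.
move=> ->; rewrite !mulmxDl -!mulmxA -!ratmM !mulmxA -/G -/E.
by rewrite U_J_T (perp_rows_usub uS) ratm0 !mulmx0 addr0 add0r.
Qed.
End ThetaData.

(** * Gluing *)

Section Glue.
Variables (n : nat) (M : primsub n).
Let X := sublattice M.
Let Y := scale (-1) (perp M).

Definition glued (b : dual X) (a : dual Y) : Prop :=
  ((dual_val b : 'M[rat]_(n, 2)) + (dual_val a : 'M[rat]_(n, 2))) \in hyp n.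

Lemma glue_decomp (x : 'M[rat]_(n, 2)) : x \in hyp n ->
  exists (b : dual X) (a : dual Y),
    x = (dual_val b : 'M[rat]_(n, 2)) + (dual_val a : 'M[rat]_(n, 2)).
Proof.
move=> /in_hypP[c ex]; have [S [uS memM memP]] := primsub_structure M.
have [u [v e]] := decomp uS memM x.
have ez : ratm c = u *m ratm (usubmx S) + v *m ratm (perp_rows S).
  by apply: hv_inj; rewrite -ex e linearD.
have [e1 e2] := pair_decomp uS ez.
have /asboolP bX : hv (u *m ratm (usubmx S)) \in dual_pred X.
  by apply/(dualX uS memM); eexists; rewrite -e1 -ratmM.
have /asboolP aY : hv (v *m ratm (perp_rows S)) \in dual_pred Y.
  by apply/(dualY uS memP); eexists; rewrite -e2 -ratmM.
by exists (@Dual X _ (introT (asboolP _) bX)), (@Dual Y _ (introT (asboolP _) aY)).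
Qed.

Lemma span_decomp (x : 'M[rat]_(n, 2)) : exists (b : qspace X) (a : qspace Y),
  [/\ in_span b, in_span a & x = (b : 'M[rat]_(n, 2)) + (a : 'M[rat]_(n, 2))].
Proof.
have [S [uS memM memP]] := primsub_structure M.
have [u [v e]] := decomp uS memM x.
exists (hv (u *m ratm (usubmx S))), (hv (v *m ratm (perp_rows S))); split=> //.
  by apply/(spanX uS memM); exists u.
by apply/(spanY uS memP); exists v.
Qed.

Lemma span_orth (b : qspace X) (a : qspace Y) : in_span b -> in_span a ->
  hyp_form (b : 'M[rat]_(n, 2)) (a : 'M[rat]_(n, 2)) = 0.
Proof.
move=> [k k0 kb] [l l0 /asboolP[_ la]].
have k0' : k%:~R != 0 :> rat by rewrite intr_eq0.
have l0' : l%:~R != 0 :> rat by rewrite intr_eq0.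
have := la _ kb; rewrite [LHS](@qformMzl (hyp n) l) (@qform_sym (hyp n)).
rewrite (@qformMzl (hyp n)) => /eqP.
by rewrite !mulf_eq0 (negPf k0') (negPf l0') => /eqP.
Qed.

(** The basis [perp_rows S] is dual to the last rows of [S], so the functional with values [c] on it
    is the pairing with the integral vector [z]. The projection of [z] to the span of the complement
    is [a], and the other projection is the wanted [b]. *)
Lemma glue_right (a : dual Y) : exists b : dual X, glued b a.
Proof.
have [S [uS memM memP]] := primsub_structure M.
case: a => x /[dup] xd; rewrite /glued /=.
have /(spanY uS memP)[v ev] : @in_span Y x by have /dual_predP[] := xd.
rewrite ev => /(dualY uS memP)[c ec].
pose z := row_mx 0 c *m S.
have [u [w e]] := decomp uS memM (hv (ratm z)).
have ez : ratm z = u *m ratm (usubmx S) + w *m ratm (perp_rows S).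
  by apply: hv_inj; rewrite e linearD.
have [e1 e2] := pair_decomp uS ez.
have ew : w = v.
  apply: (can_inj (mulmxK (Er_unit uS memM))); rewrite -e2 ec /z -ratmM; congr ratm.
  have e3 : S *m hypJ int n *m (perp_rows S)^T = col_mx 0 1%:M.
    by rewrite -(tr_form _ _ (hypJ_sym int n)) (perp_rows_mul uS) tr_row_mx trmx0 trmx1.
  by rewrite -mulmxA (mulmxA S) e3 mul_row_col mul0mx mulmx1 add0r.
have /asboolP bX : hv (u *m ratm (usubmx S)) \in dual_pred X.
  by apply/(dualX uS memM); eexists; rewrite -e1 -ratmM.
exists (@Dual X _ (introT (asboolP _) bX)) => /=.
by rewrite -ew -e; apply/in_hypP; exists z.
Qed.

(** A functional on [M] extends to [U^n] since [M] is spanned by part of a basis; [z] represents the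
    extension by zero in the basis dual to [S]. *)
Lemma glue_left (b : dual X) : exists a : dual Y, glued b a.
Proof.
have [S [uS memM memP]] := primsub_structure M.
case: b => x /[dup] xd; rewrite /glued /=.
have /(spanX uS memM)[v ev] : @in_span X x by have /dual_predP[] := xd.
rewrite ev => /(dualX uS memM)[c ec].
pose z := row_mx c 0 *m ((invmx S)^T *m hypJ int n).
have [u [w e]] := decomp uS memM (hv (ratm z)).
have ez : ratm z = u *m ratm (usubmx S) + w *m ratm (perp_rows S).
  by apply: hv_inj; rewrite e linearD.
have [e1 e2] := pair_decomp uS ez.
have eu : u = v.
  apply: (can_inj (mulmxK (Gr_unit uS memM))); rewrite -e1 ec /z -ratmM; congr ratm.
  rewrite -!mulmxA (mulmxA (hypJ int n)) hypJJ mul1mx -trmx_mul mul_usub_mx mulmxV //.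
  rewrite (scalar_mx_block n n) /block_mx col_mxKu tr_row_mx trmx1 trmx0.
  by rewrite mul_row_col mulmx1 mul0mx addr0.
have /asboolP aY : hv (w *m ratm (perp_rows S)) \in dual_pred Y.
  by apply/(dualY uS memP); eexists; rewrite -e2 -ratmM.
exists (@Dual Y _ (introT (asboolP _) aY)) => /=.
by rewrite -eu -e; apply/in_hypP; exists z.
Qed.

Lemma gluedB b b' a a' : glued b a -> glued b' a' -> glued (b - b') (a - a').
Proof.
rewrite /glued /= => H H'; have := rpredB H H'.
by rewrite opprD addrACA.
Qed.

Lemma gluedD b b' a a' : glued b a -> glued b' a' -> glued (b + b') (a + a').
Proof.
rewrite /glued /= => H H'; have := rpredD H H'.
by rewrite addrACA.
Qed.

Lemma glued_lattice b a : dual_val b \in X -> dual_val a \in Y -> glued b a.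
Proof.
move=> bX /asboolP[aU _]; apply: rpredD => //.
exact: psub_sub bX.
Qed.

(** An integral [b] in the rational span of [M] lies in [M] by primitivity. Hence the glue has
    trivial kernel over the complement, and [phi(M)] is single-valued. *)
Lemma glued_memX b a : glued b a -> dual_val a \in Y -> dual_val b \in X.
Proof.
move=> g /asboolP[aU _]; have bU : dual_val b \in hyp n.
  by rewrite -[dual_val b](addrK (dual_val a : 'M[rat]_(n, 2))); exact: rpredB.
have [k k0 kb] := dual_val_span b.
exact: (psub_torsionfree bU k0 kb).
Qed.

Lemma glued_memY b a : glued b a -> dual_val b \in X -> dual_val a \in Y.
Proof.
move=> g bX; apply/asboolP; split.
  rewrite -[dual_val a](addrK (dual_val b : 'M[rat]_(n, 2))); apply: rpredB.
    by rewrite addrC.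
  exact: psub_sub bX.
move=> y yM; rewrite hyp_form_sym; apply: span_orth.
  exact: (@in_span_mem X).
exact: dual_val_span.
Qed.

(** The sum [b + a] has even norm and orthogonal parts, so [(b, b)] and [- (a, a)] agree modulo 2;
    the scaling of [Y] absorbs the sign. *)
Lemma glued_form b a : even_integral X -> even_integral Y -> glued b a ->
  discr_form (dclass b) = discr_form (dclass a).
Proof.
move=> Xe Ye g; apply/dclass_form_eq => //=; rewrite /scale_form mulN1r opprK.
have o := span_orth (dual_val_span b) (dual_val_span a).
have /in_hypP[c ec] := g.
have [k ek] := hypJ_even c.
have : hyp_form (dual_val b + dual_val a) (dual_val b + dual_val a) = 2 * k%:~R.
  rewrite ec hyp_form_hv -ratm_hypJ -ratmT -!ratmM mxE ek intrM //.
rewrite [LHS](@qformDl (hyp n)) !(@qformDr (hyp n)) /= o [hyp_form (dual_val a)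
  _]hyp_form_sym o.
rewrite addr0 add0r => ->.
by rewrite mulrC mulKf // intr_int.
Qed.

Lemma glueE (b : dual X) (a : dual Y) : @glue n M (dclass b, dclass a) <-> glued b a.
Proof.
split=> [[b' [a' [/= eb ea g]]]|g]; last by exists b, a.
have {g} g : glued b' a' by [].
have : glued (b' + (b - b')) (a' + (a - a')).
  apply: gluedD => //; apply: glued_lattice; exact/dclass_eq.
by rewrite !(addrC _ (_ - _)) !subrK.
Qed.

Lemma phi_exists : even_integral X -> even_integral Y ->
  exists phi : discr_isometry Y X, @glue n M = [set p | p.1 = phi p.2]%classic.
Proof.
move=> Xe Ye.
have /choice[f Hf] : forall a : discr Y, exists b : discr X, glue (b, a).
  move=> a; have [b g] := glue_right (repr a); exists (dclass b).
  by rewrite -(dclass_repr a) glueE.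
have /choice[h Hh] : forall b : discr X, exists a : discr Y, glue (b, a).
  move=> b; have [a g] := glue_left (repr b); exists (dclass a).
  by rewrite -(dclass_repr b) glueE.
have uX (b b' : discr X) (a : discr Y) : glue (b, a) -> glue (b', a) -> b = b'.
  rewrite -(dclass_repr b) -(dclass_repr b') -(dclass_repr a) !glueE => g g'.
  apply/dclass_eq; have := gluedB g g'; move/glued_memX; apply.
  by rewrite subrr rpred0.
have uY (b : discr X) (a a' : discr Y) : glue (b, a) -> glue (b, a') -> a = a'.
  rewrite -(dclass_repr b) -(dclass_repr a') -(dclass_repr a) !glueE => g g'.
  apply/dclass_eq; have := gluedB g g'; move/glued_memY; apply.
  by rewrite subrr rpred0.
have fK : cancel f h by move=> a; apply: (uY (f a)).
have hK : cancel h f by move=> b; apply: (uX _ _ (h b)).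
have fadd : zmod_morphism f.
  move=> a a'; apply: (uX _ _ (a - a')) => //.
  have := Hf a; have := Hf a'.
  move: (f a) (f a') => b b'.
  rewrite -(dclass_repr b) -(dclass_repr b') -(dclass_repr a) -(dclass_repr a').
  by rewrite -!dclassB !glueE => g' g; exact: gluedB.
have fiso a : discr_form (f a) = discr_form a.
  have := Hf a; rewrite -(dclass_repr a) -(dclass_repr (f _)) glueE.
  exact: glued_form.
exists (DiscrIsometry fK hK fadd fiso).
apply/seteqP; split=> -[b a] /=; last by move=> ->.
by move=> g; apply: uX g (Hf a).
Qed.

End Glue.

Section Theta.
Variable n : nat.

Lemma perp_even (M : primsub n) : even_lattice n (scale (-1) (perp M)).
Proof.
have [S [uS memM memP]] := primsub_structure M.
exact: (Y_even uS memM memP).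
Qed.

Lemma perp_signature (M : primsub n) :
  same_signature (sublattice M) (scale (-1) (perp M)).
Proof.
have [S [uS memM memP]] := primsub_structure M.
exact: (XY_signature uS memM memP).
Qed.

Lemma theta_phi (M : primsub n) :
  exists phi : discr_isometry (scale (-1) (perp M)) (sublattice M),
    @glue n M = [set p | p.1 = phi p.2]%classic.
Proof.
by apply: phi_exists; [case: (psub_even_lattice M) | case: (perp_even M)].
Qed.

Definition theta (M : primsub n) : triple n :=
  Triple (psub_even_lattice M) (perp_even M) (perp_signature M)
    (projT1 (cid (theta_phi M))).

Lemma theta_is_theta (M : primsub n) : is_theta M (theta M).
Proof.
exists (psub_even_lattice M), (perp_even M), (perp_signature M).
by exists (projT1 (cid (theta_phi M))); split=> //; exact: projT2 (cid (theta_phi M)).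
Qed.

Lemma theta_phiE (M : primsub n) (b : dual (sublattice M)) (a : dual (scale (-1)
  (perp M))) :
  dclass b = tphi (theta M) (dclass a) <-> glued b a.
Proof.
rewrite -glueE /=; case: (cid _) => phi /= ->.
by [].
Qed.

Lemma theta_disc (M : primsub n) :
  disc (tX (theta M)) = disc (sublattice M) /\ disc (tY (theta M)) = disc (sublattice M).
Proof.
have [S [uS memM memP]] := primsub_structure M.
by split=> //; rewrite /= -(XY_disc uS memM memP).
Qed.

Lemma theta_primitive (M : primsub n) :
  primitive_lattice (sublattice M) <-> triple_primitive (theta M).
Proof.
have [S [uS memM memP]] := primsub_structure M.
by split=> [pM|[]//]; split=> //; apply/(XY_primitive uS memM memP).
Qed.

End Theta.

Section IsoSpan.
Variables (X X' : qlattice) (f : {linear qspace X -> qspace X'}).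
Hypothesis fi : lattice_iso f.

Lemma lattice_iso_span x : in_span x -> in_span (f x).
Proof.
case: fi => -[_ fm] _ [k k0 kx]; exists k => //.
by apply/fm; exists (x *~ k) => //; rewrite raddfMz.
Qed.

Lemma lattice_iso_form x y : in_span x -> in_span y -> qform (f x) (f y) = qform x y.
Proof.
case: fi => _ ff [k k0 kx] [l l0 ly].
have k0' : k%:~R != 0 :> rat by rewrite intr_eq0.
have l0' : l%:~R != 0 :> rat by rewrite intr_eq0.
apply: (mulfI k0'); apply: (mulfI l0').
have sc (Z : qlattice) (z w : qspace Z) :
    l%:~R * (k%:~R * qform z w) = qform (z *~ k) (w *~ l).
  by rewrite [in RHS]qformMzl [in RHS]qform_sym [in RHS]qformMzl [in RHS]qform_sym; ring.
by rewrite !sc -!raddfMz ff.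
Qed.

Lemma even_lattice_iso n : even_lattice n X -> even_lattice n X'.
Proof.
move=> [[b bX] ev nd]; have [bX' eg] := lattice_iso_basis bX fi.
split; first by exists (map_tuple f b).
  have [G [eG _ evG]] := gram_int bX ev.
  by apply: even_integral_gram bX' _ evG; rewrite eg.
by apply/(gram_unit bX'); rewrite eg; apply/(gram_unit bX).
Qed.
End IsoSpan.

(** * Isometries of [U^n] and proper equivalences *)

Section Hyp.
Variable n : nat.

Lemma hyp_nondeg (x : 'M[rat]_(n, 2)) :
  (forall y, y \in hyp n -> hyp_form x y = 0) -> x = 0.
Proof.
move=> H; have J0 : hc x *m hypJ rat n = 0.
  apply/rowP => j; have jU : hv (delta_mx 0 j) \in hyp n.
    by apply/in_hypP; exists (delta_mx 0 j); rewrite /ratm map_delta_mx.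
  have := H _ jU; rewrite -{1}[x]hcK hyp_form_hv trmx_delta -colE mxE => ->.
  by rewrite mxE.
rewrite -[x]hcK -[hc x]mulmx1 -(hypJJ rat n) mulmxA J0 mul0mx; exact: raddf0.
Qed.

(** The component of [x] in the span of the complement is orthogonal to the complement, hence zero
    by nondegeneracy; then primitivity puts [x] in [M]. *)
Lemma perp_perp (M : primsub n) (x : 'M[rat]_(n, 2)) : x \in hyp n ->
  (forall c, c \in perp M -> hyp_form x c = 0) -> x \in psub M.
Proof.
move=> xU xP; have [b [a [bs as_ ex]]] := span_decomp M x.
have [_ _ nd] := perp_even M.
have a0 : a = 0.
  have [k k0 ka] := as_; have k0' : k%:~R != 0 :> rat by rewrite intr_eq0.
  have : a *~ k = 0.
    apply: (nd _ ka) => c cP; rewrite /= /scale_form; apply/eqP;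
      rewrite mulf_eq0 oppr_eq0 oner_eq0 /=.
    rewrite [X in X == _](@qformMzl (hyp n) k) mulf_eq0 (negPf k0') /=; apply/eqP.
    have := xP c cP; rewrite ex [LHS](@qformDl (hyp n)) /= (span_orth bs) ?add0r //.
    exact: (@in_span_mem (scale (-1) (perp M))).
  by move/eqP; rewrite -scaler_int scaler_eq0 (negPf k0') => /eqP.
have {}ex : x = b by rewrite ex a0 addr0.
by case: bs => k k0; rewrite -ex; exact: psub_torsionfree.
Qed.

Lemma glue_linear (M : primsub n) (V : vectType rat)
    (f g : {linear 'M[rat]_(n, 2) -> V}) :
  exists F : {linear 'M[rat]_(n, 2) -> V},
    forall (b : qspace (sublattice M)) (a : qspace (scale (-1) (perp M))),
      in_span b -> in_span a ->
      F ((b : 'M[rat]_(n, 2)) + (a : 'M[rat]_(n, 2))) = f b + g a.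
Proof.
have [S [uS memM memP]] := primsub_structure M.
pose W := col_mx (ratm (usubmx S)) (ratm (perp_rows S)).
have uW : W \in unitmx by exact: W_unit uS memM.
pose c := [tuple of map f (hrows (ratm (usubmx S))) ++ map g (hrows (ratm (perp_rows S)))].
have fW : free (hrows W).
  by apply: free_lcomb => u v; rewrite !lcomb_hrows => /hv_inj/(can_inj (mulmxK uW)).
have [F HF] := basis_linear c fW.
exists F => b a /(spanX uS memM)[u ->] /(spanY uS memP)[v ->].
rewrite -linearD -mul_row_col -/W /= -lcomb_hrows HF.
rewrite -!lcomb_hrows /lcomb big_split_ord /=; congr (_ + _).
  rewrite linear_sum; apply: eq_bigr => i _; rewrite linearZ row_mxEl; congr (_ *: _).
  by rewrite tnth_lshift tnth_map.
rewrite linear_sum; apply: eq_bigr => i _; rewrite linearZ row_mxEr; congr (_ *: _).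
by rewrite tnth_rshift tnth_map.
Qed.

Lemma O_equiv_proper (M M' : primsub n) : O_equiv M M' -> proper_equiv (theta M) (theta M').
Proof.
move=> [f [[fj fm] ff] fM].
have fU x : x \in hyp n -> f x \in hyp n by move=> xU; apply/fm; exists x.
have fX : @lattice_iso (sublattice M) (sublattice M') f.
  split; last by move=> x y /psub_sub xU /psub_sub yU; exact: ff.
  by split=> [x y /psub_sub xU /psub_sub yU|y]; [exact: fj | exact: fM].
have fY : @lattice_iso (scale (-1) (perp M)) (scale (-1) (perp M')) f.
  split; last first.
    by move=> x y /asboolP[xU _] /asboolP[yU _]; rewrite /= /scale_form;
      congr (_ * _); exact: ff.
  split=> [x y /asboolP[xU _] /asboolP[yU _]|y]; first exact: fj.
  split=> [/asboolP[/fm[x xU ->] xM]|[x /asboolP[xU xM] ->]].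
    exists x => //; apply/asboolP; split=> // m mM.
    rewrite -[LHS](ff x m xU (psub_sub mM)); apply: xM.
    by apply/fM; exists m.
  apply/asboolP; split; first exact: fU.
  by move=> _ /fM[m mM ->]; rewrite [LHS](ff x m xU (psub_sub mM)); exact: xM.
exists f, f, fX, fY => a.
rewrite -(dclass_repr a); set al := repr a.
have [be g] := glue_right al.
rewrite -(proj2 (theta_phiE be al) g) [in LHS]discr_mapE [in RHS]discr_mapE.
apply/esym/theta_phiE; rewrite /glued !dual_map_val -raddfD.
exact: fU.
Qed.

Lemma proper_O_equiv (M M' : primsub n) : proper_equiv (theta M) (theta M') -> O_equiv M M'.
Proof.
move=> [f [g [fi [gi H]]]].
have [F HF] := glue_linear M f g.
have [f' [fi' [f'f ff']]] := lattice_iso_inv (psub_even_lattice M) fi.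
have [g' [gi' [g'g gg']]] := lattice_iso_inv (perp_even M) gi.
have Fform x y : hyp_form (F x) (F y) = hyp_form x y.
  have [b [a [bs as_ ->]]] := span_decomp M x.
  have [b' [a' [bs' as' ->]]] := span_decomp M y.
  rewrite !HF // [LHS](@qformDl (hyp n)) !(@qformDr (hyp n)) /=.
  rewrite [RHS](@qformDl (hyp n)) !(@qformDr (hyp n)) /=.
  have o1 := span_orth (lattice_iso_span fi bs) (lattice_iso_span gi as').
  have o2 := span_orth (lattice_iso_span fi bs') (lattice_iso_span gi as_).
  rewrite [hyp_form (g a) (f b')]hyp_form_sym o1 o2 addr0 add0r.
  rewrite (span_orth bs as') [hyp_form a b']hyp_form_sym (span_orth bs' as_) addr0 add0r.
  have e1 := lattice_iso_form fi bs bs'.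
  have := lattice_iso_form gi as_ as'; rewrite /= /scale_form !mulN1r => /oppr_inj e2.
  by congr (_ + _).
have Fglue b a : glued b a -> glued (dual_map fi b) (dual_map gi a).
  move=> /theta_phiE e; apply/theta_phiE.
  by rewrite -[X in tphi _ X](discr_mapE gi) H -e discr_mapE.
have FU x : x \in hyp n -> F x \in hyp n.
  move=> /[dup] xU /(glue_decomp M)[b [a ex]].
  rewrite ex HF; try exact: dual_val_span.
  by apply: Fglue; rewrite /glued -ex.
have FM x : x \in psub M -> F x = f x.
  move=> xM; rewrite -[x in LHS]addr0 HF ?raddf0 ?addr0 //.
    exact: (@in_span_mem (sublattice M)).
  exact/in_span_mem/rpred0.
exists F.
  split; last by move=> x y _ _; exact: Fform.
  split=> [x y xU yU e|y].
    (* Since [F] preserves the form, the difference of two vectors with equal images is orthogonal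
       to [U^n]. *)
    apply/eqP; rewrite -subr_eq0; apply/eqP/hyp_nondeg => z zU.
    have -> : hyp_form (x - y) z = hyp_form (F x - F y) (F z).
      by rewrite -Fform (raddfB F x y).
    by rewrite [F x]e subrr [LHS](@qform0l (hyp n)).
  split=> [/[dup] yU /(glue_decomp M')[b' [a' ey]]|[x xU ->]]; last exact: FU.
  pose b := dual_map fi' b'; pose a := dual_map gi' a'.
  have g0 : glued b a.
    apply/theta_phiE; apply: (can_inj (discr_map_cancel fi fi' f'f)).
    rewrite -[RHS]H -discr_mapE discr_map_cancel // -discr_mapE discr_map_cancel //.
    by apply/theta_phiE; rewrite /glued -ey.
  exists (dual_val b + dual_val a); first exact: g0.
  rewrite HF; try exact: dual_val_span.
  by rewrite /b /a !dual_map_val ff' ?gg' //; exact: dual_val_span.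
case: fi {H f' fi' f'f ff' Fglue Fform HF} FM => -[_ fm] _ FM y.
by rewrite fm; split=> -[x xM ->]; exists x => //; rewrite FM.
Qed.

(** * The anti-isometry and the involution on triples *)

Section Xi.
Variable xi : {linear qspace (hyp n) -> qspace (hyp n)}.
Hypothesis xi_anti : anti_isometry xi.

Lemma xi_mem x : x \in hyp n -> xi x \in hyp n.
Proof. by case: xi_anti => -[_ xm] _ xU; apply/xm; exists x. Qed.

Lemma xi_form x y : x \in hyp n -> y \in hyp n ->
  hyp_form (xi x) (xi y) = - hyp_form x y.
Proof.
case: xi_anti => _ xf xU yU.
have sq (u v : 'M[rat]_(n, 2)) :
    hyp_form (u + v) (u + v) = hyp_form u u + hyp_form v v + 2 * hyp_form u v.
  rewrite [LHS](@qformDl (hyp n)) !(@qformDr (hyp n)) /= (hyp_form_sym v u).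
  by ring.
have := xf (x + y) (rpredD xU yU).
rewrite (raddfD xi x y) [LHS]sq [X in _ = - X]sq !xf //.
by lra.
Qed.

(** The complement of [xi(M)] is [xi(M^perp)]. The subgroup [Z] is not yet a primitive sublattice,
    because [xi_image_exists] uses this isomorphism to prove that it is an even lattice. *)
Lemma xi_perp_iso (M : primsub n) (Z : zmodClosed 'M[rat]_(n, 2)) :
  (forall y, y \in Z <-> y \in hyp n /\ forall x, x \in psub M -> hyp_form y (xi x) = 0) ->
  @lattice_iso (scale (-1) (perp M)) (sublattice Z) xi.
Proof.
move=> HZ; have [[xj xm] xf] := xi_anti; split; last first.
  by move=> x y /asboolP[xU _] /asboolP[yU _]; rewrite /= /scale_form mulN1r;
    exact: xi_form.
split=> [x y /asboolP[xU _] /asboolP[yU _]|y]; first exact: xj.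
rewrite [X in X <-> _]HZ; split=> [[/xm[x xU ->] xM]|[x /asboolP[xU xM] ->]].
  exists x => //; apply/asboolP; split=> // m mM.
  by apply: oppr_inj; rewrite oppr0 -(xi_form xU (psub_sub mM)); exact: xM.
split; first exact: xi_mem.
by move=> m mM; rewrite (xi_form xU (psub_sub mM)) xM ?oppr0.
Qed.

(** By [xi_perp_iso], a vector [xi x] orthogonal to [M^xi] has [x] orthogonal to [M^perp], and the
    double complement of [M] is [M]. *)
Lemma xi_sub_iso (M M' : primsub n) : is_xi_image xi M M' ->
  @lattice_iso (sublattice M) (scale (-1) (perp M')) xi.
Proof.
move=> HM; have [[xj xm] xf] := xi_anti.
have [[_ pm] _] := xi_perp_iso HM.
split; last first.
  move=> x y /psub_sub xU /psub_sub yU; rewrite /= /scale_form mulN1r.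
  by rewrite -[RHS]opprK; congr (- _); exact: xi_form.
split=> [x y /psub_sub xU /psub_sub yU|y]; first exact: xj.
split=> [/asboolP[/xm[x xU ->] xM]|[x xM ->]].
  exists x => //; apply: perp_perp => // c cP.
  have cU : c \in hyp n by case/asboolP: cP.
  apply: oppr_inj; rewrite oppr0 -(xi_form xU cU); apply: xM.
  by apply/pm; exists c.
apply/asboolP; split; first exact: xi_mem (psub_sub xM).
by move=> m /HM[mU mM]; rewrite hyp_form_sym; exact: mM.
Qed.

(** For [b + a] in [U^n] the image [xi a + xi b] is again in [U^n], but [xi a] is now the component
    on the side of [M^xi]: the graph of [phi(M)] is transposed. *)
Lemma xi_image_sigma (M M' : primsub n) : is_xi_image xi M M' ->
  proper_equiv (sigma (theta M)) (theta M').
Proof.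
move=> HM; exists xi, xi, (xi_perp_iso HM), (xi_sub_iso HM) => b.
rewrite -(dclass_repr b); set be := repr b.
have [al g] := glue_left be.
have e : disc_inv (tphi (theta M)) (dclass be) = dclass al.
  by rewrite (proj2 (theta_phiE be al) g) disc_funK.
rewrite [X in _ = discr_map _ X]e [in LHS]discr_mapE [in RHS]discr_mapE.
apply/esym/theta_phiE; rewrite /glued !dual_map_val -raddfD; apply: xi_mem.
by rewrite addrC.
Qed.

Definition xi_pred (M : primsub n) : {pred 'M[rat]_(n, 2)} := fun y =>
  `[< y \in hyp n /\ forall x, x \in psub M -> hyp_form y (xi x) = 0 >].

Lemma xi_pred_closed M : zmod_closed (xi_pred M).
Proof.
split.
  by apply/asboolP; split=> [|y _]; [exact: rpred0 | exact: (@qform0l (hyp n))].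
move=> x y /asboolP[xU xM] /asboolP[yU yM]; apply/asboolP; split.
  exact: rpredB.
by move=> z zM; rewrite [LHS](@qformBl (hyp n)) /= xM // yM // subrr.
Qed.

HB.instance Definition _ M := GRing.isZmodClosed.Build 'M[rat]_(n, 2)
  (xi_pred M) (xi_pred_closed M).

Lemma xi_image_exists (M : primsub n) : exists M' : primsub n, is_xi_image xi M M'.
Proof.
have HZ y : y \in xi_pred M <->
    y \in hyp n /\ forall x, x \in psub M -> hyp_form y (xi x) = 0.
  by split=> [/asboolP|H]; last exact/asboolP.
have sub x : x \in xi_pred M -> x \in hyp n by move/HZ => [].
have tf (x : 'M[rat]_(n, 2)) (k : int) : x \in hyp n -> k != 0 ->
    x *~ k \in xi_pred M -> x \in xi_pred M.
  move=> xU k0 /HZ[_ H]; apply/HZ; split=> // y yM.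
  have := H y yM; rewrite [LHS](@qformMzl (hyp n) k) => /eqP.
  by rewrite mulf_eq0 intr_eq0 (negPf k0) => /eqP.
have ev : even_lattice n (sublattice (xi_pred M)).
  exact: (even_lattice_iso (xi_perp_iso HZ) (perp_even M)).
by exists (PrimSub sub tf ev) => y; exact: HZ.
Qed.

End Xi.
End Hyp.

(** * Surjectivity *)

Section LatticeBasis.

Lemma subgroup_Mz (V : zmodType) (H : V -> Prop) : H 0 ->
  (forall u v, H u -> H v -> H (u - v)) -> forall u (q : int), H u -> H (u *~ q).
Proof.
move=> H0 HB u q Hu.
have HN v : H v -> H (- v) by rewrite -[- v]add0r; exact: HB.
have Hn k : H (u *+ k).
  by elim: k => // k IH; rewrite mulrSr -[X in H (_ + X)]opprK; apply: HB => //; exact: HN.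
case: q => k; first exact: Hn.
by rewrite NegzE mulrNz; apply: HN; exact: Hn.
Qed.

(** The first coordinates of [H] form a subgroup of [N^-1 Z], generated by [d = k / N] with [k > 0]
    least; vectors with first coordinate 0 are handled by induction. The resulting basis is block
    triangular, as in Hermite's normal form. *)
Lemma lattice_basis m (H : 'rV[rat]_m -> Prop) (N : int) : N != 0 ->
  (forall u v, H u -> H v -> H (u - v)) -> (forall c, H (ratm c)) ->
  (forall v, H v -> exists c, N%:~R *: v = ratm c) ->
  exists2 A : 'M[rat]_m, A \in unitmx &
    forall v, H v <-> exists c, v = ratm c *m A.
Proof.
move=> N0; elim: m H => [|m IH]; last rewrite -[m.+1]/(1 + m)%N; move=> H Hsub Hi Hb.
  exists 1%:M; first exact: unitmx1.
  move=> v; split=> [_|[c ->]]; first by exists 0; rewrite !thinmx0.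
  by rewrite mulmx1.
have H00 : H 0 by rewrite -(ratm0 1 (1 + m)).
have HMz := subgroup_Mz H00 Hsub.
have HD u v : H u -> H v -> H (u + v).
  by move=> Hu Hv; rewrite -[v]opprK; apply: (Hsub) => //; rewrite -[- v]add0r; exact: Hsub.
have rowB k (x y : 'M[rat]_(1, k)) (a c : 'rV[rat]_1) :
    row_mx a x - row_mx c y = row_mx (a - c) (x - y).
  by rewrite opp_row_mx add_row_mx.
have [A0 uA0 HA0] : exists2 A : 'M[rat]_m, A \in unitmx &
    forall v, H (row_mx 0 v) <-> exists c, v = ratm c *m A.
  apply: (IH (fun v => H (row_mx 0 v))) => [u v Hu Hv|c|v Hv].
  - by have := Hsub _ _ Hu Hv; rewrite rowB subrr.
  - by have := Hi (row_mx 0 c); rewrite /ratm map_row_mx map_mx0.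
  have [c ec] := Hb _ Hv; exists (rsubmx c).
  by rewrite /ratm map_rsubmx -/(ratm c) -ec scale_row_mx row_mxKr.
pose D (a : rat) := exists v, H (row_mx a%:M v).
have DB a c : D a -> D c -> D (a - c).
  move=> [v Hv] [w Hw]; exists (v - w); have := Hsub _ _ Hv Hw.
  by rewrite rowB -raddfB.
have D1 : D 1.
  exists 0; have := Hi (row_mx 1%:M 0).
  by rewrite /ratm map_row_mx map_mx0 map_mx1.
have D0 : D 0 by rewrite -(subrr 1); exact: DB.
have DMz := subgroup_Mz D0 DB.
have NQ : N%:~R != 0 :> rat by rewrite intr_eq0.
pose P := fun k : nat => `[< (0 < k)%N /\ D (k%:R / N%:~R) >].
have exP : exists k, P k.
  exists `|N|%N; apply/asboolP; split; first by rewrite absz_gt0.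
  have -> : `|N|%:R / N%:~R = 1 *~ sgz N :> rat.
    rewrite pmulrn abszEsg intrM mulfK //.
  exact: DMz.
case: (ex_minnP exP) => k /asboolP[k0 Dk] kmin.
set d := k%:R / N%:~R in Dk; have [w Hw] := Dk.
have d0 : d != 0 by rewrite mulf_neq0 ?invr_eq0 // pnatr_eq0 -lt0n.
have Dd a : D a -> exists q : int, a = d *~ q.
  move=> Da; have [v Hv] := Da; have [c ec] := Hb _ Hv.
  have ea : a = (c 0 0)%:~R / N%:~R.
    have := congr1 (fun M : 'rV_(1 + m) => M 0 (lshift m 0)) ec.
    rewrite mxE row_mxEl !mxE eqxx mulr1n lshift0 => <-.
    by rewrite mulrC mulKf.
  set z := c 0 0 in ea; exists (z %/ k)%Z.
  pose r := (z %% k)%Z.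
  have r0 : 0 <= r by rewrite modz_ge0 //; lia.
  have rk : r < k%:Z by apply: ltz_pmod.
  have er : a - d *~ (z %/ k)%Z = r%:~R / N%:~R.
    have -> : r = z - (z %/ k)%Z * k%:Z by apply/eqP; rewrite eq_sym subr_eq addrC -divz_eq.
    by rewrite ea /d intrB intrM -mulrzr -pmulrn; field.
  have Dr : D (`|r|%:R / N%:~R).
    have -> : `|r|%:R = r%:~R :> rat by rewrite pmulrn gez0_abs.
    by rewrite -er; apply: DB => //; exact: DMz.
  have [r00|rp] := posnP `|r|%N.
    move: er; have -> : r = 0 by lia.
    by rewrite mul0r => /eqP; rewrite subr_eq0 => /eqP.
  have := kmin `|r|%N; rewrite /P => le.
  have : (k <= `|r|)%N by apply: le; apply/asboolP.
  by lia.
pose A : 'M[rat]_(1 + m) := block_mx d%:M w 0 A0.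
exists A.
  by rewrite unitmxE det_ublock det_scalar1 unitrM unitfE d0 -unitmxE uA0.
move=> v; split=> [Hv|[c ->]].
  have [q eq] : exists q : int, lsubmx v = d%:M *~ q.
    have ev : lsubmx v = (lsubmx v 0 0)%:M by exact: mx11_scalar.
    have [q eq] : exists q, lsubmx v 0 0 = d *~ q.
      by apply: Dd; exists (rsubmx v); rewrite -ev hsubmxK.
    by exists q; rewrite ev eq raddfMz.
  have : H (v - row_mx d%:M w *~ q) by apply: Hsub => //; exact: HMz.
  rewrite -{1}[v]hsubmxK -!scaler_int scale_row_mx rowB scaler_int -eq subrr.
  move=> /HA0[c ec]; exists (row_mx q%:M c).
  rewrite /A /ratm map_row_mx map_scalar_mx mul_row_block mulmx0 addr0 -ec.
  rewrite !mul_scalar_mx scaler_int -eq addrC subrK hsubmxK //.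
rewrite -[c]hsubmxK /ratm map_row_mx mul_row_block mulmx0 addr0.
have -> : map_mx intr (lsubmx c) = ((c 0 0)%:~R)%:M :> 'M[rat]_1.
  by apply/rowP => i; rewrite !ord1 !mxE eqxx mulr1n lshift0.
rewrite !mul_scalar_mx -[X in row_mx X _]addr0 -add_row_mx -scale_row_mx; apply: HD.
  by rewrite scaler_int; exact: HMz.
by apply/HA0; exists (rsubmx c).
Qed.

End LatticeBasis.

Definition row_lattice n k (S : 'M[rat]_(k, n + n)) : {pred 'M[rat]_(n, 2)} :=
  fun x => `[< exists c, x = hv (ratm c *m S) >].

Lemma row_lattice_closed n k (S : 'M[rat]_(k, n + n)) : zmod_closed (row_lattice S).
Proof.
split; first by apply/asboolP; exists 0; rewrite ratm0 mul0mx raddf0.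
move=> x y /asboolP[c ->] /asboolP[d ->]; apply/asboolP; exists (c - d).
by rewrite ratmB mulmxBl raddfB.
Qed.

HB.instance Definition _ n k S := GRing.isZmodClosed.Build 'M[rat]_(n, 2)
  (@row_lattice n k S) (row_lattice_closed S).

(** * The even unimodular overlattice of [X] and [Y(-1)] *)

Section Overlattice.
Variables (n : nat) (t : triple n).
Let X := tX t.
Let Y := tY t.
Variables (bX : n.-tuple (qspace X)) (bY : n.-tuple (qspace Y)).
Hypotheses (hbX : Zbasis bX) (hbY : Zbasis bY).

Let Xeven : even_integral X. Proof. by case: (tX_even t). Qed.
Let Yeven : even_integral Y. Proof. by case: (tY_even t). Qed.

(* The graph of phi as a subgroup of X^* (+) Y^*, in coordinates. *)
Definition overlattice (w : 'rV[rat]_(n + n)) : Prop :=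
  exists (b : dual X) (a : dual Y), [/\ dual_val b = lcomb bX (lsubmx w),
    dual_val a = lcomb bY (rsubmx w) & dclass b = tphi t (dclass a)].

Definition over_form : 'M[rat]_(n + n) := block_mx (gram bX) 0 0 (- gram bY).

Lemma over_formE (w w' : 'rV[rat]_(n + n)) :
  (w *m over_form *m w'^T) 0 0 =
  qform (lcomb bX (lsubmx w)) (lcomb bX (lsubmx w')) -
  qform (lcomb bY (rsubmx w)) (lcomb bY (rsubmx w')).
Proof.
rewrite -{1}[w]hsubmxK -{1}[w']hsubmxK tr_row_mx mul_row_block mul_row_col.
rewrite !mulmx0 addr0 add0r mulmxN mulNmx !qform_gram.
by rewrite mxE [X in _ + X]mxE.
Qed.

Lemma over_form_sym : over_form^T = over_form.
Proof. by rewrite /over_form tr_block_mx !trmx0 linearN /= !gram_sym. Qed.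

Lemma tphi0 : tphi t 0 = 0.
Proof. by have := disc_additive (tphi t) 0 0; rewrite !subrr. Qed.

Lemma dclass_mem (Z : qlattice) (a : dual Z) : dual_val a \in Z -> dclass a = 0.
Proof.
by move=> aZ; rewrite -[RHS](raddf0 (\pi_(Quotient.quot (dual_lat Z))%qT));
  apply/dclass_eq; rewrite subr0.
Qed.

Lemma dclass0_mem (Z : qlattice) (a : dual Z) : dclass a = 0 -> dual_val a \in Z.
Proof.
rewrite -[X in _ = X](raddf0 (\pi_(Quotient.quot (dual_lat Z))%qT)) => /dclass_eq.
by rewrite subr0.
Qed.

Lemma mem_dual (Z : qlattice) z : even_integral Z -> z \in Z -> z \in dual_pred Z.
Proof.
move=> [Zi _] zZ; apply/dual_predP; split; first exact: in_span_mem.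
by move=> x xZ; exact: Zi.
Qed.

Lemma overB u v : overlattice u -> overlattice v -> overlattice (u - v).
Proof.
move=> [b [a [eb ea e]]] [b' [a' [eb' ea' e']]]; exists (b - b'), (a - a'); split.
- by rewrite /= eb eb' !raddfB.
- by rewrite /= ea ea' !raddfB.
by rewrite !dclassB disc_additive e e'.
Qed.

Lemma over_int c : overlattice (ratm c).
Proof.
have bM : lcomb bX (lsubmx (ratm c)) \in X.
  by apply/(Zbasis_mem hbX); exists (lsubmx c); rewrite /ratm map_lsubmx.
have aM : lcomb bY (rsubmx (ratm c)) \in Y.
  by apply/(Zbasis_mem hbY); exists (rsubmx c); rewrite /ratm map_rsubmx.
exists (Dual (mem_dual Xeven bM)), (Dual (mem_dual Yeven aM)); split=> //.
by rewrite !dclass_mem // tphi0.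
Qed.

Lemma over_even w : overlattice w -> exists k : int, (w *m over_form *m w^T) 0 0 = 2
  * k%:~R.
Proof.
move=> [b [a [eb ea e]]]; rewrite over_formE -eb -ea.
have : discr_form (dclass b) = discr_form (dclass a) by rewrite e disc_isometry.
move=> /(dclass_form_eq _ _ Xeven Yeven)/intrP[k ek]; exists k; rewrite -ek.
by field.
Qed.

(** By polarization, twice the pairing is a combination of the even norms of [w], [w'] and
    [w - w']. *)
Lemma over_integral w w' : overlattice w -> overlattice w' ->
  (w *m over_form *m w'^T) 0 0 \is a Num.int.
Proof.
move=> ow ow'; have := overB ow ow' => /over_even[k ek].
have [k1 ek1] := over_even ow; have [k2 ek2] := over_even ow'.
apply/intrP; exists (k1 + k2 - k); rewrite intrB intrD.
have es : (w' *m over_form *m w^T) 0 0 = (w *m over_form *m w'^T) 0 0.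
  by rewrite -(tr_form _ _ over_form_sym) mxE.
move: ek; have -> : (w - w') *m over_form *m (w - w')^T =
    w *m over_form *m w^T - w *m over_form *m w'^T
    - (w' *m over_form *m w^T - w' *m over_form *m w'^T).
  by rewrite linearB /= !mulmxBl !mulmxBr.
have ent (P Q R S : 'M[rat]_1) : (P - Q - (R - S)) 0 0 = P 0 0 - Q 0 0 - (R 0 0 - S 0 0).
  by rewrite !mxE.
rewrite ent es ek1 ek2; lra.
Qed.

Lemma dual_dual (Z : qlattice) m (b : m.-tuple (qspace Z)) u : Zbasis b ->
  gram b \in unitmx ->
  (forall z : dual Z, qform (lcomb b u) (dual_val z) \is a Num.int) ->
  exists c, u = ratm c.
Proof.
move=> bZ ug H; apply/ratm_intP => i j; rewrite ord1.
pose v : 'rV[rat]_m := delta_mx 0 j *m invmx (gram b).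
have vd : lcomb b v \in dual_pred Z.
  apply/(Zbasis_dual bZ); exists (delta_mx 0 j).
  by rewrite mulmxKV // /ratm map_delta_mx.
have := H (Dual vd); rewrite /= qform_gram /v trmx_mul trmx_inv gram_sym.
by rewrite mulmxA mulmxK // trmx_delta -colE mxE.
Qed.

Lemma gramX_unit : gram bX \in unitmx.
Proof. by case: (tX_even t) => _ _ /(gram_unit hbX). Qed.

Lemma gramY_unit : gram bY \in unitmx.
Proof. by case: (tY_even t) => _ _ /(gram_unit hbY). Qed.

(** Pairing with [X] and [Y] shows that both components of [z] are dual vectors. Let [b1] represent
    the image of [a] under the isometry. Then [b - b1] pairs integrally with all of [X^*], because
    every dual vector of [X] occurs in the overlattice, and so it lies in [X]. *)
Lemma over_self_dual z : (forall w, overlattice w -> (z *m over_form *m w^T) 0 0 \is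
  a Num.int) ->
  overlattice z.
Proof.
move=> Hz.
have xd : lcomb bX (lsubmx z) \in dual_pred X.
  apply/dual_predP; split; first by apply/(Zbasis_span hbX); exists (lsubmx z).
  move=> _ /(Zbasis_mem hbX)[c ->]; have := Hz _ (over_int (row_mx c 0)).
  by rewrite over_formE /ratm map_row_mx row_mxKl row_mxKr map_mx0 raddf0 qform0r subr0.
have yd : lcomb bY (rsubmx z) \in dual_pred Y.
  apply/dual_predP; split; first by apply/(Zbasis_span hbY); exists (rsubmx z).
  move=> _ /(Zbasis_mem hbY)[c ->]; have := Hz _ (over_int (row_mx 0 c)).
  rewrite over_formE /ratm map_row_mx row_mxKl row_mxKr map_mx0 raddf0 qform0r sub0r.
  by rewrite rpredN.
pose b := Dual xd; pose a := Dual yd.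
pose b1 := repr (tphi t (dclass a));
  have eb1 : dclass b1 = tphi t (dclass a) by exact: dclass_repr.
have /(Zbasis_span hbX)[x1 ex1] := dual_val_span b1.
have ow1 : overlattice (row_mx x1 (rsubmx z)).
  by exists b1, a; rewrite row_mxKl row_mxKr.
have [c ec] : exists c, lsubmx z - x1 = ratm c.
  apply: (dual_dual hbX gramX_unit) => b'.
  pose a' := repr (disc_inv (tphi t) (dclass b')).
  have ea' : tphi t (dclass a') = dclass b' by rewrite dclass_repr disc_invK.
  have /(Zbasis_span hbX)[x' ex'] := dual_val_span b'.
  have /(Zbasis_span hbY)[y' ey'] := dual_val_span a'.
  have ow' : overlattice (row_mx x' y') by exists b', a'; rewrite row_mxKl row_mxKr.
  have := rpredB (Hz _ ow') (over_integral ow1 ow').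
  by rewrite !over_formE !row_mxKl !row_mxKr -ex' opprB addrA subrK raddfB qformBl.
exists b, a; split=> //; rewrite -eb1; apply/dclass_eq => /=.
by rewrite ex1 -raddfB ec; apply/(Zbasis_mem hbX); exists c.
Qed.

(** By the adjugate, the determinant of the Gram matrix multiplies a dual lattice into the lattice;
    this is the denominator bound that [lattice_basis] asks for. *)
Lemma over_bound : exists2 N : int, N != 0 &
  forall w, overlattice w -> exists c, N%:~R *: w = ratm c.
Proof.
have [GX [eGX _ _]] := gram_int hbX Xeven; have [GY [eGY _ _]] := gram_int hbY Yeven.
have dX : \det GX != 0.
  by have := gramX_unit; rewrite eGX unitmxE ratm_det unitfE intr_eq0.
have dY : \det GY != 0.
  by have := gramY_unit; rewrite eGY unitmxE ratm_det unitfE intr_eq0.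
have adj (G : 'M[int]_n) (u : 'rV[rat]_n) c : u *m ratm G = ratm c ->
    (\det G)%:~R *: u = ratm (c *m \adj G).
  by move=> e; rewrite ratmM -e -mulmxA -ratmM mul_mx_adj /ratm map_scalar_mx mul_mx_scalar.
exists (\det GX * \det GY); first by rewrite mulf_neq0.
move=> w [b [a [eb ea _]]].
have := dual_valP b; rewrite eb => /(Zbasis_dual hbX)[c ec].
have := dual_valP a; rewrite ea => /(Zbasis_dual hbY)[d ed].
exists (row_mx (\det GY *: (c *m \adj GX)) (\det GX *: (d *m \adj GY))).
rewrite -[w]hsubmxK scale_row_mx /ratm map_row_mx -!/(ratm _) !ratmZ.
rewrite eGX in ec; rewrite eGY in ed;
  rewrite -(adj _ _ _ ec) -(adj _ _ _ ed) !scalerA intrM.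
by rewrite [X in row_mx (X *: _)]mulrC.
Qed.

(** The basis [Z] dual to [A] lies in the overlattice by [over_self_dual], so its coordinates [C] in
    the basis [A] are integral, and [C] is the inverse of [g]. *)
Lemma over_unimodular : exists (A : 'M[rat]_(n + n)) (g : 'M[int]_(n + n)),
  [/\ A \in unitmx, forall w, overlattice w <-> exists c, w = ratm c *m A,
      A *m over_form *m A^T = ratm g, g^T = g & g \in unitmx /\ even_mx g].
Proof.
have [N N0 HN] := over_bound.
have [A uA HA] := lattice_basis N0 overB over_int HN.
have rowA (c : 'rV[int]_(n + n)) : overlattice (ratm c *m A) by apply/HA; exists c.
have [g eg] : exists g, A *m over_form *m A^T = ratm g.
  apply/ratm_intP => i j.
  have := over_integral (rowA (delta_mx 0 i)) (rowA (delta_mx 0 j)).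
  rewrite /ratm !map_delta_mx trmx_mul trmx_delta !mulmxA -colE -!mulmxA -rowE.
  by rewrite !mxE.
have gs : g^T = g.
  by apply: ratm_inj; rewrite ratmT -eg !trmx_mul trmxK over_form_sym mulmxA.
exists A, g; split=> //; split; last first.
  move=> v; have [k ek] := over_even (rowA v); exists k.
  apply: (@intr_inj rat); rewrite intrM -ek trmx_mul.
  have -> : ratm v *m A *m over_form *m (A^T *m (ratm v)^T) =
      ratm v *m (A *m over_form *m A^T) *m (ratm v)^T by rewrite !mulmxA.
  by rewrite eg -ratmT -!ratmM [RHS]mxE.
have uQ : over_form \in unitmx.
  rewrite unitmxE det_ublock unitrM -!unitmxE gramX_unit -scaleN1r unitmxE detZ unitrM.
  by rewrite -unitmxE gramY_unit unitrX ?unitrN1.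
have ug : ratm g \in unitmx by rewrite -eg !unitmx_mul uA uQ unitmx_tr uA.
pose Z := invmx (ratm g) *m A.
have ZA : Z *m over_form *m A^T = 1%:M.
  by rewrite /Z -!mulmxA (mulmxA A) eg mulVmx.
have /choice[c Hc] : forall i, exists c : 'rV[int]_(n + n), row i Z = ratm c *m A.
  move=> i; apply/HA/over_self_dual => w /HA[c ->].
  rewrite trmx_mul.
  have -> : row i Z *m over_form *m (A^T *m (ratm c)^T) =
      row i (Z *m over_form *m A^T) *m (ratm c)^T by rewrite !row_mul !mulmxA.
  by rewrite ZA row1 -rowE !mxE intr_int.
pose C : 'M[int]_(n + n) := \matrix_i c i.
have eZ : Z = ratm C *m A.
  apply/row_matrixP => i; rewrite Hc row_mul; congr (_ *m _).
  by apply/rowP => j; rewrite !mxE.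
have : g *m C = 1%:M.
  apply: ratm_inj; rewrite ratmM ratm1 -(mulmxK uA (ratm C)) -eZ /Z.
  by rewrite mulmxK // mulmxV.
by case/mulmx1_unit.
Qed.

End Overlattice.

Lemma gram_signature (n p q : nat) (X : qlattice) (b : n.-tuple (qspace X)) :
  Zbasis b -> has_signature X p q ->
  exists (c : n.-tuple (qspace X)) (P : 'M[rat]_n) (d : 'rV[rat]_n),
    [/\ Zbasis c, P \in unitmx, P *m gram c *m P^T = diag_mx d,
        (forall i, d 0 i != 0) & \sum_i Num.sg (d 0 i) = p%:R - q%:R].
Proof.
move=> bX [m [c [P [d [cX uP HP d0 [-> ->]]]]]].
have [em _] := Zbasis_change bX cX; subst m.
by exists c, P, d; split=> //; case: (sg_sum_count d0).
Qed.

Lemma theta_surjective n (t : triple n) :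
  exists M : primsub n, proper_equiv (theta M) t.
Proof.
have [[bX0 hbX0] _ _] := tX_even t; have [[bY0 hbY0] _ _] := tY_even t.
have [p [q [sX sY]]] := t_sign t.
have [bX [P [d [hbX uP HP d0 sd]]]] := gram_signature hbX0 sX.
have [bY [Q [e [hbY uQ HQ e0 se]]]] := gram_signature hbY0 sY.
have [A [g [uA HA eg gs [ug evg]]]] := over_unimodular hbX hbY.
(* Over [Q] the overlattice is [X] plus [Y(-1)], and the sign sums of [X] and [Y] cancel as their
   signatures agree. *)
have sg0 : signature_zero g.
  exists (block_mx P 0 0 Q *m invmx A), (row_mx d (- e)); split.
  - by rewrite unitmx_mul unitmx_inv uA unitmxE det_ublock unitrM -!unitmxE uP uQ.
  - rewrite -/(ratm g) -eg trmx_mul.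
    have -> : block_mx P 0 0 Q *m invmx A *m (A *m over_form bX bY *m A^T) *m
        ((invmx A)^T *m (block_mx P 0 0 Q)^T) =
        block_mx P 0 0 Q *m (invmx A *m A) *m over_form bX bY *m
        (invmx A *m A)^T *m (block_mx P 0 0 Q)^T by rewrite [(invmx A *m
          A)^T]trmx_mul !mulmxA.
    rewrite mulVmx // mulmx1 trmx1 mulmx1 /over_form tr_block_mx !trmx0 !mulmx_block.
    rewrite !(mulmx0, mul0mx, addr0, add0r) HP diag_mx_row.
    by congr block_mx; rewrite mulmxN mulNmx HQ; apply/esym; exact: raddfN.
  - by move=> i; case: (split_ordP i) => j ->; rewrite ?row_mxEl ?row_mxEr // mxE oppr_eq0.
  rewrite big_split_ord /=.
  have -> : \sum_(i < n) Num.sg (row_mx d (- e) 0 (lshift n i)) = \sum_i Num.sg (d 0 i).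
    by apply: eq_bigr => i _; rewrite row_mxEl.
  have -> : \sum_(i < n) Num.sg (row_mx d (- e) 0 (rshift n i)) = - \sum_i Num.sg (e 0 i).
    by rewrite -sumrN; apply: eq_bigr => i _; rewrite row_mxEr mxE sgrN.
  by rewrite sd se subrr.
have [C1 [C2 [C11 C22 C12]]] := hyperbolic_basis (addnn n) gs ug evg sg0.
pose C : 'M[int]_(n + n) := col_mx C1 C2.
have CJ : C *m g *m C^T = hypJ int n.
  rewrite /C tr_col_mx mul_col_mx mul_col_row C11 C22 C12.
  by rewrite -[C2 *m g *m C1^T](tr_form _ _ gs) C12 trmx1.
have uC : C \in unitmx.
  have := hypJ_unit n; rewrite -CJ !unitmx_mul.
  by case/andP => /andP[].
pose T := ratm C *m A.
have uT : T \in unitmx by rewrite unitmx_mul uA ratm_unit.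
have HT w : overlattice bX bY w <-> exists c, w = ratm c *m T.
  rewrite HA; split=> [[c ->]|[c ->]].
    by exists (c *m invmx C); rewrite /T mulmxA -ratmM mulmxKV.
  by exists (c *m C); rewrite ratmM mulmxA.
have TJ : T *m over_form bX bY *m T^T = hypJ rat n.
  rewrite -ratm_hypJ -CJ !ratmM ratmT -eg /T trmx_mul.
  by rewrite !mulmxA.
clearbody T; pose Ti := invmx T; have uTi : Ti \in unitmx by rewrite unitmx_inv.
have TiJ : Ti *m hypJ rat n *m Ti^T = over_form bX bY.
  rewrite -TJ /Ti trmx_inv -!mulmxA mulKmx // mulmxV ?unitmx_tr // mulmx1 //.
(* The rows of [Ti] are the images in [U^n] of the bases [bX] and [bY]: [S1] will span [M], and [S2]
   its complement. *)
pose S1 := usubmx Ti; pose S2 := dsubmx Ti.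
have blocks : [/\ S1 *m hypJ rat n *m S1^T = gram bX, S1 *m hypJ rat n *m S2^T = 0
    & S2 *m hypJ rat n *m S2^T = - gram bY].
  move: TiJ; rewrite -{1 2}[Ti]vsubmxK tr_col_mx mul_col_mx mul_col_row.
  by case/eq_block_mx.
have [S11 S12 S22] := blocks.
have hvT (c : 'rV[rat]_(n + n)) : hv c = hv (lsubmx (c *m T) *m S1 + rsubmx (c *m T) *m S2).
  by rewrite -mul_row_col hsubmxK vsubmxK mulmxK.
(* An element of the graph with zero [Y] component has trivial class on the [X] side. This makes [X]
   primitive in the overlattice; injectivity of the isometry does the same for [Y]. *)
have over_l u : overlattice bX bY (row_mx u 0) -> exists c, u = ratm c.
  move=> [b [a []]]; rewrite row_mxKl row_mxKr raddf0 => eb ea e'.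
  apply/(Zbasis_memE hbX); rewrite -eb; apply: dclass0_mem; rewrite e' dclass_mem ?tphi0 //.
  by rewrite ea rpred0.
have over_r v : overlattice bX bY (row_mx 0 v) -> exists c, v = ratm c.
  move=> [b [a []]]; rewrite row_mxKl row_mxKr raddf0 => eb ea e'.
  apply/(Zbasis_memE hbY); rewrite -ea; apply: dclass0_mem.
  apply: (can_inj (disc_funK (tphi t))); rewrite -e' tphi0 dclass_mem //.
  by rewrite eb rpred0.
have Ti_int u v : overlattice bX bY (row_mx u v) <-> hv (u *m S1 + v *m S2) \in hyp n.
  rewrite HT hv_hyp -mul_row_col vsubmxK.
  split=> -[c ec]; exists c; first by rewrite ec mulmxK.
  by rewrite -ec mulmxKV.
have fS1 : row_free S1 by exact: usubmx_free.
have fS2 : row_free S2 by exact: dsubmx_free.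
have memM x : x \in row_lattice S1 <-> exists c, x = hv (ratm c *m S1).
  by split=> [/asboolP|H]; last exact/asboolP.
have bM : @Zbasis (sublattice (row_lattice S1)) n (hrows S1) by exact: hrows_Zbasis.
have gM : @gram (sublattice (row_lattice S1)) n (hrows S1) = gram bX.
  by rewrite gram_hrows.
have Msub x : x \in row_lattice S1 -> x \in hyp n.
  move=> /memM[c ->]; have := over_int hbX hbY (row_mx c 0).
  by rewrite /ratm map_row_mx map_mx0 => /Ti_int; rewrite mul0mx addr0.
have Mtf (x : 'M[rat]_(n, 2)) (k : int) : x \in hyp n -> k != 0 ->
    x *~ k \in row_lattice S1 -> x \in row_lattice S1.
  move=> xU k0 /memM[c ec]; have k0' : k%:~R != 0 :> rat by rewrite intr_eq0.
  have ex : x = hv ((k%:~R^-1 *: ratm c) *m S1).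
    by rewrite -scalemxAl linearZ /= -ec -scaler_int scalerA mulVf // scale1r.
  have /over_l[c' ec'] : overlattice bX bY (row_mx (k%:~R^-1 *: ratm c) 0).
    by apply/Ti_int; rewrite mul0mx addr0 -ex.
  by apply/memM; exists c'; rewrite ex ec'.
have [fX HfX] := basis_linear (hrows S1) (proj1 hbX).
have Mev : even_lattice n (sublattice (row_lattice S1)).
  have fXi : @lattice_iso (tX t) (sublattice (row_lattice S1)) fX.
    exact: basis_lattice_iso hbX bM (esym gM) HfX.
  by have := even_lattice_iso fXi (tX_even t).
pose M := PrimSub Msub Mtf Mev.
have memP x : x \in perp M <-> exists c, x = hv (ratm c *m S2).
  split=> [/asboolP[/in_hypP[c ->] xM]|[c ->]].
    pose w := ratm c *m T.
    (* Pairing with [M] only sees the [X] coordinates, through the invertible Gram matrix of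
       [bX]. *)
    have w0 : lsubmx w = 0.
      apply: (can_inj (mulmxK (gramX_unit hbX))); rewrite mul0mx.
      apply/rowP => j; have jM : hv (ratm (delta_mx 0 j) *m S1) \in row_lattice S1.
        by apply/memM; exists (delta_mx 0 j).
      have := xM _ jM; rewrite hvT hyp_form_hv /ratm map_delta_mx trmx_mul trmx_delta.
      rewrite mulmxA -colE !mulmxDl -!mulmxA (mulmxA S1) S11 (mulmxA S2).
      have -> : S2 *m hypJ rat n *m S1^T = 0.
        by rewrite -(tr_form _ _ (hypJ_sym rat n)) S12 trmx0.
      rewrite mulmx0 addr0 mxE => ->.
      by rewrite mxE.
    have /over_r[c' ec'] : overlattice bX bY (row_mx 0 (rsubmx w)).
      by rewrite -w0 hsubmxK; apply/HT; exists c.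
    by exists c'; rewrite hvT -/w w0 mul0mx add0r ec'.
  apply/asboolP; split.
    have := over_int hbX hbY (row_mx 0 c).
    by rewrite /ratm map_row_mx map_mx0 => /Ti_int; rewrite mul0mx add0r.
  move=> y /memM[c' ->];
    rewrite hyp_form_hv trmx_mul -!mulmxA (mulmxA (hypJ rat n)) (mulmxA S2) (mulmxA S2).
  have -> : S2 *m hypJ rat n *m S1^T = 0.
    by rewrite -(tr_form _ _ (hypJ_sym rat n)) S12 trmx0.
  by rewrite mul0mx mulmx0 mxE.
have bP : @Zbasis (scale (-1) (perp M)) n (hrows S2).
  exact: (@hrows_Zbasis _ _ _ (perp_pred M) fS2 memP).
have gP : @gram (scale (-1) (perp M)) n (hrows S2) = gram bY.
  apply: oppr_inj; rewrite -S22 -(gram_hrows S2 (perp_pred M)).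
  by apply/matrixP => i j; rewrite !mxE /= /scale_form mulN1r opprK.
have [f Hf] := basis_linear bX (proj1 bM).
have [h Hh] := basis_linear bY (proj1 bP).
have fi : @lattice_iso (sublattice M) (tX t) f by exact: basis_lattice_iso bM hbX gM Hf.
have hi : @lattice_iso (scale (-1) (perp M)) (tY t) h by exact: basis_lattice_iso bP
  hbY gP Hh.
exists M, f, h, fi, hi => a.
rewrite -(dclass_repr a); set al := repr a.
have [be gl] := glue_right al.
rewrite -[X in discr_map fi X](proj2 (theta_phiE be al) gl).
rewrite [in LHS]discr_mapE [in RHS]discr_mapE.
have /(Zbasis_span bM)[u eu] := dual_val_span be.
have /(Zbasis_span bP)[v ev] := dual_val_span al.
(* By [Ti_int], membership in [U^n] is membership in the overlattice, that is in the graph of the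
   given isometry. *)
have [b1 [a1 [eb1 ea1 e1]]] : overlattice bX bY (row_mx u v).
  apply/Ti_int; move: gl; rewrite /glued eu ev !lcomb_hrows.
  by rewrite -linearD.
rewrite row_mxKl row_mxKr in eb1 ea1.
have -> : dclass (dual_map fi be) = dclass b1.
  by apply/dclass_eq; rewrite dual_map_val eu Hf eb1 subrr rpred0.
rewrite e1; congr (tphi t _).
by apply/dclass_eq; rewrite dual_map_val ev Hh ea1 subrr rpred0.
Qed.

(** * The bijections *)

Lemma classes_eq (T : Type) (R : T -> T -> Prop) (C D : classes R) :
  (forall x, sval C x <-> sval D x) -> C = D.
Proof.
case: C D => [C hC] [D hD] /= e.
have eCD : C = D by apply/funext => x; apply/propext.
by subst D; congr exist; exact: Prop_irrelevance.
Qed.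

(** The equivalence between [R] and [S] along [th] gives both well-definedness and injectivity on
    classes. [F] and its inverse [G] choose representatives, and the [S] laws make the choice
    irrelevant. *)
Lemma descends_bijection n (th : primsub n -> triple n)
    (R : primsub n -> primsub n -> Prop) (S : triple n -> triple n -> Prop) :
  (forall t, S t t) -> (forall t t', S t t' -> S t' t) ->
  (forall t t' t'', S t t' -> S t' t'' -> S t t'') ->
  (forall M M', R M M' <-> S (th M) (th M')) ->
  (forall t, exists M, S (th M) t) ->
  (forall M t, S (th M) t -> triple_has_disc t (disc (sublattice M)) /\
    (primitive_lattice (sublattice M) <-> triple_primitive t)) ->
  exists F : classes R -> classes S, descends_to_bijection th F /\ preserves F.
Proof.
move=> S1 Ss St RS surj inv.
have hC (C : classes R) : exists M, sval C = R M by case: C.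
have hD (D : classes S) : exists M, forall t, sval D t <-> S (th M) t.
  case: D => D [t e]; have [M Mt] := surj t; exists M => u /=; rewrite {}e.
  by split; apply: St => //; exact: Ss.
pose F C := class_of S (th (projT1 (cid (hC C)))).
pose G D := class_of R (projT1 (cid (hD D))).
have FE (C : classes R) M : sval C = R M -> F C = class_of S (th M).
  rewrite /F; case: (cid _) => M' /= -> e.
  have RM : S (th M') (th M) by apply/RS; rewrite e; apply/RS.
  by apply: classes_eq => t /=; split; apply: St => //; exact: Ss.
exists F; split; last first.
  move=> C M t CM; have [M0 e0] := hC C; rewrite (FE C M0 e0) /= => Ht.
  apply: inv; apply: St Ht; apply/Ss/RS.
  by rewrite -e0.
split; first by move=> M; exact: FE.
exists G => [C|D].
  have [M e] := hC C; rewrite (FE C M e) /G; case: (cid _) => M' /= HM'.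
  apply: classes_eq => M'' /=; rewrite e !RS.
  have RM : S (th M) (th M') by apply/HM'.
  by split; apply: St => //; exact: Ss.
rewrite /G; case: (cid _) => M /= HM; rewrite (FE _ M) //.
by apply: classes_eq => t /=; rewrite HM.
Qed.

Lemma O_equivE n (M M' : primsub n) :
  O_equiv M M' <-> proper_equiv (theta M) (theta M').
Proof. by split; [exact: O_equiv_proper | exact: proper_O_equiv]. Qed.

Lemma proper_equiv_invariants n (M : primsub n) (t : triple n) :
  proper_equiv (theta M) t -> triple_has_disc t (disc (sublattice M)) /\
    (primitive_lattice (sublattice M) <-> triple_primitive t).
Proof.
move=> H; have [dX dY] := proper_equiv_disc H; have [eX eY] := theta_disc M.
split; first by split; rewrite -?dX -?dY ?eX ?eY.
by rewrite theta_primitive; exact: proper_equiv_primitive.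
Qed.

Lemma sigma_equiv_invariants n (t t' : triple n) : sigma_equiv t t' ->
  (forall d, triple_has_disc t d <-> triple_has_disc t' d) /\
  (triple_primitive t <-> triple_primitive t').
Proof.
elim=> {t t'} [t t' [H|->]|t|t t' _ [H1 H2]|t t' t'' _ [H1 H2] _ [H3 H4]].
- have [dX dY] := proper_equiv_disc H.
  by split; [move=> d; rewrite /triple_has_disc dX dY | exact: proper_equiv_primitive].
- by split=> [d|]; split=> -[].
- by [].
- by split=> [d|]; rewrite ?H1 ?H2.
by split=> [d|]; rewrite ?H1 ?H2.
Qed.

Section XiSigma.
Variables (n : nat) (xi : {linear qspace (hyp n) -> qspace (hyp n)}).
Hypothesis xi_anti : anti_isometry xi.

Lemma xi_equiv_sigma (M M' : primsub n) :
  O_xi_equiv xi M M' -> sigma_equiv (theta M) (theta M').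
Proof.
elim=> {M M'} [M M' [H|H]|M|M M' _ H|M M' M'' _ H1 _ H2].
- by apply: rst_step; left; apply/O_equivE.
- apply: (rst_trans _ _ _ (sigma (theta M))); first by apply: rst_step; right.
  by apply: rst_step; left; exact (xi_image_sigma xi_anti H).
- exact: rst_refl.
- exact: rst_sym.
exact: rst_trans H1 H2.
Qed.

(** The triples inside a chain need not be values of [theta], so the induction ranges over all lifts
    up to proper equivalence; at a transitivity step surjectivity supplies the lift of the middle
    triple. *)
Lemma sigma_equiv_xi (t t' : triple n) : sigma_equiv t t' ->
  forall M M', proper_equiv (theta M) t -> proper_equiv (theta M') t' ->
    O_xi_equiv xi M M'.
Proof.
have step N N' u : proper_equiv (theta N) u -> proper_equiv (theta N') u ->
    O_xi_equiv xi N N'.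
  move=> H H'; apply: rst_step; left; apply/O_equivE.
  exact: proper_equiv_trans H (proper_equiv_sym H').
elim=> [u u' [H|->]|u|u u' _ IH|u u' u'' _ IH1 _ IH2] M M' HM HM'.
- exact: step (proper_equiv_trans HM H) HM'.
- have [Mx Hx] := xi_image_exists xi_anti M.
  apply: (rst_trans _ _ _ Mx); first by apply: rst_step; right.
  apply: (step _ _ (sigma u)) => //.
  apply: proper_equiv_trans (proper_equiv_sigma HM).
  exact: proper_equiv_sym (xi_image_sigma xi_anti Hx).
- exact: step HM HM'.
- by apply: rst_sym; exact: IH.
have [N HN] := theta_surjective u'.
exact: rst_trans (IH1 _ _ HM HN) (IH2 _ _ HN HM').
Qed.

End XiSigma.

Theorem theorem4p8 (n : nat) (n_ge1 : (1 <= n)%N)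
    (xi : {linear qspace (hyp n) -> qspace (hyp n)})
    (xi_anti : anti_isometry xi) :
  exists theta : primsub n -> triple n,
    (forall M : primsub n, is_theta M (theta M)) /\
    (exists F : classes (@O_equiv n) -> classes (@proper_equiv n),
       descends_to_bijection theta F /\ preserves F) /\
    (exists F : classes (O_xi_equiv xi) -> classes (@sigma_equiv n),
       descends_to_bijection theta F /\ preserves F).
Proof.
exists (@theta n); split; first exact: theta_is_theta.
split.
  apply: descends_bijection.
  - exact: proper_equiv_refl.
  - exact: proper_equiv_sym.
  - exact: proper_equiv_trans.
  - exact: O_equivE.
  - exact: theta_surjective.
  exact: proper_equiv_invariants.
apply: descends_bijection.
- by move=> t; exact: rst_refl.
- by move=> t t'; exact: rst_sym.
- by move=> t t' t''; exact: rst_trans.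
- move=> M M'; split; first exact: xi_equiv_sigma.
  by move=> H; apply: (sigma_equiv_xi xi_anti H); exact: proper_equiv_refl.
- move=> t; have [M H] := theta_surjective t; exists M.
  by apply: rst_step; left.
move=> M t H; have [Hd Hp] := sigma_equiv_invariants H.
have [d0 p0] := proper_equiv_invariants (proper_equiv_refl (theta M)).
by split; [apply/Hd | rewrite p0].
Qed.
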